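(* Let $x,y,z\in\mathbb{C}^*$ with $|q|<|y|<1$ and $|q|<|z|<1$, and suppose $x$ is not an integral power of $q$. Then $$\begin{aligned} \Big(\sum_{s,t\ge 0}-\sum_{s,t<0}\Big)\frac{q^{st}y^sz^t}{1-xq^{s+t}} &=\frac{(yz,q^2/yz;q^2)_\infty}{(y,z,q/y,q/z;q)_\infty}\frac{(q;q)_\infty^2}{(q^2;q^2)_\infty}\sum_{k\in\mathbb{Z}}\frac{(-1)^kq^{k^2}(yz)^k}{1+q^{2k}x}\\ &\quad+\frac{(xy,q^2/xy;q^2)_\infty}{(x,y,q/x,q/y;q)_\infty}\frac{(q;q)_\infty^2}{(q^2;q^2)_\infty}\sum_{k\in\mathbb{Z}}\frac{(-1)^kq^{k^2}(xy)^k}{1+q^{2k}z}\\ &\quad+\frac{(xz,q^2/xz;q^2)_\infty}{(x,z,q/x,q/z;q)_\infty}\frac{(q;q)_\infty^2}{(q^2;q^2)_\infty}\sum_{k\in\mathbb{Z}}\frac{(-1)^kq^{k^2}(xz)^k}{1+q^{2k}y}\\ &\quad-2\,\frac{(q^2;q^2)_\infty^3}{(x,y,z,q/x,q/y,q/z;q)_\infty}\cdot\frac{(xy,xz,yz,q^2/xy,q^2/xz,q^2/yz;q^2)_\infty}{(-x,-y,-z,-q^2/x,-q^2/y,-q^2/z;q^2)_\infty}. \end{aligned}$$ At the points $x=-q^{2n}$ ($n\in\mathbb{Z}$), where individual terms on the right have poles that cancel in the sum, the right-hand side is understood as its limit (removable singularity).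
   Context: $q$ is a fixed complex number with $0<|q|<1$, and $\mathbb{C}^*=\mathbb{C}\setminus\{0\}$. $(x;q)_\infty=\prod_{i\ge0}(1-q^ix)$ and $(a_1,\dots,a_n;q)_\infty=\prod_{i=1}^n(a_i;q)_\infty$. Expressions such as $q^2/yz$ mean $q^2/(yz)$. Sums run over integers, and $\big(\sum_{s,t\ge0}-\sum_{s,t<0}\big)a_{s,t}$ means $\sum_{s,t\ge0}a_{s,t}-\sum_{s,t<0}a_{s,t}$. *)

(* Defs.v *)
From Stdlib Require Import Reals ZArith List.
From Coquelicot Require Import Coquelicot.

Open Scope C_scope.

Definition Cpowz (c : C) (n : Z) : C :=
  match n with
  | Z0 => 1
  | Zpos p => c ^ Pos.to_nat p
  | Zneg p => / (c ^ Pos.to_nat p)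
  end.

Fixpoint Cprod (f : nat -> C) (n : nat) : C :=
  match n with
  | O => 1
  | S m => Cprod f m * f m
  end.

(* (a; p)_oo *)
Definition qpoch (a p : C) : C :=
  iota (T := C_CompleteNormedModule) (fun l : C =>
    filterlim (fun n : nat => Cprod (fun i => 1 - p ^ i * a) n)
              eventually (locally l)).

(* (a_1, ..., a_n; p)_oo *)
Definition qpochs (s : list C) (p : C) : C :=
  fold_right (fun a r => qpoch a p * r) 1 s.

Definition Csum_list {I : Type} (a : I -> C) (F : list I) : C :=
  fold_right (fun i r => a i + r) 0 F.

(* The filter of finite subsets of A directed by inclusion, a finite subset
   being represented by a duplicate-free list.  Convergence along it is
   unconditional summation, so that no enumeration of Z or Z * Z is chosen. *)
Definition finite_subsets {I : Type} (A : I -> Prop) (P : list I -> Prop) : Prop :=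
  exists F0 : list I, List.Forall A F0 /\
    forall F : list I, NoDup F -> List.Forall A F -> incl F0 F -> P F.

Definition is_sum_over {I : Type} (A : I -> Prop) (a : I -> C) (l : C) : Prop :=
  filterlim (Csum_list a) (finite_subsets A) (locally l).

Definition ex_sum_over {I : Type} (A : I -> Prop) (a : I -> C) : Prop :=
  exists l : C, is_sum_over A a l.

Definition sum_over {I : Type} (A : I -> Prop) (a : I -> C) : C :=
  iota (T := C_CompleteNormedModule) (fun l : C => is_sum_over A a l).

Definition nonneg2 (i : Z * Z) : Prop := (0 <= fst i)%Z /\ (0 <= snd i)%Z.
Definition neg2 (i : Z * Z) : Prop := (fst i < 0)%Z /\ (snd i < 0)%Z.
Definition all_Z (k : Z) : Prop := True.

Definition double_term (q x y z : C) (i : Z * Z) : C :=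
  let (s, t) := i in
  Cpowz q (s * t) * Cpowz y s * Cpowz z t / (1 - x * Cpowz q (s + t)).

Definition lhs (q x y z : C) : C :=
  sum_over nonneg2 (double_term q x y z) - sum_over neg2 (double_term q x y z).

Definition single_term (q w c : C) (k : Z) : C :=
  Cpowz (-1) k * Cpowz q (k * k) * Cpowz w k / (1 + Cpowz q (2 * k) * c).

(* The first three summands of the right-hand side are
   single_part q y z x, single_part q x y z and single_part q x z y. *)
Definition single_part (q a b c : C) : C :=
  qpochs (a * b :: q ^ 2 / (a * b) :: nil) (q ^ 2)
  / qpochs (a :: b :: q / a :: q / b :: nil) q
  * (qpoch q q ^ 2 / qpoch (q ^ 2) (q ^ 2))
  * sum_over all_Z (single_term q (a * b) c).

Definition product_part (q x y z : C) : C :=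
  2 * (qpoch (q ^ 2) (q ^ 2) ^ 3
       / qpochs (x :: y :: z :: q / x :: q / y :: q / z :: nil) q)
  * (qpochs (x * y :: x * z :: y * z
             :: q ^ 2 / (x * y) :: q ^ 2 / (x * z) :: q ^ 2 / (y * z) :: nil) (q ^ 2)
     / qpochs (- x :: - y :: - z
               :: - (q ^ 2 / x) :: - (q ^ 2 / y) :: - (q ^ 2 / z) :: nil) (q ^ 2)).

(* At x = - q^(2n) some denominators vanish and this is a junk value; there
   only its limit is meaningful. *)
Definition rhs (q x y z : C) : C :=
  single_part q y z x + single_part q x y z + single_part q x z y
  - product_part q x y z.

(* Main.v *)
Require Import Defs.
From Stdlib Require Import Reals ZArith List.
From Coquelicot Require Import Coquelicot.
From Stdlib Require Import Permutation ClassicalEpsilon Lra Lia Psatz FunctionalExtensionality.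

Open Scope C_scope.

(** Write [t_p(a) = (a; p)_oo (p / a; p)_oo], [J_p = (p; p)_oo] and [Q = q^2].  Both sides of the
    identity are, as functions of [x], partial fraction series with poles at the powers of [q], and
    the proof compares residues; no complex function theory is used, only rearrangements of absolutely
    convergent families.

    The left-hand side is [sum_n A_n / (1 - x q^n)], where [A_n] collects the indices with [s + t = n]
    ([lhs_diag]); one has [A_0 = 1], [A_(-1) = 0] and
    [A_(n+2) = q^(n+1) y z A_n + y^(n+2) + z^(n+2)] ([diag_sum_rec]), which determines [A_n].

    On the right, let [K_y(x) = sum_n y^n / (1 - x q^n)] be Kronecker's series, equal to
    [J_q^2 t_q(x y) / (t_q(x) t_q(y))] ([kron_eq]), and let
    [S(a, w) = sum_k (-1)^k Q^(k(k-1)/2) a^k / (1 - w Q^k)] be the Appell-Lerch sum.  Since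
    [t_q(a) = t_Q(a) t_Q(q a)], the second single sum is [K_y(x)] times
    [S(q x y, - z) / (J_Q t_Q(q x y))], the third is obtained by exchanging [y] and [z], and the product term is [K_y(x)] times a theta quotient in [x].
    The symmetry of the Appell-Lerch sum ([appell_sym]) and the expansion of such theta quotients
    ([thp_quotient_appell]) write the second factors as partial fraction series in [x] with rapidly
    decreasing coefficients.  The product of two partial fraction series is split term by term by
    [1 / ((1-u)(1-v)) = 1 / ((1-u)(1-v/u)) + 1 / ((1-v)(1-u/v))] ([kron_mult_pfrac]).  The poles at
    [x y = q^(odd)] disappear because [K_y] vanishes there, and the poles of the product term at
    [x = - Q^n] reproduce the first single sum ([kron_theta_quot]).  What remains is
    [sum_n B_n / (1 - x q^n)]; the shift rules of [S] and [t_Q] show that [B_n] obeys the recurrence of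
    [A_n] ([rhs_residue_rec]), and [B_0 = 1], [B_(-1) = 0] are two further cases of
    [thp_quotient_appell].

    The theta facts needed are Jacobi's triple product and the partial fractions of [1 / t_p(a)].  Both
    are limits of finite identities with the weights [1 / ((p; p)_(N-n) (p; p)_(N+n))], which follow by
    induction on [N] ([finite_theta_prod], [finite_pfrac_prod]); the limits are taken by Tannery's
    theorem ([Sum_dominated]).

    The computation assumes that [x y] and [x z] are not odd powers of [q] and that [x] is not of the
    form [- Q^n].  Such exceptional points are isolated and the left-hand side is continuous in [x], so
    the identity extends to them by continuity of the right-hand side, or as a limit where the latter
    has removable singularities. *)


(** * Limits in the complex plane *)

(** Convergence of [f] to [l] along the filter [F], measured by the modulus. *)
Definition clim {T : Type} (F : (T -> Prop) -> Prop) (f : T -> C) (l : C) : Prop :=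
  forall eps : R, (0 < eps)%R -> F (fun t => (Cmod (f t - l) < eps)%R).

Lemma clim_filterlim {T : Type} (F : (T -> Prop) -> Prop) {FF : Filter F}
  (f : T -> C) (l : C) : clim F f l <-> filterlim f F (locally l).
Proof.
  split.
  - intros H P [eps HP]. unfold filtermap.
    apply (filter_imp (fun t => (Cmod (f t - l) < eps)%R)).
    + intros t Ht. apply HP. apply C_NormedModule_mixin_compat1. exact Ht.
    + apply H, cond_pos.
  - intros H eps Heps.
    assert (Hs : (0 < sqrt 2)%R) by (apply sqrt_lt_R0; lra).
    assert (He : (0 < eps / sqrt 2)%R) by (apply Rdiv_lt_0_compat; lra).
    apply (H (fun u => (Cmod (u - l) < eps)%R)).
    exists (mkposreal _ He). intros u Hu.
    assert (H1 := C_NormedModule_mixin_compat2 l u (mkposreal _ He) Hu).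
    simpl in H1. replace (sqrt 2 * (eps / sqrt 2))%R with eps in H1 by (field; lra).
    exact H1.
Qed.

Lemma half_pos (e : R) : (0 < e)%R -> (0 < e / 2)%R.
Proof. lra. Qed.

Lemma third_pos (e : R) : (0 < e)%R -> (0 < e / 3)%R.
Proof. lra. Qed.

Lemma Cmod_minus_sym (a b : C) : Cmod (a - b) = Cmod (b - a).
Proof. rewrite <- (Cmod_opp (a - b)). f_equal. ring. Qed.

Lemma Cmod_triangle_sub (a b c : C) : (Cmod (a - c) <= Cmod (a - b) + Cmod (b - c))%R.
Proof. replace (a - c) with ((a - b) + (b - c)) by ring. apply Cmod_triangle. Qed.

Lemma Cmod_triangle_inv (a b : C) : (Cmod a - Cmod b <= Cmod (a - b))%R.
Proof.
  assert (H := Cmod_triangle (a - b) b).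
  replace (a - b + b) with a in H by ring. lra.
Qed.

Lemma Cmod_le_eps_eq (a b : C) :
  (forall eps : R, (0 < eps)%R -> (Cmod (a - b) <= eps)%R) -> a = b.
Proof.
  intros H. assert (H0 : Cmod (a - b) = 0%R).
  { destruct (Rle_lt_or_eq_dec _ _ (Cmod_ge_0 (a - b))) as [h|h]; [|easy].
    specialize (H (Cmod (a - b) / 2)%R ltac:(lra)). lra. }
  apply Cmod_eq_0 in H0. replace a with (a - b + b) by ring. rewrite H0. ring.
Qed.

Section Clim.
Context {T : Type} (F : (T -> Prop) -> Prop).

Lemma clim_unique {FF : ProperFilter F} f l m : clim F f l -> clim F f m -> l = m.
Proof.
  intros Hl Hm. apply Cmod_le_eps_eq. intros eps He.
  destruct (filter_ex _ (filter_and _ _ (Hl _ (half_pos _ He)) (Hm _ (half_pos _ He))))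
    as [t [H1 H2]].
  rewrite Cmod_minus_sym in H1.
  assert (H := Cmod_triangle_sub l (f t) m). lra.
Qed.

Context {FF : Filter F}.

Lemma clim_const c : clim F (fun _ => c) c.
Proof.
  intros eps He. apply filter_forall. intros _.
  replace (c - c) with (RtoC 0) by ring. rewrite Cmod_0. easy.
Qed.

Lemma clim_ext_loc f g l : F (fun t => f t = g t) -> clim F f l -> clim F g l.
Proof.
  intros H Hf eps He. generalize (filter_and _ _ H (Hf eps He)).
  apply filter_imp. intros t [<- h]. exact h.
Qed.

Lemma clim_ext f g l : (forall t, f t = g t) -> clim F f l -> clim F g l.
Proof. intros H. apply clim_ext_loc, filter_forall, H. Qed.

Lemma clim_plus f g l m : clim F f l -> clim F g m -> clim F (fun t => f t + g t) (l + m).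
Proof.
  intros Hf Hg eps He.
  generalize (filter_and _ _ (Hf _ (half_pos _ He)) (Hg _ (half_pos _ He))).
  apply filter_imp. intros t [H1 H2].
  replace (f t + g t - (l + m)) with ((f t - l) + (g t - m)) by ring.
  assert (H := Cmod_triangle (f t - l) (g t - m)). lra.
Qed.

Lemma clim_mult f g l m : clim F f l -> clim F g m -> clim F (fun t => f t * g t) (l * m).
Proof.
  intros Hf Hg eps He.
  assert (Hl := Cmod_ge_0 l). assert (Hm := Cmod_ge_0 m).
  set (K := (1 + Cmod l + Cmod m)%R). assert (HK : (0 < K)%R) by (unfold K; lra).
  set (d := Rmin 1 (eps / K)).
  assert (Hd : (0 < d)%R) by (unfold d; apply Rmin_pos; [lra | apply Rdiv_lt_0_compat; lra]).
  assert (Hd1 : (d <= 1)%R) by apply Rmin_l.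
  assert (Hd2 : (d * K <= eps)%R).
  { apply Rle_trans with (eps / K * K)%R.
    - apply Rmult_le_compat_r; [lra | apply Rmin_r].
    - right. field. lra. }
  generalize (filter_and _ _ (Hf d Hd) (Hg d Hd)).
  apply filter_imp. intros t [H1 H2].
  replace (f t * g t - l * m) with ((f t - l) * (g t - m) + (l * (g t - m) + m * (f t - l))) by ring.
  assert (h1 := Cmod_triangle ((f t - l) * (g t - m)) (l * (g t - m) + m * (f t - l))).
  assert (h2 := Cmod_triangle (l * (g t - m)) (m * (f t - l))).
  rewrite !Cmod_mult in *.
  assert (a0 := Cmod_ge_0 (f t - l)). assert (b0 := Cmod_ge_0 (g t - m)).
  set (A := Cmod (f t - l)) in *. set (B := Cmod (g t - m)) in *.
  assert (A * B <= A * d)%R by (apply Rmult_le_compat_l; lra).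
  assert (A * d < d * 1)%R by nra.
  assert (Cmod l * B <= Cmod l * d)%R by (apply Rmult_le_compat_l; lra).
  assert (Cmod m * A <= Cmod m * d)%R by (apply Rmult_le_compat_l; lra).
  unfold K in Hd2. nra.
Qed.

Lemma clim_opp f l : clim F f l -> clim F (fun t => - f t) (- l).
Proof.
  intros H. replace (- l) with ((-(1)) * l) by ring.
  apply clim_ext with (fun t => (-(1)) * f t); [intros; ring|].
  apply clim_mult; [apply clim_const | exact H].
Qed.

Lemma clim_minus f g l m : clim F f l -> clim F g m -> clim F (fun t => f t - g t) (l - m).
Proof. intros Hf Hg. apply clim_plus; [exact Hf | apply clim_opp, Hg]. Qed.

Lemma clim_inv (f : T -> C) (l : C) : l <> 0 -> clim F f l -> clim F (fun t => / f t) (/ l).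
Proof.
  intros Hl Hf eps He. apply Cmod_gt_0 in Hl.
  set (L := Cmod l) in *.
  assert (HL : (0 < eps * (L * L) / 2)%R) by (apply half_pos; repeat apply Rmult_lt_0_compat; lra).
  generalize (filter_and _ _ (Hf _ (half_pos _ Hl))
    (Hf (eps * (L * L) / 2)%R HL)).
  apply filter_imp. intros t [H1 H2].
  assert (H3 : (L / 2 < Cmod (f t))%R).
  { assert (h := Cmod_triangle_inv l (f t)). rewrite Cmod_minus_sym in h. fold L in h. lra. }
  assert (Hf0 : f t <> 0) by (apply Cmod_gt_0; lra).
  assert (Hl0 : l <> 0) by (apply Cmod_gt_0; fold L; lra).
  replace (/ f t - / l) with ((l - f t) * / (f t * l)) by (field; tauto).
  rewrite Cmod_mult, Cmod_inv, Cmod_mult; [|apply Cmult_neq_0; assumption].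
  fold L. rewrite Cmod_minus_sym.
  assert (H4 : (L * L / 2 < Cmod (f t) * L)%R) by nra.
  apply Rle_lt_trans with (Cmod (f t - l) * / (L * L / 2))%R.
  - apply Rmult_le_compat_l; [apply Cmod_ge_0|]. apply Rinv_le_contravar; nra.
  - apply Rmult_lt_reg_r with (L * L / 2)%R; [nra|].
    rewrite Rmult_assoc, Rinv_l; [lra | nra].
Qed.

Lemma clim_div (f g : T -> C) (l m : C) : m <> 0 -> clim F f l -> clim F g m ->
  clim F (fun t => f t / g t) (l / m).
Proof. intros Hm Hf Hg. apply clim_mult; [exact Hf | apply clim_inv; assumption]. Qed.

Lemma clim_pow f l n : clim F f l -> clim F (fun t => f t ^ n) (l ^ n).
Proof.
  intros H. induction n; simpl.
  - apply clim_const.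
  - apply clim_mult; assumption.
Qed.

Lemma clim_Cpowz (f : T -> C) (l : C) n : l <> 0 -> clim F f l -> clim F (fun t => Cpowz (f t) n) (Cpowz l n).
Proof.
  intros Hl H. destruct n; simpl.
  - apply clim_const.
  - apply clim_pow, H.
  - apply clim_inv; [apply Cpow_nz, Hl | apply clim_pow, H].
Qed.

Lemma clim_Cmod_le {FP : ProperFilter F} f l M :
  F (fun t => (Cmod (f t) <= M)%R) -> clim F f l -> (Cmod l <= M)%R.
Proof.
  intros HM Hf. apply Rnot_lt_le. intros h.
  assert (h0 : (0 < Cmod l - M)%R) by lra.
  destruct (filter_ex _ (filter_and _ _ HM (Hf _ h0))) as [t [H1 H2]].
  assert (h1 := Cmod_triangle_inv l (f t)). rewrite Cmod_minus_sym in h1. lra.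
Qed.

End Clim.

(** * Unconditional sums *)

(** Classical decidability of equality, needed to remove duplicates from lists of indices. *)
Definition eq_dec_cl {I : Type} (x y : I) : {x = y} + {x <> y} :=
  excluded_middle_informative (x = y).

(** The real counterpart of [Csum_list]. *)
Definition Rsum_list {I : Type} (b : I -> R) (F : list I) : R :=
  fold_right (fun i r => (b i + r)%R) 0%R F.

Section FiniteSums.
Context {I : Type}.
Implicit Types (a : I -> C) (b : I -> R) (F G : list I).

Lemma Csum_list_app a F G : Csum_list a (F ++ G) = Csum_list a F + Csum_list a G.
Proof. induction F; simpl; [ring | rewrite IHF; ring]. Qed.

Lemma Csum_list_perm a F G : Permutation F G -> Csum_list a F = Csum_list a G.
Proof.
  induction 1; simpl; [easy | rewrite IHPermutation; easy | ring | congruence].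
Qed.

Lemma Csum_list_plus a a' F :
  Csum_list (fun i => a i + a' i) F = Csum_list a F + Csum_list a' F.
Proof. induction F; simpl; [ring | rewrite IHF; ring]. Qed.

Lemma Csum_list_scal c a F : Csum_list (fun i => c * a i) F = c * Csum_list a F.
Proof. induction F; simpl; [ring | rewrite IHF; ring]. Qed.

Lemma Csum_list_ext a a' F : (forall i, In i F -> a i = a' i) -> Csum_list a F = Csum_list a' F.
Proof.
  induction F; simpl; intros H; [easy|]. rewrite H, IHF; auto.
Qed.

Lemma Csum_list_mod_le a F : (Cmod (Csum_list a F) <= Rsum_list (fun i => Cmod (a i)) F)%R.
Proof.
  induction F; simpl.
  - rewrite Cmod_0. lra.
  - eapply Rle_trans; [apply Cmod_triangle | lra].
Qed.

Lemma Rsum_list_app b F G : Rsum_list b (F ++ G) = (Rsum_list b F + Rsum_list b G)%R.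
Proof. induction F; simpl; [ring | rewrite IHF; ring]. Qed.

Lemma Rsum_list_perm b F G : Permutation F G -> Rsum_list b F = Rsum_list b G.
Proof.
  induction 1; simpl; [easy | rewrite IHPermutation; easy | ring | congruence].
Qed.

Lemma Rsum_list_plus b b' F :
  Rsum_list (fun i => (b i + b' i)%R) F = (Rsum_list b F + Rsum_list b' F)%R.
Proof. induction F; simpl; [ring | rewrite IHF; ring]. Qed.

Lemma Rsum_list_scal c b F : Rsum_list (fun i => (c * b i)%R) F = (c * Rsum_list b F)%R.
Proof. induction F; simpl; [ring | rewrite IHF; ring]. Qed.

Lemma Rsum_list_le b b' F : (forall i, In i F -> (b i <= b' i)%R) ->
  (Rsum_list b F <= Rsum_list b' F)%R.
Proof.
  induction F; simpl; intros H; [lra|].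
  assert (h1 := H a (or_introl eq_refl)). assert (h2 := IHF (fun i hi => H i (or_intror hi))). lra.
Qed.

Lemma Rsum_list_nonneg b F : (forall i, (0 <= b i)%R) -> (0 <= Rsum_list b F)%R.
Proof. intros H. induction F; simpl; [lra|]. specialize (H a). lra. Qed.

(** A duplicate-free list containing [F0] is, up to order, [F0] followed by a list disjoint from it. *)
Lemma split_incl F0 F : NoDup F0 -> NoDup F -> incl F0 F ->
  exists F1, NoDup F1 /\ (forall i, In i F1 -> ~ In i F0) /\ incl F1 F /\ Permutation F (F0 ++ F1).
Proof.
  intros H0 HF Hi.
  set (f := fun i => if in_dec eq_dec_cl i F0 then false else true).
  assert (Hf : forall i, In i (filter f F) <-> In i F /\ ~ In i F0).
  { intros i. rewrite filter_In. unfold f. destruct (in_dec eq_dec_cl i F0); intuition congruence. }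
  exists (filter f F). split; [apply NoDup_filter, HF|]. split.
  { intros i Hin. apply Hf in Hin. tauto. }
  split. { intros i Hin. apply Hf in Hin. tauto. }
  apply NoDup_Permutation; [exact HF| |].
  - apply NoDup_app; [exact H0 | apply NoDup_filter, HF |].
    intros i h1 h2. apply Hf in h2. tauto.
  - intros i. rewrite in_app_iff, Hf.
    destruct (in_dec eq_dec_cl i F0) as [h|h]; [|tauto].
    split; [tauto | intros _; apply Hi, h].
Qed.

(** Finite sums of nonnegative terms are monotone in the set of indices. *)
Lemma Rsum_list_incl b F G : (forall i, (0 <= b i)%R) -> NoDup F -> NoDup G -> incl F G ->
  (Rsum_list b F <= Rsum_list b G)%R.
Proof.
  intros Hb HF HG Hi. destruct (split_incl F G HF HG Hi) as [F1 [_ [_ [_ Hp]]]].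
  rewrite (Rsum_list_perm b _ _ Hp), Rsum_list_app.
  assert (h := Rsum_list_nonneg b F1 Hb). lra.
Qed.

End FiniteSums.

Lemma Rsum_list_map {I K : Type} (h : I -> K) (b : K -> R) F :
  Rsum_list b (map h F) = Rsum_list (fun i => b (h i)) F.
Proof. induction F; simpl; congruence. Qed.

Lemma Csum_list_map {I K : Type} (h : I -> K) (a : K -> C) F :
  Csum_list a (map h F) = Csum_list (fun i => a (h i)) F.
Proof. induction F; simpl; congruence. Qed.

Lemma Csum_list_prod {I K : Type} (a : I * K -> C) F G :
  Csum_list a (list_prod F G) = Csum_list (fun i => Csum_list (fun k => a (i, k)) G) F.
Proof.
  induction F; simpl; [easy|]. rewrite Csum_list_app, IHF, Csum_list_map. easy.
Qed.

Lemma Rsum_list_prod {I K : Type} (a : I * K -> R) F G :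
  Rsum_list a (list_prod F G) = Rsum_list (fun i => Rsum_list (fun k => a (i, k)) G) F.
Proof.
  induction F; simpl; [easy|]. rewrite Rsum_list_app, IHF, Rsum_list_map. easy.
Qed.

Lemma Csum_list_swap {I K : Type} (a : I -> K -> C) F G :
  Csum_list (fun i => Csum_list (fun k => a i k) G) F
  = Csum_list (fun k => Csum_list (fun i => a i k) F) G.
Proof.
  induction F; simpl.
  - induction G; simpl; [easy | rewrite <- IHG; ring].
  - rewrite IHF, Csum_list_plus. easy.
Qed.

Lemma NoDup_list_prod {I K : Type} (F : list I) (G : list K) :
  NoDup F -> NoDup G -> NoDup (list_prod F G).
Proof.
  intros HF HG. induction HF as [|i F Hi HF IH]; simpl; [constructor|].
  apply NoDup_app; [| exact IH |].
  - apply FinFun.Injective_map_NoDup; [|exact HG]. intros u v; congruence.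
  - intros [i' k] h1 h2. apply in_map_iff in h1 as [k' [h1 _]].
    apply in_prod_iff in h2. injection h1 as -> ->. tauto.
Qed.

#[global] Instance finite_subsets_filter {I : Type} (A : I -> Prop) :
  ProperFilter (finite_subsets A).
Proof.
  constructor.
  - intros P [F0 [HA HP]]. exists (nodup eq_dec_cl F0). apply HP.
    + apply NoDup_nodup.
    + apply Forall_forall. intros i Hi. apply nodup_In in Hi.
      rewrite Forall_forall in HA. auto.
    + intros i Hi. apply nodup_In, Hi.
  - constructor.
    + exists nil. split; [constructor | easy].
    + intros P P' [F0 [HA HP]] [F0' [HA' HP']]. exists (F0 ++ F0'). split.
      * apply Forall_app. tauto.
      * intros F HF HAF Hi. split; [apply HP | apply HP']; auto;
          intros i h; apply Hi, in_app_iff; tauto.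
    + intros P P' H [F0 [HA HP]]. exists F0. split; auto.
Qed.

(** Families of nonnegative reals with bounded finite partial sums. *)
Definition rsummable {I : Type} (b : I -> R) : Prop :=
  exists M : R, forall F, NoDup F -> (Rsum_list b F <= M)%R.

(** Absolute summability. *)
Definition summable {I : Type} (a : I -> C) : Prop := rsummable (fun i => Cmod (a i)).

(** The full index set; [all_Z] is its instance at [Z]. *)
Definition full {I : Type} (i : I) : Prop := True.

(** [has_sum a l] is [is_sum_over full a l], stated with [clim]. *)
Definition has_sum {I : Type} (a : I -> C) (l : C) : Prop :=
  clim (finite_subsets full) (Csum_list a) l.

(** The unconditional sum over the whole index type. *)
Definition Sum {I : Type} (a : I -> C) : C := sum_over full a.

Section Summable.
Context {I : Type}.
Implicit Types (a : I -> C) (b : I -> R).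

Lemma rsummable_le b b' : (forall i, (b i <= b' i)%R) -> rsummable b' -> rsummable b.
Proof.
  intros H [M HM]. exists M. intros F HF.
  eapply Rle_trans; [apply Rsum_list_le; intros; apply H | apply HM, HF].
Qed.

Lemma rsummable_plus b b' : rsummable b -> rsummable b' -> rsummable (fun i => (b i + b' i)%R).
Proof.
  intros [M HM] [M' HM']. exists (M + M')%R. intros F HF. rewrite Rsum_list_plus.
  specialize (HM F HF). specialize (HM' F HF). lra.
Qed.

Lemma rsummable_scal c b : (0 <= c)%R -> rsummable b -> rsummable (fun i => (c * b i)%R).
Proof.
  intros Hc [M HM]. exists (c * M)%R. intros F HF. rewrite Rsum_list_scal.
  apply Rmult_le_compat_l; auto.
Qed.

Lemma summable_le a b : (forall i, (Cmod (a i) <= b i)%R) -> rsummable b -> summable a.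
Proof. apply rsummable_le. Qed.

Lemma summable_ext a a' : (forall i, a i = a' i) -> summable a -> summable a'.
Proof. intros H. apply rsummable_le. intros i. rewrite H. lra. Qed.

Lemma summable_plus a a' : summable a -> summable a' -> summable (fun i => a i + a' i).
Proof.
  intros H H'. eapply summable_le; [|apply (rsummable_plus _ _ H H')].
  intros i. apply Cmod_triangle.
Qed.

Lemma summable_scal c a : summable a -> summable (fun i => c * a i).
Proof.
  intros H. eapply summable_le; [|apply (rsummable_scal (Cmod c) _ (Cmod_ge_0 c) H)].
  intros i. rewrite Cmod_mult. lra.
Qed.

Lemma summable_bounded_mult M a a' :
  (forall i, (Cmod (a' i) <= M)%R) -> summable a -> summable (fun i => a' i * a i).
Proof.
  intros HM H. apply summable_le with (fun i => (Rmax 0 M * Cmod (a i))%R).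
  - intros i. rewrite Cmod_mult. apply Rmult_le_compat_r; [apply Cmod_ge_0|].
    eapply Rle_trans; [apply HM | apply Rmax_r].
  - apply rsummable_scal; [apply Rmax_l | exact H].
Qed.

(** Outside a suitable finite set all finite partial sums are small. *)
Lemma rsummable_tail b : (forall i, (0 <= b i)%R) -> rsummable b ->
  forall eps, (0 < eps)%R -> exists F0, NoDup F0 /\
    forall F, NoDup F -> (forall i, In i F -> ~ In i F0) -> (Rsum_list b F <= eps)%R.
Proof.
  intros Hb [M HM] eps He.
  destruct (completeness (fun s => exists F, NoDup F /\ s = Rsum_list b F)) as [L [HL1 HL2]].
  - exists M. intros s [F [HF ->]]. auto.
  - exists 0%R, nil. split; [constructor | easy].
  - destruct (classic (exists F0, NoDup F0 /\ (L - eps < Rsum_list b F0)%R)) as [[F0 [H0 H1]]|Hn].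
    + exists F0. split; [exact H0|]. intros F HF Hd.
      assert (h : (Rsum_list b (F0 ++ F) <= L)%R).
      { apply HL1. exists (F0 ++ F). split; [|easy].
        apply NoDup_app; auto. intros i h1 h2. apply (Hd i h2 h1). }
      rewrite Rsum_list_app in h. lra.
    + exfalso. assert (h : (L <= L - eps)%R); [|lra].
      apply HL2. intros s [F [HF ->]]. apply Rnot_lt_le. intros h. apply Hn. eauto.
Qed.

(** Absolutely summable families are unconditionally summable. *)
Lemma summable_ex a : summable a -> exists l, has_sum a l.
Proof.
  intros H.
  assert (h : exists l : C_CompleteNormedModule,
    filterlim (Csum_list a : list I -> C_CompleteNormedModule) (finite_subsets full) (locally l)).
  { refine (proj1 (@filterlim_locally_cauchy (list I) C_CompleteNormedModule
      (finite_subsets full) _ (Csum_list a)) _). intros eps.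
    destruct (rsummable_tail _ (fun i => Cmod_ge_0 (a i)) H (eps / 3)%R) as [F0 [H0 Ht]].
    { apply Rdiv_lt_0_compat; [apply cond_pos | lra]. }
    exists (fun F => NoDup F /\ incl F0 F). split.
    { exists F0. split; [apply Forall_forall; easy | auto]. }
    assert (Hk : forall F, NoDup F -> incl F0 F ->
      (Cmod (Csum_list a F - Csum_list a F0) <= eps / 3)%R).
    { intros F HF Hi. destruct (split_incl F0 F H0 HF Hi) as [F1 [h1 [h2 [_ h3]]]].
      rewrite (Csum_list_perm a _ _ h3), Csum_list_app.
      replace (Csum_list a F0 + Csum_list a F1 - Csum_list a F0) with (Csum_list a F1) by ring.
      eapply Rle_trans; [apply Csum_list_mod_le | apply Ht; auto]. }
    intros u v [Hu1 Hu2] [Hv1 Hv2]. apply C_NormedModule_mixin_compat1.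
    assert (e1 := Hk u Hu1 Hu2). assert (e2 := Hk v Hv1 Hv2).
    rewrite Cmod_minus_sym in e1.
    assert (e3 := Cmod_triangle_sub (Csum_list a v) (Csum_list a F0) (Csum_list a u)).
    assert (e4 := cond_pos eps).
    change (Cmod (Csum_list a v - Csum_list a u) < eps)%R. lra. }
  destruct h as [l Hl]. exists l. apply clim_filterlim; [typeclasses eauto | exact Hl].
Qed.

Lemma has_sum_is_sum_over a l : has_sum a l <-> is_sum_over full a l.
Proof. apply clim_filterlim. typeclasses eauto. Qed.

Lemma sum_over_eq (A : I -> Prop) a l : is_sum_over A a l -> sum_over A a = l.
Proof.
  intros H. unfold sum_over, is_sum_over.
  apply (@iota_filterlim_locally C_AbsRing C_CompleteNormedModule (list I) (finite_subsets A)).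
  - apply Proper_StrongProper. typeclasses eauto.
  - exact H.
Qed.

Lemma Sum_eq a l : has_sum a l -> Sum a = l.
Proof. intros H. apply sum_over_eq, has_sum_is_sum_over, H. Qed.

Lemma has_sum_Sum a : summable a -> has_sum a (Sum a).
Proof.
  intros H. destruct (summable_ex a H) as [l Hl]. rewrite (Sum_eq a l Hl). exact Hl.
Qed.

Lemma has_sum_ext a a' l : (forall i, a i = a' i) -> has_sum a l -> has_sum a' l.
Proof. intros H. apply functional_extensionality in H. subst. easy. Qed.

Lemma Sum_ext a a' : (forall i, a i = a' i) -> Sum a = Sum a'.
Proof. intros H. apply functional_extensionality in H. subst. easy. Qed.

Lemma has_sum_plus a a' l l' : has_sum a l -> has_sum a' l' ->
  has_sum (fun i => a i + a' i) (l + l').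
Proof.
  intros H H'. eapply clim_ext; [typeclasses eauto | |
    apply (clim_plus (finite_subsets full) _ _ _ _ H H')].
  intros F. simpl. now rewrite Csum_list_plus.
Qed.

Lemma has_sum_scal c a l : has_sum a l -> has_sum (fun i => c * a i) (c * l).
Proof.
  intros H. eapply clim_ext; [typeclasses eauto | |
    apply (clim_mult (finite_subsets full) (fun _ => c) _ c _ (clim_const _ c) H)].
  intros F. simpl. now rewrite Csum_list_scal.
Qed.

Lemma Sum_plus a a' : summable a -> summable a' -> Sum (fun i => a i + a' i) = Sum a + Sum a'.
Proof. intros H H'. apply Sum_eq, has_sum_plus; apply has_sum_Sum; assumption. Qed.

Lemma Sum_scal c a : summable a -> Sum (fun i => c * a i) = c * Sum a.
Proof. intros H. apply Sum_eq, has_sum_scal, has_sum_Sum, H. Qed.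

(** The error of a finite partial sum is bounded by the sums over disjoint finite sets. *)
Lemma Sum_tail a F0 eps : NoDup F0 -> summable a ->
  (forall F, NoDup F -> (forall i, In i F -> ~ In i F0) ->
     (Rsum_list (fun i => Cmod (a i)) F <= eps)%R) ->
  (Cmod (Sum a - Csum_list a F0) <= eps)%R.
Proof.
  intros H0 Ha Ht.
  assert (h : clim (finite_subsets full) (fun F => Csum_list a F - Csum_list a F0)
                (Sum a - Csum_list a F0)).
  { apply clim_minus; [typeclasses eauto | apply has_sum_Sum, Ha | apply clim_const; typeclasses eauto]. }
  refine (clim_Cmod_le (finite_subsets full) _ _ eps _ h).
  exists F0. split; [apply Forall_forall; easy|]. intros F HF _ Hi.
  destruct (split_incl F0 F H0 HF Hi) as [F1 [h1 [h2 [_ h3]]]].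
  rewrite (Csum_list_perm a _ _ h3), Csum_list_app.
  replace (Csum_list a F0 + Csum_list a F1 - Csum_list a F0) with (Csum_list a F1) by ring.
  eapply Rle_trans; [apply Csum_list_mod_le | apply Ht; auto].
Qed.

Lemma Sum_single a i0 : (forall i, i <> i0 -> a i = 0) -> Sum a = a i0.
Proof.
  intros H. apply Sum_eq. intros eps He. exists (i0 :: nil).
  split; [apply Forall_forall; easy|]. intros F HF _ Hi.
  destruct (split_incl (i0 :: nil) F) as [F1 [h1 [h2 [_ h3]]]]; auto.
  { constructor; [easy | constructor]. }
  rewrite (Csum_list_perm a _ _ h3). simpl.
  rewrite (Csum_list_ext a (fun _ => 0 * 0) F1).
  - rewrite Csum_list_scal. replace (a i0 + _ - a i0) with (RtoC 0) by ring.
    rewrite Cmod_0. exact He.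
  - intros i hi. rewrite H; [ring|]. intros ->. apply (h2 i0 hi). now left.
Qed.

Lemma Csum_list_clim {T : Type} (G : (T -> Prop) -> Prop) {FG : Filter G}
  (f : T -> I -> C) (g : I -> C) F :
  (forall i, clim G (fun t => f t i) (g i)) ->
  clim G (fun t => Csum_list (f t) F) (Csum_list g F).
Proof.
  intros H. induction F; simpl.
  - apply clim_const; assumption.
  - apply clim_plus; auto.
Qed.

(** Tannery's theorem, that is, dominated convergence for unconditional sums. *)
Lemma Sum_dominated {T : Type} (G : (T -> Prop) -> Prop) {FG : ProperFilter G}
  (f : T -> I -> C) (g : I -> C) b :
  rsummable b ->
  G (fun t => forall i, (Cmod (f t i) <= b i)%R) ->
  (forall i, clim G (fun t => f t i) (g i)) ->
  summable g /\ clim G (fun t => Sum (f t)) (Sum g).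
Proof.
  intros Hb Hd Hl.
  assert (Hg : forall i, (Cmod (g i) <= b i)%R).
  { intros i. refine (clim_Cmod_le G _ _ _ _ (Hl i)).
    revert Hd. apply filter_imp. auto. }
  assert (Hb0 : forall i, (0 <= b i)%R).
  { intros i. eapply Rle_trans; [apply Cmod_ge_0 | apply Hg]. }
  assert (Hsg : summable g) by (eapply summable_le; eassumption).
  split; [exact Hsg|]. intros eps He.
  destruct (rsummable_tail b Hb0 Hb _ (third_pos _ He)) as [F0 [H0 Ht]].
  generalize (filter_and _ _ Hd (Csum_list_clim G f g F0 Hl _ (third_pos _ He))).
  apply filter_imp. intros t [h1 h2].
  assert (e1 : (Cmod (Sum (f t) - Csum_list (f t) F0) <= eps / 3)%R).
  { apply Sum_tail; auto.
    - eapply summable_le; eassumption.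
    - intros F HF Hi. eapply Rle_trans; [apply Rsum_list_le; intros; apply h1 | auto]. }
  assert (e2 : (Cmod (Sum g - Csum_list g F0) <= eps / 3)%R).
  { apply Sum_tail; auto.
    intros F HF Hi. eapply Rle_trans; [apply Rsum_list_le; intros; apply Hg | auto]. }
  assert (e3 := Cmod_triangle_sub (Sum (f t)) (Csum_list (f t) F0) (Sum g)).
  assert (e4 := Cmod_triangle_sub (Csum_list (f t) F0) (Csum_list g F0) (Sum g)).
  rewrite (Cmod_minus_sym (Csum_list g F0)) in e4. lra.
Qed.

End Summable.

Lemma rsummable_inj {I K : Type} (h : I -> K) (b : K -> R) :
  (forall i j, h i = h j -> i = j) -> rsummable b -> rsummable (fun i => b (h i)).
Proof.
  intros Hh [M HM]. exists M. intros F HF. rewrite <- Rsum_list_map.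
  apply HM, FinFun.Injective_map_NoDup; assumption.
Qed.

Lemma summable_inj {I K : Type} (h : I -> K) (a : K -> C) :
  (forall i j, h i = h j -> i = j) -> summable a -> summable (fun i => a (h i)).
Proof. intros Hh. apply (rsummable_inj h (fun k => Cmod (a k)) Hh). Qed.

(** Reindexing by a bijection [h] with inverse [k]. *)
Lemma Sum_reindex {I K : Type} (h : I -> K) (k : K -> I) (a : K -> C) :
  (forall i, k (h i) = i) -> (forall j, h (k j) = j) -> summable a ->
  Sum (fun i => a (h i)) = Sum a.
Proof.
  intros Hkh Hhk Ha. apply Sum_eq. intros eps He.
  destruct (has_sum_Sum a Ha eps He) as [F0 [_ HF]].
  exists (map k F0). split; [apply Forall_forall; easy|].
  intros F HF1 _ Hi. rewrite <- Csum_list_map. apply HF.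
  - apply FinFun.Injective_map_NoDup; [|exact HF1].
    intros x y E. rewrite <- (Hkh x), <- (Hkh y). congruence.
  - apply Forall_forall. easy.
  - intros j Hj. rewrite <- (Hhk j). apply in_map, Hi, in_map, Hj.
Qed.

Lemma rsummable_prod {I K : Type} (u : I -> R) (v : K -> R) :
  (forall i, (0 <= u i)%R) -> (forall k, (0 <= v k)%R) ->
  rsummable u -> rsummable v -> rsummable (fun x : I * K => (u (fst x) * v (snd x))%R).
Proof.
  intros Hu Hv [M HM] [N HN]. exists (M * N)%R. intros F HF.
  set (F1 := nodup eq_dec_cl (map fst F)). set (F2 := nodup eq_dec_cl (map snd F)).
  assert (h1 : NoDup F1) by apply NoDup_nodup. assert (h2 : NoDup F2) by apply NoDup_nodup.
  apply Rle_trans with (Rsum_list (fun x : I * K => (u (fst x) * v (snd x))%R) (list_prod F1 F2)).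
  - apply Rsum_list_incl; auto.
    + intros x. apply Rmult_le_pos; auto.
    + apply NoDup_list_prod; assumption.
    + intros [i k] Hx. apply in_prod_iff. unfold F1, F2. rewrite !nodup_In. split.
      * change i with (fst (i, k)). apply in_map, Hx.
      * change k with (snd (i, k)). apply in_map, Hx.
  - rewrite Rsum_list_prod. simpl.
    assert (E : Rsum_list (fun i => Rsum_list (fun k => (u i * v k)%R) F2) F1
                = (Rsum_list u F1 * Rsum_list v F2)%R).
    { clear. induction F1; simpl; [ring|]. rewrite IHF1, Rsum_list_scal. ring. }
    rewrite E. specialize (HM F1 h1). specialize (HN F2 h2).
    apply Rmult_le_compat; auto; apply Rsum_list_nonneg; auto.
Qed.

Lemma summable_prod {I K : Type} (a : I -> C) (a' : K -> C) :
  summable a -> summable a' -> summable (fun x : I * K => a (fst x) * a' (snd x)).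
Proof.
  intros H H'. eapply summable_le;
    [| apply (rsummable_prod _ _ (fun i => Cmod_ge_0 (a i)) (fun k => Cmod_ge_0 (a' k)) H H')].
  intros x. simpl. rewrite Cmod_mult. lra.
Qed.

Lemma summable_row {I K : Type} (a : I * K -> C) i :
  summable a -> summable (fun k => a (i, k)).
Proof. apply (summable_inj (fun k => (i, k))). congruence. Qed.

(** A finite sum of sums is the sum of the finite sums. *)
Lemma Csum_list_has_sum {I K : Type} (a : I -> K -> C) (G : list I) :
  (forall i, summable (a i)) ->
  has_sum (fun k => Csum_list (fun i => a i k) G) (Csum_list (fun i => Sum (a i)) G).
Proof.
  intros H. induction G; simpl.
  - apply has_sum_ext with (fun _ => 0 * 0); [intros; ring|].
    intros eps He. exists nil. split; [constructor|]. intros F _ _ _.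
    rewrite Csum_list_scal. replace (0 * _ - 0) with (RtoC 0) by ring.
    now rewrite Cmod_0.
  - apply has_sum_plus; [apply has_sum_Sum, H | exact IHG].
Qed.

(** Fubini's theorem for absolutely summable double families. *)
Lemma Sum_fubini {I K : Type} (a : I * K -> C) : summable a ->
  summable (fun i => Sum (fun k => a (i, k))) /\
  Sum (fun i => Sum (fun k => a (i, k))) = Sum a.
Proof.
  intros Ha.
  assert (Hr : forall i, summable (fun k => a (i, k))) by (intros; apply summable_row, Ha).
  assert (Hs : summable (fun i => Sum (fun k => a (i, k)))).
  { destruct Ha as [M HM]. exists M. intros G HG.
    (* Replace the finitely many inner sums over [K] by sums over one large finite set. *)
    assert (h : forall eps, (0 < eps)%R ->
       (Rsum_list (fun i => Cmod (Sum (fun k => a (i, k)))) G <= M + eps)%R).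
    { intros eps He.
      assert (h : exists H, NoDup H /\
        (Rsum_list (fun i => Cmod (Sum (fun k => a (i, k)))) G
         <= Rsum_list (fun i => Cmod (Csum_list (fun k => a (i, k)) H)) G + eps)%R).
      { assert (h : finite_subsets full (fun H =>
          (Rsum_list (fun i => Cmod (Sum (fun k => a (i, k)))) G
           <= Rsum_list (fun i => Cmod (Csum_list (fun k => a (i, k)) H)) G + eps)%R)).
        { clear HG. revert eps He. induction G as [|i G IH]; intros eps He.
          - apply filter_forall. intros H. simpl. lra.
          - generalize (filter_and _ _ (IH _ (half_pos _ He))
              (has_sum_Sum _ (Hr i) _ (half_pos _ He))).
            apply filter_imp. intros H [h1 h2]. simpl.
            assert (h3 := Cmod_triangle_inv (Sum (fun k => a (i, k))) (Csum_list (fun k => a (i, k)) H)).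
            rewrite Cmod_minus_sym in h3. lra. }
        destruct h as [F0 [_ HF0]]. exists (nodup eq_dec_cl F0).
        split; [apply NoDup_nodup|]. apply HF0; [apply NoDup_nodup | apply Forall_forall; easy |].
        intros k hk. apply nodup_In, hk. }
      destruct h as [H [HH h]]. eapply Rle_trans; [exact h|].
      apply Rplus_le_compat_r.
      eapply Rle_trans; [| apply (HM (list_prod G H) (NoDup_list_prod _ _ HG HH))].
      rewrite Rsum_list_prod. apply Rsum_list_le. intros i _. apply Csum_list_mod_le. }
    apply Rnot_lt_le. intros hlt.
    specialize (h ((Rsum_list (fun i => Cmod (Sum (fun k => a (i, k)))) G - M) / 2)%R ltac:(lra)).
    lra. }
  split; [exact Hs|]. apply Sum_eq. intros eps He.
  destruct (has_sum_Sum a Ha _ (half_pos _ He)) as [F0 [_ HF0]].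
  exists (map fst F0). split; [apply Forall_forall; easy|]. intros G HG _ Hi.
  destruct (Csum_list_has_sum (fun i k => a (i, k)) G Hr _ (half_pos _ He)) as [H0 [_ HH0]].
  set (H := nodup eq_dec_cl (H0 ++ map snd F0)).
  assert (e1 := HH0 H (NoDup_nodup _ _) ltac:(apply Forall_forall; easy)
    ltac:(intros k hk; apply nodup_In, in_app_iff; tauto)).
  assert (e2 : (Cmod (Csum_list a (list_prod G H) - Sum a) < eps / 2)%R).
  { apply HF0; [apply NoDup_list_prod; [exact HG | apply NoDup_nodup] | apply Forall_forall; easy |].
    intros [i k] Hx. apply in_prod_iff. split.
    - apply Hi. change i with (fst (i, k)). apply in_map, Hx.
    - apply nodup_In, in_app_iff. right. change k with (snd (i, k)). apply in_map, Hx. }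
  rewrite Csum_list_prod, Csum_list_swap in e2.
  rewrite Cmod_minus_sym in e1.
  assert (e3 := Cmod_triangle_sub (Csum_list (fun i => Sum (fun k => a (i, k))) G)
    (Csum_list (fun k => Csum_list (fun i => a (i, k)) G) H) (Sum a)). lra.
Qed.

Lemma Sum_fubini_swap {I K : Type} (a : I * K -> C) : summable a ->
  summable (fun k => Sum (fun i => a (i, k))) /\
  Sum (fun k => Sum (fun i => a (i, k))) = Sum a.
Proof.
  intros Ha. set (a' := fun x : K * I => a (snd x, fst x)).
  assert (Ha' : summable a').
  { apply (summable_inj (fun x : K * I => (snd x, fst x))); [|exact Ha].
    intros [? ?] [? ?]; simpl; congruence. }
  destruct (Sum_fubini a' Ha') as [h1 h2]. split; [exact h1|].
  unfold a' in h2 at 1. simpl in h2. rewrite h2.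
  apply (Sum_reindex (fun x : K * I => (snd x, fst x)) (fun x => (snd x, fst x)));
    [now intros [? ?] | now intros [? ?] | exact Ha].
Qed.

(** A sum over [A] is the sum over the whole type of the extension by zero. *)
Lemma is_sum_over_extend {I : Type} (A : I -> Prop) (a e : I -> C) :
  (forall i, A i -> e i = a i) -> (forall i, ~ A i -> e i = 0) -> summable e ->
  is_sum_over A a (Sum e).
Proof.
  intros H1 H2 He. apply clim_filterlim; [typeclasses eauto|].
  intros eps Heps. destruct (has_sum_Sum e He eps Heps) as [F0 [_ HF0]].
  set (f := fun i => if excluded_middle_informative (A i) then true else false).
  assert (Hf : forall i, f i = true <-> A i).
  { intros i. unfold f. destruct (excluded_middle_informative (A i)); intuition congruence. }
  exists (filter f F0). split.
  { apply Forall_forall. intros i Hi. apply filter_In in Hi. apply Hf. tauto. }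
  intros F HF HA Hi. rewrite Forall_forall in HA.
  set (F' := nodup eq_dec_cl (F ++ F0)).
  assert (HF' : NoDup F') by apply NoDup_nodup.
  assert (Hinc : incl F F') by (intros i h; apply nodup_In, in_app_iff; tauto).
  assert (Hlim : (Cmod (Csum_list e F' - Sum e) < eps)%R).
  { apply HF0; [exact HF' | apply Forall_forall; easy |].
    intros i h. apply nodup_In, in_app_iff. tauto. }
  destruct (split_incl F F' HF HF' Hinc) as [F1 [h1 [h2 [h3 h4]]]].
  rewrite (Csum_list_perm e _ _ h4), Csum_list_app in Hlim.
  rewrite (Csum_list_ext e (fun _ => 0 * 0) F1), Csum_list_scal in Hlim.
  - rewrite (Csum_list_ext e a F) in Hlim by auto.
    replace (Csum_list a F + _) with (Csum_list a F) in Hlim by ring. exact Hlim.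
  - intros i hi. rewrite H2; [ring|]. intros HAi. apply (h2 i hi), Hi, filter_In.
    split; [|now apply Hf]. specialize (h3 i hi). apply nodup_In, in_app_iff in h3.
    destruct h3 as [h3|h3]; [contradict (h2 i hi h3) | exact h3].
Qed.

(** * Integral powers *)

Lemma Cinv_neq_0 (a : C) : a <> 0 -> / a <> 0.
Proof. intros Ha. apply Cmod_gt_0. rewrite Cmod_inv by exact Ha. now apply Rinv_0_lt_compat, Cmod_gt_0. Qed.

Lemma Cdiv_neq_0 (a b : C) : a <> 0 -> b <> 0 -> a / b <> 0.
Proof. intros Ha Hb. apply Cmult_neq_0; [exact Ha | now apply Cinv_neq_0]. Qed.

Lemma Copp_neq_0 (a : C) : a <> 0 -> - a <> 0.
Proof. intros Ha h. apply Ha. replace a with (- - a) by ring. rewrite h. ring. Qed.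

Lemma Cpowz_of_nat c k : Cpowz c (Z.of_nat k) = c ^ k.
Proof. destruct k; simpl; [easy|]. now rewrite SuccNat2Pos.id_succ. Qed.

Lemma Cpowz_opp (c : C) n : c <> 0 -> Cpowz c (- n) = / Cpowz c n.
Proof.
  intros Hc. destruct n; simpl; [now field | easy |].
  field. apply Cpow_nz, Hc.
Qed.

Lemma Cpowz_succ (c : C) n : c <> 0 -> Cpowz c (n + 1) = c * Cpowz c n.
Proof.
  intros Hc. destruct (Z_le_gt_dec 0 n) as [h|h].
  - rewrite <- (Z2Nat.id n h). replace (Z.of_nat (Z.to_nat n) + 1)%Z with (Z.of_nat (S (Z.to_nat n))) by lia.
    now rewrite !Cpowz_of_nat.
  - replace n with (- Z.of_nat (S (Z.to_nat (- n - 1))))%Z at 2 by lia.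
    replace (n + 1)%Z with (- Z.of_nat (Z.to_nat (- n - 1)))%Z by lia.
    rewrite !Cpowz_opp, !Cpowz_of_nat by exact Hc. rewrite Cpow_S. field.
    split; [apply Cpow_nz|]; exact Hc.
Qed.

Lemma Cpowz_0 c : Cpowz c 0 = 1.
Proof. easy. Qed.

Lemma Cpowz_1 c : Cpowz c 1 = c.
Proof. simpl. ring. Qed.

Lemma Cpowz_2 c : Cpowz c 2 = c ^ 2.
Proof. easy. Qed.

Lemma Cpowz_neq_0 (c : C) n : c <> 0 -> Cpowz c n <> 0.
Proof.
  intros Hc. destruct n; simpl; [apply C1_nz | apply Cpow_nz, Hc | apply Cinv_neq_0, Cpow_nz, Hc].
Qed.

Lemma Cpowz_add (c : C) n m : c <> 0 -> Cpowz c (n + m) = Cpowz c n * Cpowz c m.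
Proof.
  intros Hc. revert n.
  apply (Z.peano_ind (fun n => Cpowz c (n + m) = Cpowz c n * Cpowz c m)).
  - simpl. ring.
  - intros n IH. unfold Z.succ. replace (n + 1 + m)%Z with (n + m + 1)%Z by ring.
    rewrite !Cpowz_succ, IH by exact Hc. ring.
  - intros n IH. unfold Z.pred.
    assert (h1 := Cpowz_succ c (n + -1 + m) Hc). assert (h2 := Cpowz_succ c (n + -1) Hc).
    replace (n + -1 + m + 1)%Z with (n + m)%Z in h1 by ring.
    replace (n + -1 + 1)%Z with n in h2 by ring.
    rewrite IH, h2 in h1. 
    assert (h3 : c * Cpowz c (n + -1 + m) = c * (Cpowz c (n + -1) * Cpowz c m))
      by (rewrite <- h1; ring).
    replace (Cpowz c (n + -1 + m)) with (/ c * (c * Cpowz c (n + -1 + m))) by (field; exact Hc).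
    rewrite h3. field. exact Hc.
Qed.

Lemma Cpowz_sub (c : C) n m : c <> 0 -> Cpowz c (n - m) = Cpowz c n / Cpowz c m.
Proof. intros Hc. unfold Z.sub. now rewrite Cpowz_add, Cpowz_opp. Qed.

Lemma Cpowz_mult_l (a b : C) n : a <> 0 -> b <> 0 -> Cpowz (a * b) n = Cpowz a n * Cpowz b n.
Proof.
  intros Ha Hb. destruct n; simpl; [ring | apply Cpow_mult_l |].
  rewrite Cpow_mult_l. field. split; apply Cpow_nz; assumption.
Qed.

Lemma Cpowz_inv (a : C) n : a <> 0 -> Cpowz (/ a) n = / Cpowz a n.
Proof.
  intros Ha. destruct n; simpl; [now field | now apply Cpow_inv |].
  f_equal. now apply Cpow_inv.
Qed.

Lemma Cpowz_div (a b : C) n : a <> 0 -> b <> 0 -> Cpowz (a / b) n = Cpowz a n / Cpowz b n.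
Proof.
  intros Ha Hb. unfold Cdiv. rewrite Cpowz_mult_l, Cpowz_inv; auto.
  now apply Cinv_neq_0.
Qed.

Lemma Cpowz_1_l n : Cpowz 1 n = 1.
Proof. destruct n; simpl; rewrite ?Cpow_1_l; [easy | easy | now field]. Qed.

Lemma Cpowz_mul (c : C) n m : c <> 0 -> Cpowz c (n * m) = Cpowz (Cpowz c n) m.
Proof.
  intros Hc. assert (Hn := Cpowz_neq_0 c n Hc). revert m.
  apply (Z.peano_ind (fun m => Cpowz c (n * m) = Cpowz (Cpowz c n) m)).
  - now rewrite Z.mul_0_r.
  - intros m IH. unfold Z.succ. rewrite Cpowz_succ by exact Hn.
    replace (n * (m + 1))%Z with (n + n * m)%Z by ring. now rewrite Cpowz_add, IH.
  - intros m IH. unfold Z.pred. rewrite (Cpowz_add _ m (-1)) by exact Hn.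
    replace (n * (m + -1))%Z with (n * m - n)%Z by ring. rewrite Cpowz_sub, IH by exact Hc.
    change (-1)%Z with (- (1))%Z. now rewrite Cpowz_opp, Cpowz_1.
Qed.

Lemma Cmod_Cpowz (c : C) n : c <> 0 -> Cmod (Cpowz c n) = powerRZ (Cmod c) n.
Proof.
  intros Hc. destruct n; simpl; [apply Cmod_1 | apply Cmod_pow |].
  rewrite Cmod_inv, Cmod_pow; [easy | apply Cpow_nz, Hc].
Qed.

Lemma powerRZ_antitone r n m : (0 < r < 1)%R -> (n <= m)%Z -> (powerRZ r m <= powerRZ r n)%R.
Proof.
  intros Hr H. replace m with (n + Z.of_nat (Z.to_nat (m - n)))%Z by lia.
  rewrite powerRZ_add by lra. rewrite <- pow_powerRZ.
  assert (h1 : (0 < powerRZ r n)%R) by (apply powerRZ_lt; lra).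
  assert (h2 : (r ^ Z.to_nat (m - n) <= 1)%R).
  { rewrite <- (pow1 (Z.to_nat (m - n))). apply pow_incr. lra. }
  nra.
Qed.

Lemma powerRZ_small r eps : (0 < r < 1)%R -> (0 < eps)%R ->
  exists N : Z, (0 <= N)%Z /\ forall n, (N <= n)%Z -> (powerRZ r n <= eps)%R.
Proof.
  intros Hr He. destruct (pow_lt_1_zero r ltac:(rewrite Rabs_pos_eq; lra) eps He) as [N HN].
  exists (Z.of_nat N). split; [lia|]. intros n Hn.
  apply Rle_trans with (powerRZ r (Z.of_nat N)); [apply powerRZ_antitone; assumption|].
  rewrite <- pow_powerRZ. specialize (HN N (le_n _)).
  rewrite Rabs_pos_eq in HN; [lra | apply pow_le; lra].
Qed.

(** The triangular exponent [k (k - 1) / 2]. *)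
Definition tri (k : Z) : Z := (k * (k - 1) / 2)%Z.

Lemma tri_double k : (2 * tri k = k * (k - 1))%Z.
Proof.
  unfold tri. assert (H : ((k * (k - 1)) mod 2 = 0)%Z).
  { destruct (Z.Even_or_Odd k) as [[m ->]|[m ->]].
    - replace (2 * m * (2 * m - 1))%Z with ((m * (2 * m - 1)) * 2)%Z by ring. apply Z_mod_mult.
    - replace ((2 * m + 1) * (2 * m + 1 - 1))%Z with (((2 * m + 1) * m) * 2)%Z by ring.
      apply Z_mod_mult. }
  assert (h := Z.div_mod (k * (k - 1)) 2 ltac:(lia)). lia.
Qed.

Lemma tri_add k m : tri (k + m) = (tri k + tri m + k * m)%Z.
Proof.
  assert (h1 := tri_double k). assert (h2 := tri_double m). assert (h3 := tri_double (k + m)). nia.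
Qed.

Lemma opp1_neq_0 : (-1 : C) <> 0.
Proof. intros h. apply (f_equal fst) in h. simpl in h. lra. Qed.

(** The coefficients [(-1)^k p^(k (k - 1) / 2)] of the theta series. *)
Definition thc (p : C) (k : Z) : C := Cpowz (-1) k * Cpowz p (tri k).

Section ThetaCoefficients.
Variable p : C.
Hypothesis Hp : p <> 0.

Lemma thc_neq_0 k : thc p k <> 0.
Proof. apply Cmult_neq_0; apply Cpowz_neq_0; [apply opp1_neq_0 | exact Hp]. Qed.

Lemma thc_0 : thc p 0 = 1.
Proof. unfold thc. simpl. ring. Qed.

Lemma thc_1 : thc p 1 = - (1).
Proof. unfold thc. simpl. apply injective_projections; simpl; ring. Qed.

Lemma thc_add k m : thc p (k + m) = thc p k * thc p m * Cpowz p (k * m).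
Proof.
  unfold thc. rewrite tri_add, !Cpowz_add by (exact Hp || apply opp1_neq_0). ring.
Qed.

Lemma thc_succ k : thc p (k + 1) = - (Cpowz p k * thc p k).
Proof. rewrite thc_add, thc_1, Z.mul_1_r. ring. Qed.

Lemma Cpowz_m1_sq k : Cpowz (-1) k * Cpowz (-1) k = 1.
Proof.
  rewrite <- Cpowz_mult_l by apply opp1_neq_0.
  replace ((-1 : C) * (-1)) with (RtoC 1) by (apply injective_projections; simpl; ring).
  apply Cpowz_1_l.
Qed.

Lemma thc_sq k : thc p k * thc p k = Cpowz p (k * k) / Cpowz p k.
Proof.
  unfold thc. replace (_ * _ * (_ * _)) with
    (Cpowz (-1) k * Cpowz (-1) k * (Cpowz p (tri k) * Cpowz p (tri k))) by ring.
  rewrite Cpowz_m1_sq, <- Cpowz_add, <- Cpowz_sub by exact Hp.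
  assert (h := tri_double k). replace (tri k + tri k)%Z with (k * k - k)%Z by lia. ring.
Qed.

Lemma thc_opp k : thc p (- k) = thc p k * Cpowz p k.
Proof.
  assert (h := thc_add k (- k)). rewrite Z.add_opp_diag_r, thc_0 in h.
  assert (h2 := thc_sq k).
  replace (k * - k)%Z with (- (k * k))%Z in h by ring. rewrite Cpowz_opp in h by exact Hp.
  assert (n1 := thc_neq_0 k). assert (n2 := Cpowz_neq_0 p (k * k) Hp).
  assert (n3 := Cpowz_neq_0 p k Hp).
  replace (thc p (- k)) with
    ((thc p k * thc p (- k) * / Cpowz p (k * k)) * Cpowz p (k * k) / thc p k) by (field; auto).
  rewrite <- h.
  replace (Cpowz p (k * k)) with (thc p k * thc p k * Cpowz p k) by (rewrite h2; field; auto).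
  field. auto.
Qed.

End ThetaCoefficients.

(** * Summability over the integers *)

Lemma rsummable_nat_seq (b : nat -> R) M : (forall n, (0 <= b n)%R) ->
  (forall K, (Rsum_list b (seq 0 K) <= M)%R) -> rsummable b.
Proof.
  intros Hb HM. exists M. intros F HF.
  assert (h : exists K, forall i, In i F -> (i < K)%nat).
  { clear HF. induction F as [|i F [K HK]].
    - exists 0%nat. easy.
    - exists (Nat.max (S i) K). intros j [->|h]; [lia|]. specialize (HK j h). lia. }
  destruct h as [K HK]. eapply Rle_trans; [|apply (HM K)].
  apply Rsum_list_incl; auto; [apply seq_NoDup|].
  intros i hi. apply in_seq. specialize (HK i hi). lia.
Qed.

(** The ratio test. *)
Lemma rsummable_ratio (b : nat -> R) N rho : (forall n, (0 <= b n)%R) -> (0 <= rho < 1)%R ->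
  (forall n, (N <= n)%nat -> (b (S n) <= rho * b n)%R) -> rsummable b.
Proof.
  intros Hb Hr H.
  assert (h : forall m, (Rsum_list b (seq 0 (N + m)) + b (N + m)%nat / (1 - rho)
                         <= Rsum_list b (seq 0 N) + b N / (1 - rho))%R).
  { induction m as [|m IH].
    - rewrite Nat.add_0_r. lra.
    - replace (N + S m)%nat with (S (N + m)) by lia.
      rewrite seq_S, Rsum_list_app. simpl.
      assert (h1 := H (N + m)%nat ltac:(lia)).
      assert (h2 : (b (S (N + m)) / (1 - rho) <= rho * b (N + m)%nat / (1 - rho))%R).
      { apply Rmult_le_compat_r; [|exact h1]. left. apply Rinv_0_lt_compat. lra. }
      assert (h3 : (b (N + m)%nat + rho * b (N + m)%nat / (1 - rho) = b (N + m)%nat / (1 - rho))%R)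
        by (field; lra).
      lra. }
  apply rsummable_nat_seq with (Rsum_list b (seq 0 N) + b N / (1 - rho))%R; [exact Hb|].
  intros K. eapply Rle_trans; [|apply (h K)].
  assert (h1 : (Rsum_list b (seq 0 K) <= Rsum_list b (seq 0 (N + K)))%R).
  { rewrite (Nat.add_comm N K), seq_app, Rsum_list_app.
    assert (h1 := Rsum_list_nonneg b (seq (0 + K) N) Hb). lra. }
  assert (h2 : (0 <= b (N + K)%nat / (1 - rho))%R).
  { apply Rmult_le_pos; [apply Hb|]. left. apply Rinv_0_lt_compat. lra. }
  lra.
Qed.

Lemma rsummable_geom r : (0 <= r < 1)%R -> rsummable (fun n : nat => (r ^ n)%R).
Proof.
  intros Hr. apply rsummable_ratio with 0%nat r; [|exact Hr|].
  - intros n. apply pow_le. lra.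
  - intros n _. simpl. lra.
Qed.

Lemma rsummable_Z (b : Z -> R) : (forall n, (0 <= b n)%R) ->
  rsummable (fun k : nat => b (Z.of_nat k)) -> rsummable (fun k : nat => b (- Z.of_nat k)%Z) ->
  rsummable b.
Proof.
  intros Hb [M HM] [M' HM']. exists (M + M')%R. intros F HF.
  set (f := fun n => Z.leb 0 n).
  assert (e : Rsum_list b F = (Rsum_list b (filter f F) + Rsum_list b (filter (fun n => negb (f n)) F))%R).
  { clear HF. induction F as [|n F IH]; simpl; [ring|]. destruct (f n); simpl; rewrite IH; ring. }
  rewrite e. apply Rplus_le_compat.
  - replace (filter f F) with (map Z.of_nat (map Z.to_nat (filter f F))).
    + rewrite Rsum_list_map. apply HM.
      apply NoDup_map_NoDup_ForallPairs; [|apply NoDup_filter, HF].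
      intros n m hn hm. apply filter_In in hn, hm. unfold f in *.
      destruct hn as [_ hn], hm as [_ hm]. apply Z.leb_le in hn, hm. lia.
    + rewrite map_map. rewrite <- map_id. apply map_ext_in. intros n hn.
      apply filter_In in hn as [_ hn]. apply Z.leb_le in hn. lia.
  - replace (filter (fun n => negb (f n)) F) with
      (map (fun k => - Z.of_nat k)%Z (map (fun n => Z.to_nat (- n)) (filter (fun n => negb (f n)) F))).
    + rewrite Rsum_list_map. apply HM'.
      apply NoDup_map_NoDup_ForallPairs; [|apply NoDup_filter, HF].
      intros n m hn hm. apply filter_In in hn, hm. unfold f in *.
      destruct hn as [_ hn], hm as [_ hm]. apply Bool.negb_true_iff, Z.leb_gt in hn, hm. lia.
    + rewrite map_map. rewrite <- map_id. apply map_ext_in. intros n hn.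
      apply filter_In in hn as [_ hn]. apply Bool.negb_true_iff, Z.leb_gt in hn. lia.
Qed.

Lemma summable_thc (p a : C) : (0 < Cmod p < 1)%R -> a <> 0 ->
  summable (fun n => thc p n * Cpowz a n).
Proof.
  intros Hp Ha. assert (Hp0 : p <> 0) by (apply Cmod_gt_0; lra).
  assert (Ha0 : (0 < Cmod a)%R) by (now apply Cmod_gt_0).
  assert (step : forall n, Cmod (thc p (n + 1) * Cpowz a (n + 1))
    = (powerRZ (Cmod p) n * Cmod a * Cmod (thc p n * Cpowz a n))%R).
  { intros n. rewrite thc_succ, Cpowz_succ by assumption.
    replace (- (Cpowz p n * thc p n) * (a * Cpowz a n)) with
      (- (Cpowz p n * a * (thc p n * Cpowz a n))) by ring.
    rewrite Cmod_opp, !Cmod_mult, Cmod_Cpowz by assumption. ring. }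
  apply rsummable_Z; [intros; apply Cmod_ge_0 | |].
  - destruct (powerRZ_small (Cmod p) (/ (2 * Cmod a)) Hp) as [N [HN HN2]].
    { apply Rinv_0_lt_compat. lra. }
    apply rsummable_ratio with (Z.to_nat N) (1/2)%R; [intros; apply Cmod_ge_0 | lra |].
    intros n Hn. rewrite Nat2Z.inj_succ. unfold Z.succ. rewrite step.
    apply Rmult_le_compat_r; [apply Cmod_ge_0|].
    specialize (HN2 (Z.of_nat n) ltac:(lia)).
    apply Rle_trans with (/ (2 * Cmod a) * Cmod a)%R; [apply Rmult_le_compat_r; lra|].
    right. field. lra.
  - destruct (powerRZ_small (Cmod p) (Cmod a / 2) Hp) as [N [HN HN2]]; [lra|].
    apply rsummable_ratio with (Z.to_nat N) (1/2)%R; [intros; apply Cmod_ge_0 | lra |].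
    intros n Hn. rewrite Nat2Z.inj_succ. unfold Z.succ.
    assert (e := step (- (Z.of_nat n + 1))%Z).
    replace (- (Z.of_nat n + 1) + 1)%Z with (- Z.of_nat n)%Z in e by ring. rewrite e.
    set (X := Cmod (thc p (- (Z.of_nat n + 1)) * _)).
    assert (hX : (0 <= X)%R) by apply Cmod_ge_0.
    specialize (HN2 (Z.of_nat n + 1)%Z ltac:(lia)).
    rewrite powerRZ_neg'.
    assert (hP : (0 < powerRZ (Cmod p) (Z.of_nat n + 1))%R) by (apply powerRZ_lt; lra).
    set (P := powerRZ (Cmod p) (Z.of_nat n + 1)) in *.
    assert (h2 : (2 <= / P * Cmod a)%R).
    { apply Rmult_le_reg_l with P; [exact hP|]. rewrite <- Rmult_assoc, Rinv_r by lra. lra. }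
    nra.
Qed.

Lemma rsummable_Z_geom (b : Z -> R) r s : (forall n, (0 <= b n)%R) ->
  (0 <= r < 1)%R -> (0 <= s < 1)%R ->
  (forall k : nat, (b (Z.of_nat k) <= r ^ k)%R) ->
  (forall k : nat, (b (- Z.of_nat k)%Z <= s ^ k)%R) -> rsummable b.
Proof.
  intros Hb Hr Hs H1 H2. apply rsummable_Z; [exact Hb | |].
  - eapply rsummable_le; [exact H1 | apply rsummable_geom, Hr].
  - eapply rsummable_le; [exact H2 | apply rsummable_geom, Hs].
Qed.

(** For [p < b < 1] the factor [1 / (1 + p^n)], of order [p^(- n)] as [n] tends to [- oo], turns the
    divergent bilateral geometric series into a convergent one. *)
Lemma rsummable_geom_damped (p b : R) : (0 < p < 1)%R -> (p < b < 1)%R ->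
  rsummable (fun n : Z => (powerRZ b n / (1 + powerRZ p n))%R).
Proof.
  intros Hp Hb. apply rsummable_Z_geom with b (p / b)%R.
  - intros n. assert (0 < powerRZ b n)%R by (apply powerRZ_lt; lra).
    assert (0 < powerRZ p n)%R by (apply powerRZ_lt; lra).
    apply Rlt_le, Rdiv_lt_0_compat; lra.
  - lra.
  - split.
    + apply Rlt_le, Rdiv_lt_0_compat; lra.
    + apply Rmult_lt_reg_r with b; [lra|]. field_simplify; lra.
  - intros k. rewrite <- !pow_powerRZ.
    assert (0 < b ^ k)%R by (apply pow_lt; lra). assert (0 < p ^ k)%R by (apply pow_lt; lra).
    apply Rmult_le_reg_r with (1 + p ^ k)%R; [lra|]. field_simplify; nra.
  - intros k. rewrite !powerRZ_neg', <- !pow_powerRZ.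
    assert (h1 : (0 < b ^ k)%R) by (apply pow_lt; lra). assert (h2 : (0 < p ^ k)%R) by (apply pow_lt; lra).
    unfold Rdiv. rewrite Rpow_mult_distr, pow_inv.
    assert (e : (/ b ^ k * / (1 + / p ^ k) = p ^ k * / b ^ k * / (1 + p ^ k))%R) by (field; lra).
    rewrite e. rewrite <- (Rmult_1_r (p ^ k * / b ^ k)) at 2.
    apply Rmult_le_compat_l.
    + apply Rlt_le, Rmult_lt_0_compat; [lra | apply Rinv_0_lt_compat; lra].
    + rewrite <- Rinv_1. apply Rinv_le_contravar; lra.
Qed.

Lemma rsummable_bump (p : R) : (0 < p < 1)%R ->
  rsummable (fun n : Z => (powerRZ p n / ((1 + powerRZ p n) * (1 + powerRZ p n)))%R).
Proof.
  intros Hp. apply rsummable_Z_geom with p p; [| lra | lra | |].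
  - intros n. assert (0 < powerRZ p n)%R by (apply powerRZ_lt; lra).
    apply Rlt_le, Rdiv_lt_0_compat; nra.
  - intros k. rewrite <- !pow_powerRZ. assert (0 < p ^ k)%R by (apply pow_lt; lra).
    apply Rmult_le_reg_r with ((1 + p ^ k) * (1 + p ^ k))%R; [nra|]. field_simplify; nra.
  - intros k. rewrite !powerRZ_neg', <- !pow_powerRZ.
    assert (h2 : (0 < p ^ k)%R) by (apply pow_lt; lra).
    assert (e : (/ p ^ k / ((1 + / p ^ k) * (1 + / p ^ k)) = p ^ k / ((1 + p ^ k) * (1 + p ^ k)))%R)
      by (field; lra).
    rewrite e. apply Rmult_le_reg_r with ((1 + p ^ k) * (1 + p ^ k))%R; [nra|]. field_simplify; nra.
Qed.

(** * Distance to a geometric progression *)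

(** [x] is not an integral power of [p]. *)
Definition nopole (p x : C) : Prop := forall n : Z, 1 - x * Cpowz p n <> 0.

Lemma nopole_iff (p x : C) : p <> 0 -> nopole p x <-> forall n : Z, x <> Cpowz p n.
Proof.
  intros Hp. split; intros H n h.
  - apply (H (- n)%Z). rewrite h, Cpowz_opp by exact Hp. field. apply Cpowz_neq_0, Hp.
  - apply (H (- n)%Z). rewrite Cpowz_opp by exact Hp.
    assert (n0 := Cpowz_neq_0 p n Hp).
    replace x with (x * Cpowz p n * / Cpowz p n) by (field; exact n0).
    replace (x * Cpowz p n) with (1 - (1 - x * Cpowz p n)) by ring. rewrite h. field. exact n0.
Qed.

Lemma nopole_shift (p x : C) k : p <> 0 -> nopole p x -> nopole p (x * Cpowz p k).
Proof.
  intros Hp H n. rewrite <- Cmult_assoc, <- Cpowz_add by exact Hp. apply H.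
Qed.

Lemma nopole_inv (p x : C) : p <> 0 -> x <> 0 -> nopole p x -> nopole p (/ x).
Proof.
  intros Hp Hx H n h. apply (H (- n)%Z). rewrite Cpowz_opp by exact Hp.
  assert (n0 := Cpowz_neq_0 p n Hp).
  replace (1 - x * / Cpowz p n) with (- (1 - / x * Cpowz p n) * (x / Cpowz p n)) by (field; auto).
  rewrite h. ring.
Qed.

Lemma nopole_ne_1 (p x : C) : nopole p x -> 1 - x <> 0.
Proof. intros H. specialize (H 0%Z). rewrite Cpowz_0, Cmult_1_r in H. exact H. Qed.

Lemma nopole_annulus (p x : C) : (0 < Cmod p < 1)%R -> (Cmod p < Cmod x < 1)%R -> nopole p x.
Proof.
  intros Hp Hx. assert (Hp0 : p <> 0) by (apply Cmod_gt_0; lra).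
  apply nopole_iff; [exact Hp0|]. intros n ->. rewrite Cmod_Cpowz in Hx by exact Hp0.
  destruct (Z_le_gt_dec n 0) as [h|h].
  - assert (h1 := powerRZ_antitone (Cmod p) n 0 Hp h). rewrite powerRZ_O in h1. lra.
  - assert (h1 := powerRZ_antitone (Cmod p) 1 n Hp ltac:(lia)). rewrite powerRZ_1 in h1. lra.
Qed.

(** Away from its poles, [1 / (1 - x p^n)] is bounded by a multiple of [1 / (1 + |p|^n)]. *)
Lemma pole_bound (p x : C) : (0 < Cmod p < 1)%R -> x <> 0 -> nopole p x ->
  exists c : R, (0 < c)%R /\
    forall n, (c * (1 + powerRZ (Cmod p) n) <= Cmod (1 - x * Cpowz p n))%R.
Proof.
  intros Hp Hx H. assert (Hp0 : p <> 0) by (apply Cmod_gt_0; lra).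
  assert (Hx0 : (0 < Cmod x)%R) by (now apply Cmod_gt_0).
  set (r := Cmod p) in *.
  destruct (powerRZ_small r (/ (2 * Cmod x))%R Hp) as [N [HN HN2]].
  { apply Rinv_0_lt_compat. lra. }
  destruct (powerRZ_small r (Cmod x / 2)%R Hp) as [N' [HN' HN2']]; [lra|].
  (* Only finitely many [n] remain once both tails are estimated by the triangle inequality. *)
  assert (Hfin : forall L : list Z, exists c, (0 < c)%R /\
    forall n, In n L -> (c * (1 + powerRZ r n) <= Cmod (1 - x * Cpowz p n))%R).
  { induction L as [|n L [c [Hc IH]]].
    - exists 1%R. split; [lra | easy].
    - assert (h : (0 < Cmod (1 - x * Cpowz p n))%R) by (apply Cmod_gt_0, H).
      assert (hP : (0 < powerRZ r n)%R) by (apply powerRZ_lt; lra).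
      exists (Rmin c (Cmod (1 - x * Cpowz p n) / (1 + powerRZ r n)))%R. split.
      + apply Rmin_pos; [exact Hc | apply Rdiv_lt_0_compat; lra].
      + intros m [<-|hm].
        * apply Rle_trans with (Cmod (1 - x * Cpowz p n) / (1 + powerRZ r n) * (1 + powerRZ r n))%R.
          -- apply Rmult_le_compat_r; [lra | apply Rmin_r].
          -- right. field. lra.
        * assert (hP' : (0 < powerRZ r m)%R) by (apply powerRZ_lt; lra).
          eapply Rle_trans; [|apply IH, hm]. apply Rmult_le_compat_r; [lra | apply Rmin_l]. }
  destruct (Hfin (map (fun k => Z.of_nat k - N')%Z (seq 0 (Z.to_nat (N + N'))))) as [c [Hc Hf]].
  set (c' := Rmin c (Rmin (1/4) (Cmod x / 4))).
  assert (Hc' : (0 < c')%R) by (unfold c'; repeat apply Rmin_pos; lra).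
  assert (k1 : (c' <= c)%R) by apply Rmin_l.
  assert (k2 : (c' <= 1/4)%R) by (eapply Rle_trans; [apply Rmin_r | apply Rmin_l]).
  assert (k3 : (c' <= Cmod x / 4)%R) by (eapply Rle_trans; [apply Rmin_r | apply Rmin_r]).
  exists c'. split; [exact Hc'|]. intros n.
  assert (hP : (0 < powerRZ r n)%R) by (apply powerRZ_lt; lra).
  assert (em : Cmod (x * Cpowz p n) = (Cmod x * powerRZ r n)%R)
    by (rewrite Cmod_mult, Cmod_Cpowz by exact Hp0; easy).
  destruct (Z_le_gt_dec N n) as [h|h].
  - specialize (HN2 n h).
    assert (h1 : (Cmod x * powerRZ r n <= 1/2)%R).
    { apply Rle_trans with (Cmod x * / (2 * Cmod x))%R; [apply Rmult_le_compat_l; lra|].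
      right. field. lra. }
    assert (h2 := Cmod_triangle_inv 1 (x * Cpowz p n)). rewrite Cmod_1, em in h2.
    assert (h3 := powerRZ_antitone r 0 n Hp ltac:(lia)). rewrite powerRZ_O in h3. nra.
  - destruct (Z_le_gt_dec n (- N')) as [h'|h'].
    + specialize (HN2' (- n)%Z ltac:(lia)). rewrite powerRZ_neg' in HN2'.
      assert (h1 : (2 <= Cmod x * powerRZ r n)%R).
      { apply Rmult_le_reg_r with (/ powerRZ r n)%R; [apply Rinv_0_lt_compat; lra|].
        rewrite Rmult_assoc, Rinv_r by lra. lra. }
      assert (h2 := Cmod_triangle_inv (x * Cpowz p n) 1). rewrite Cmod_1, em in h2.
      rewrite Cmod_minus_sym.
      assert (h3 := powerRZ_antitone r n 0 Hp ltac:(lia)). rewrite powerRZ_O in h3. nra.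
    + eapply Rle_trans; [|apply Hf].
      * apply Rmult_le_compat_r; lra.
      * apply in_map_iff. exists (Z.to_nat (n + N')). split; [lia|]. apply in_seq. lia.
Qed.

(** The same bound holds uniformly near [x]. *)
Lemma pole_bound_near (p x : C) : (0 < Cmod p < 1)%R -> x <> 0 -> nopole p x ->
  exists c : R, (0 < c)%R /\ forall u, (Cmod (u - x) < c)%R ->
    forall n, (c * (1 + powerRZ (Cmod p) n) <= Cmod (1 - u * Cpowz p n))%R.
Proof.
  intros Hp Hx H. assert (Hp0 : p <> 0) by (apply Cmod_gt_0; lra).
  destruct (pole_bound p x Hp Hx H) as [c [Hc Hb]].
  exists (c / 2)%R. split; [lra|]. intros u Hu n.
  assert (hP : (0 < powerRZ (Cmod p) n)%R) by (apply powerRZ_lt; lra).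
  specialize (Hb n).
  assert (h := Cmod_triangle (1 - u * Cpowz p n) ((u - x) * Cpowz p n)).
  replace (1 - u * Cpowz p n + (u - x) * Cpowz p n) with (1 - x * Cpowz p n) in h by ring.
  rewrite (Cmod_mult (u - x)), Cmod_Cpowz in h by exact Hp0. nra.
Qed.

Lemma pole_inv_bound (p x : C) : (0 < Cmod p < 1)%R -> x <> 0 -> nopole p x ->
  exists M : R, (0 < M)%R /\
    forall n, (Cmod (/ (1 - x * Cpowz p n)) <= M / (1 + powerRZ (Cmod p) n))%R.
Proof.
  intros Hp Hx H. destruct (pole_bound p x Hp Hx H) as [c [Hc Hb]].
  exists (/ c)%R. split; [apply Rinv_0_lt_compat, Hc|]. intros n.
  assert (hP : (0 < powerRZ (Cmod p) n)%R) by (apply powerRZ_lt; lra).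
  rewrite Cmod_inv by apply H. unfold Rdiv. rewrite <- Rinv_mult.
  apply Rinv_le_contravar; [nra | apply Hb].
Qed.

Lemma pole_inv_bounded (p x : C) : (0 < Cmod p < 1)%R -> x <> 0 -> nopole p x ->
  exists M : R, forall n, (Cmod (/ (1 - x * Cpowz p n)) <= M)%R.
Proof.
  intros Hp Hx H. destruct (pole_inv_bound p x Hp Hx H) as [M [HM Hb]].
  exists M. intros n. eapply Rle_trans; [apply Hb|].
  assert (hP : (0 < powerRZ (Cmod p) n)%R) by (apply powerRZ_lt; lra).
  apply Rmult_le_reg_r with (1 + powerRZ (Cmod p) n)%R; [lra|]. field_simplify; nra.
Qed.

(** * Infinite products *)

(** The finite product [(a; p)_n]. *)
Definition pochn (a p : C) (n : nat) : C := Cprod (fun i => 1 - p ^ i * a) n.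

Lemma pochn_S_l a p n : pochn a p (S n) = (1 - a) * pochn (p * a) p n.
Proof.
  induction n.
  - unfold pochn. simpl. ring.
  - change (pochn a p (S (S n))) with (pochn a p (S n) * (1 - p ^ S n * a)).
    rewrite IHn. unfold pochn. simpl. ring.
Qed.

Lemma geom_sum_bound (r s : R) n : (0 <= r < 1)%R -> (0 <= s)%R ->
  (Rsum_list (fun i => s * r ^ i)%R (seq 0 n) <= s / (1 - r))%R.
Proof.
  intros Hr Hs.
  assert (h : (Rsum_list (fun i => s * r ^ i)%R (seq 0 n) = s * (1 - r ^ n) / (1 - r))%R).
  { induction n.
    - simpl. field. lra.
    - rewrite seq_S, Rsum_list_app, IHn. simpl. field. lra. }
  rewrite h. apply Rmult_le_compat_r; [left; apply Rinv_0_lt_compat; lra|].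
  assert (0 <= r ^ n)%R by (apply pow_le; lra). nra.
Qed.

Lemma pochn_bound (a p : C) : (0 < Cmod p < 1)%R ->
  exists M : R, forall n, (Cmod (pochn a p n) <= M)%R.
Proof.
  intros Hp. exists (exp (Cmod a / (1 - Cmod p)))%R. intros n.
  apply Rle_trans with (exp (Rsum_list (fun i => Cmod a * Cmod p ^ i)%R (seq 0 n))).
  - induction n.
    + unfold pochn. simpl. rewrite Cmod_1, exp_0. lra.
    + rewrite seq_S, Rsum_list_app, exp_plus. simpl. rewrite Rplus_0_r.
      change (pochn a p (S n)) with (pochn a p n * (1 - p ^ n * a)). rewrite Cmod_mult.
      apply Rmult_le_compat; try apply Cmod_ge_0; [exact IHn|].
      eapply Rle_trans; [|apply exp_ineq1_le].
      eapply Rle_trans; [apply Cmod_triangle|].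
      rewrite Cmod_opp, Cmod_1, Cmod_mult, Cmod_pow. lra.
  - assert (h := geom_sum_bound (Cmod p) (Cmod a) n ltac:(lra) (Cmod_ge_0 a)).
    destruct (Rle_lt_or_eq_dec _ _ h) as [h1|h1]; [left; apply exp_increasing, h1 | right; now f_equal].
Qed.

(** The products [(p; p)_n] stay away from zero, since [1 - s >= exp (- s / (1 - r))] for
    [0 < s <= r < 1]. *)
Lemma pochn_lower (p : C) : (0 < Cmod p < 1)%R ->
  exists c : R, (0 < c)%R /\ forall n, (c <= Cmod (pochn p p n))%R.
Proof.
  intros Hp. set (r := Cmod p) in *.
  assert (hs : (0 <= r / (1 - r))%R) by (apply Rmult_le_pos; [lra | left; apply Rinv_0_lt_compat; lra]).
  exists (exp (- (r / (1 - r) / (1 - r))))%R. split; [apply exp_pos|]. intros n.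
  apply Rle_trans with (exp (- Rsum_list (fun i => r / (1 - r) * r ^ i)%R (seq 0 n))).
  - assert (h := geom_sum_bound r (r / (1 - r)) n ltac:(lra) hs).
    destruct (Rle_lt_or_eq_dec _ _ h) as [h1|h1].
    + left. apply exp_increasing. lra.
    + right. now rewrite h1.
  - induction n.
    + unfold pochn. simpl. rewrite Cmod_1, Ropp_0, exp_0. lra.
    + rewrite seq_S, Rsum_list_app, Ropp_plus_distr, exp_plus. simpl. rewrite Rplus_0_r.
      change (pochn p p (S n)) with (pochn p p n * (1 - p ^ n * p)). rewrite Cmod_mult.
      apply Rmult_le_compat; try (left; apply exp_pos); [exact IHn|].
      assert (h := Cmod_triangle_inv 1 (p ^ n * p)). rewrite Cmod_1, Cmod_mult, Cmod_pow in h. fold r in h.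
      eapply Rle_trans; [|exact h].
      assert (hn : (0 <= r ^ n <= 1)%R).
      { split; [apply pow_le; lra | rewrite <- (pow1 n); apply pow_incr; lra]. }
      assert (hs2 : (0 < r ^ n * r)%R) by (apply Rmult_lt_0_compat; [apply pow_lt|]; lra).
      assert (hs3 : (r ^ n * r <= r)%R) by nra.
      set (s := (r ^ n * r)%R) in *.
      rewrite exp_Ropp.
      replace (r / (1 - r) * r ^ n)%R with (s / (1 - r))%R by (unfold s; field; lra).
      assert (h2 := exp_ineq1_le (s / (1 - r))).
      assert (h3 : (/ (1 - s) <= 1 + s / (1 - r))%R).
      { apply Rmult_le_reg_r with ((1 - s) * (1 - r))%R; [apply Rmult_lt_0_compat; lra|].
        field_simplify; nra. }
      rewrite <- (Rinv_inv (1 - s)). apply Rinv_le_contravar.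
      * apply Rinv_0_lt_compat. lra.
      * lra.
Qed.

Lemma has_sum_seq (a : nat -> C) l : has_sum a l ->
  clim eventually (fun n => Csum_list a (seq 0 n)) l.
Proof.
  intros H eps He. destruct (H eps He) as [F0 [_ HF]].
  assert (h : exists K, forall i, In i F0 -> (i < K)%nat).
  { clear HF. induction F0 as [|i F [K HK]].
    - exists 0%nat. easy.
    - exists (Nat.max (S i) K). intros j [->|h]; [lia|]. specialize (HK j h). lia. }
  destruct h as [K HK]. exists K. intros n Hn. apply HF.
  - apply seq_NoDup.
  - apply Forall_forall. easy.
  - intros i hi. apply in_seq. specialize (HK i hi). lia.
Qed.

(** The infinite product converges: its successive differences are dominated by a geometric series. *)
Lemma pochn_lim (a p : C) : (0 < Cmod p < 1)%R -> clim eventually (pochn a p) (qpoch a p).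
Proof.
  intros Hp. destruct (pochn_bound a p Hp) as [M HM].
  set (d := fun n => - (p ^ n * a) * pochn a p n).
  assert (Hd : summable d).
  { apply summable_le with (fun n => (M * Cmod a * Cmod p ^ n)%R).
    - intros n. unfold d. rewrite Cmod_mult, Cmod_opp, Cmod_mult, Cmod_pow.
      specialize (HM n). assert (h1 := Cmod_ge_0 a).
      assert (h2 : (0 <= Cmod p ^ n)%R) by (apply pow_le; lra).
      assert (h3 : (0 <= Cmod p ^ n * Cmod a)%R) by (apply Rmult_le_pos; lra).
      replace (M * Cmod a * Cmod p ^ n)%R with (Cmod p ^ n * Cmod a * M)%R by ring.
      now apply Rmult_le_compat_l.
    - apply rsummable_scal; [|apply rsummable_geom; lra].
      apply Rmult_le_pos; [|apply Cmod_ge_0].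
      eapply Rle_trans; [apply Cmod_ge_0 | apply (HM 0%nat)]. }
  assert (Hlim : clim eventually (pochn a p) (1 + Sum d)).
  { apply clim_ext with (fun n => 1 + Csum_list d (seq 0 n)); [apply eventually_filter| |].
    - intros n. induction n.
      + unfold pochn. simpl. ring.
      + rewrite seq_S, Csum_list_app.
        change (pochn a p (S n)) with (pochn a p n * (1 - p ^ n * a)).
        rewrite <- IHn at 1. simpl. unfold d at 2. rewrite <- IHn. ring.
    - apply clim_plus; [apply eventually_filter | apply clim_const, eventually_filter |].
      apply has_sum_seq, has_sum_Sum, Hd. }
  replace (qpoch a p) with (1 + Sum d); [exact Hlim|]. symmetry.
  apply (@iota_filterlim_locally C_AbsRing C_CompleteNormedModule nat eventually).
  - apply Proper_StrongProper, eventually_filter.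
  - apply clim_filterlim in Hlim; [exact Hlim | apply eventually_filter].
Qed.

Lemma clim_S (f : nat -> C) l : clim eventually f l -> clim eventually (fun n => f (S n)) l.
Proof. intros H eps He. destruct (H eps He) as [N HN]. exists N. intros n hn. apply HN. lia. Qed.

Lemma clim_double (f : nat -> C) l : clim eventually f l -> clim eventually (fun n => f (2 * n)%nat) l.
Proof. intros H eps He. destruct (H eps He) as [N HN]. exists N. intros n hn. apply HN. lia. Qed.

Lemma clim_seq_unique (f : nat -> C) l m : clim eventually f l -> clim eventually f m -> l = m.
Proof. apply clim_unique, eventually_filter. Qed.

Lemma qpoch_rec (a p : C) : (0 < Cmod p < 1)%R -> qpoch a p = (1 - a) * qpoch (p * a) p.
Proof.
  intros Hp. apply (clim_seq_unique (fun n => pochn a p (S n))).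
  - apply clim_S, pochn_lim, Hp.
  - apply clim_ext with (fun n => (1 - a) * pochn (p * a) p n); [apply eventually_filter| |].
    + intros n. now rewrite pochn_S_l.
    + apply clim_mult; [apply eventually_filter | apply clim_const, eventually_filter | apply pochn_lim, Hp].
Qed.

Lemma qpoch_self_neq_0 (p : C) : (0 < Cmod p < 1)%R -> qpoch p p <> 0.
Proof.
  intros Hp h. destruct (pochn_lower p Hp) as [c [Hc H]].
  assert (hl := pochn_lim p p Hp). rewrite h in hl.
  destruct (hl c Hc) as [N HN]. specialize (HN N (le_n _)). specialize (H N).
  replace (pochn p p N - 0) with (pochn p p N) in HN by ring. lra.
Qed.

Lemma qpoch_split (a p : C) : (0 < Cmod p < 1)%R ->
  qpoch a p = qpoch a (p ^ 2) * qpoch (p * a) (p ^ 2).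
Proof.
  intros Hp. assert (Hp2 : (0 < Cmod (p ^ 2) < 1)%R) by (rewrite Cmod_pow; simpl; nra).
  apply (clim_seq_unique (fun n => pochn a p (2 * n))).
  - apply (clim_double (pochn a p)), pochn_lim, Hp.
  - apply clim_ext with (fun n => pochn a (p ^ 2) n * pochn (p * a) (p ^ 2) n);
      [apply eventually_filter | |].
    + intros n. induction n as [|n IH].
      * unfold pochn. simpl. ring.
      * replace (2 * S n)%nat with (S (S (2 * n))) by lia.
        change (pochn a p (S (S (2 * n)))) with
          (pochn a p (2 * n) * (1 - p ^ (2 * n) * a) * (1 - p ^ S (2 * n) * a)).
        rewrite <- IH.
        change (pochn a (p ^ 2) (S n)) with (pochn a (p ^ 2) n * (1 - (p ^ 2) ^ n * a)).
        change (pochn (p * a) (p ^ 2) (S n)) with (pochn (p * a) (p ^ 2) n * (1 - (p ^ 2) ^ n * (p * a))).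
        rewrite (Cpow_S p (2 * n)), (Cpow_mult_r p 2 n). set (X := (p ^ 2) ^ n). ring.
    + apply clim_mult; [apply eventually_filter | apply pochn_lim, Hp2 | apply pochn_lim, Hp2].
Qed.

Lemma qpoch_neg (p : C) : (0 < Cmod p < 1)%R ->
  qpoch (- p) p * qpoch p p = qpoch (p ^ 2) (p ^ 2).
Proof.
  intros Hp. assert (Hp2 : (0 < Cmod (p ^ 2) < 1)%R) by (rewrite Cmod_pow; simpl; nra).
  apply (clim_seq_unique (fun n => pochn (- p) p n * pochn p p n)).
  - apply clim_mult; [apply eventually_filter | apply pochn_lim, Hp | apply pochn_lim, Hp].
  - apply clim_ext with (pochn (p ^ 2) (p ^ 2)); [apply eventually_filter| |apply pochn_lim, Hp2].
    intros n. induction n as [|n IH].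
    + unfold pochn. simpl. ring.
    + change (pochn (p ^ 2) (p ^ 2) (S n)) with (pochn (p ^ 2) (p ^ 2) n * (1 - (p ^ 2) ^ n * p ^ 2)).
      change (pochn (- p) p (S n)) with (pochn (- p) p n * (1 - p ^ n * - p)).
      change (pochn p p (S n)) with (pochn p p n * (1 - p ^ n * p)).
      rewrite IH, <- (Cpow_mult_r p 2 n), Nat.mul_comm, Cpow_mult_r.
      set (X := p ^ n). ring.
Qed.

(** The modified theta product [(a; p)_oo (p / a; p)_oo]. *)
Definition thp (p a : C) : C := qpoch a p * qpoch (p / a) p.

Lemma thp_shift (p a : C) : (0 < Cmod p < 1)%R -> a <> 0 -> thp p (p * a) = - (thp p a / a).
Proof.
  intros Hp Ha. assert (Hp0 : p <> 0) by (apply Cmod_gt_0; lra). unfold thp.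
  rewrite (qpoch_rec a p Hp), (qpoch_rec (p / (p * a)) p Hp).
  replace (p / (p * a)) with (/ a) by (field; auto).
  replace (p * / a) with (p / a) by (field; auto). field. exact Ha.
Qed.

Lemma thp_refl (p a : C) : p <> 0 -> a <> 0 -> thp p (p / a) = thp p a.
Proof.
  intros Hp Ha. unfold thp. replace (p / (p / a)) with a by (field; auto). ring.
Qed.

Lemma thp_inv (p a : C) : (0 < Cmod p < 1)%R -> a <> 0 -> thp p (/ a) = - (thp p a / a).
Proof.
  intros Hp Ha. assert (Hp0 : p <> 0) by (apply Cmod_gt_0; lra).
  rewrite <- thp_shift by assumption. rewrite <- (thp_refl p (p * a)) by (auto using Cmult_neq_0).
  f_equal. field. auto.
Qed.

Lemma thp_1 (p : C) : (0 < Cmod p < 1)%R -> thp p 1 = 0.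
Proof. intros Hp. unfold thp. rewrite qpoch_rec by exact Hp. ring. Qed.

Lemma thp_Cpowz (p a : C) n : (0 < Cmod p < 1)%R -> a <> 0 ->
  thp p (Cpowz p n * a) = thp p a / (thc p n * Cpowz a n).
Proof.
  intros Hp Ha. assert (Hp0 : p <> 0) by (apply Cmod_gt_0; lra). revert n.
  assert (step : forall n, thp p (Cpowz p (n + 1) * a) = - (thp p (Cpowz p n * a) / (Cpowz p n * a))).
  { intros n. rewrite Cpowz_succ, <- Cmult_assoc by exact Hp0. apply thp_shift; [exact Hp|].
    apply Cmult_neq_0; [apply Cpowz_neq_0, Hp0 | exact Ha]. }
  apply (Z.peano_ind (fun n => thp p (Cpowz p n * a) = thp p a / (thc p n * Cpowz a n))).
  - rewrite thc_0, !Cpowz_0. replace (1 * a) with a by ring. field.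
  - intros n IH. unfold Z.succ. rewrite step, IH, thc_succ, Cpowz_succ by assumption.
    field. repeat split; auto using thc_neq_0, Cpowz_neq_0.
  - intros n IH. unfold Z.pred. assert (e := step (n + -1)%Z).
    replace (n + -1 + 1)%Z with n in e by ring. rewrite IH in e.
    assert (e2 := thc_succ p Hp0 (n + -1)). assert (e3 := Cpowz_succ a (n + -1) Ha).
    replace (n + -1 + 1)%Z with n in e2, e3 by ring. rewrite e2, e3 in e.
    assert (n1 := Cpowz_neq_0 p (n + -1) Hp0). assert (n2 := Cpowz_neq_0 a (n + -1) Ha).
    assert (n3 := thc_neq_0 p Hp0 (n + -1)).
    set (X := thp p (Cpowz p (n + -1) * a)) in *.
    replace X with (- (- (X / (Cpowz p (n + -1) * a))) * (Cpowz p (n + -1) * a)) by (field; auto).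
    rewrite <- e. field. auto.
Qed.

(** * The triple product and the partial fractions of [1 / thp] *)

(** [1 / (p; p)_m], extended by zero to negative [m]. *)
Definition ipoch (p : C) (m : Z) : C :=
  if Z.ltb m 0 then 0 else / pochn p p (Z.to_nat m).

Section Finite.
Variable p : C.
Hypothesis Hp : (0 < Cmod p < 1)%R.

Let Hp0 : p <> 0.
Proof. apply Cmod_gt_0. lra. Qed.

Lemma pochn_self_neq_0 n : pochn p p n <> 0.
Proof. destruct (pochn_lower p Hp) as [c [Hc H]]. apply Cmod_gt_0. specialize (H n). lra. Qed.

Lemma ipoch_rec m : (1 - Cpowz p m) * ipoch p m = ipoch p (m - 1).
Proof.
  unfold ipoch. destruct (Z.ltb_spec m 0) as [h|h].
  - destruct (Z.ltb_spec (m - 1) 0); [ring | lia].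
  - destruct (Z.ltb_spec (m - 1) 0) as [h'|h'].
    + replace m with 0%Z by lia. rewrite Cpowz_0. ring.
    + assert (n1 := pochn_self_neq_0 (Z.to_nat (m - 1))).
      assert (n2 := pochn_self_neq_0 (Z.to_nat m)).
      replace (Z.to_nat m) with (S (Z.to_nat (m - 1))) in * by lia.
      replace m with (Z.of_nat (S (Z.to_nat (m - 1)))) at 1 by lia.
      rewrite Cpowz_of_nat.
      change (pochn p p (S (Z.to_nat (m - 1)))) with
        (pochn p p (Z.to_nat (m - 1)) * (1 - p ^ Z.to_nat (m - 1) * p)) in *.
      rewrite Cpow_S. field. split; [exact n1|]. intros h2. apply n2.
      rewrite h2. ring.
Qed.

Lemma ipoch_bound : exists M, forall m, (Cmod (ipoch p m) <= M)%R.
Proof.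
  destruct (pochn_lower p Hp) as [c [Hc H]]. exists (/ c)%R. intros m. unfold ipoch.
  destruct (Z.ltb m 0).
  - rewrite Cmod_0. left. now apply Rinv_0_lt_compat.
  - rewrite Cmod_inv by apply pochn_self_neq_0. now apply Rinv_le_contravar.
Qed.

(** The weights [1 / ((p; p)_(N - n) (p; p)_(N + n))], which vanish unless [- N <= n <= N]. *)
Definition weight (N n : Z) : C := ipoch p (N - n) * ipoch p (N + n).

Lemma weight_bound : exists M, forall N n, (Cmod (weight N n) <= M)%R.
Proof.
  destruct ipoch_bound as [M H]. exists (M * M)%R. intros N n. unfold weight. rewrite Cmod_mult.
  apply Rmult_le_compat; auto using Cmod_ge_0.
Qed.

(** The next three lemmas express the weights of level [N] at [n - 1], [n] and [n + 1] through the
    weight of level [N + 1] at [n]. *)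
Lemma weight_down N n :
  weight N n = (1 - Cpowz p (N + 1) / Cpowz p n) * (1 - Cpowz p (N + 1) * Cpowz p n) * weight (N + 1) n.
Proof.
  unfold weight. assert (e1 := ipoch_rec (N + 1 - n)). assert (e2 := ipoch_rec (N + 1 + n)).
  replace (N + 1 - n - 1)%Z with (N - n)%Z in e1 by ring.
  replace (N + 1 + n - 1)%Z with (N + n)%Z in e2 by ring.
  rewrite Cpowz_sub in e1 by exact Hp0. rewrite Cpowz_add in e2 by exact Hp0.
  rewrite <- e1, <- e2. ring.
Qed.

Lemma weight_left N n :
  weight N (n - 1) = (1 - Cpowz p N * Cpowz p n) * (1 - Cpowz p (N + 1) * Cpowz p n) * weight (N + 1) n.
Proof.
  unfold weight. assert (e1 := ipoch_rec (N + 1 + n)). assert (e2 := ipoch_rec (N + n)).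
  replace (N + 1 + n - 1)%Z with (N + n)%Z in e1 by ring.
  rewrite Cpowz_add in e1, e2 by exact Hp0.
  replace (N - (n - 1))%Z with (N + 1 - n)%Z by ring.
  replace (N + (n - 1))%Z with (N + n - 1)%Z by ring.
  rewrite <- e2, <- e1. ring.
Qed.

Lemma weight_right N n :
  weight N (n + 1) = (1 - Cpowz p N / Cpowz p n) * (1 - Cpowz p (N + 1) / Cpowz p n) * weight (N + 1) n.
Proof.
  unfold weight. assert (e1 := ipoch_rec (N + 1 - n)). assert (e2 := ipoch_rec (N - n)).
  replace (N + 1 - n - 1)%Z with (N - n)%Z in e1 by ring.
  rewrite Cpowz_sub in e1, e2 by exact Hp0.
  replace (N - (n + 1))%Z with (N - n - 1)%Z by ring.
  replace (N + (n + 1))%Z with (N + 1 + n)%Z by ring.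
  rewrite <- e2, <- e1. ring.
Qed.

Lemma summable_weight N (a : C) : a <> 0 -> summable (fun n => weight N n * (thc p n * Cpowz a n)).
Proof.
  intros Ha. destruct weight_bound as [M HM].
  apply summable_bounded_mult with M; [apply HM | now apply summable_thc].
Qed.

(** The theta series truncated by the weights; up to the factor [(p; p)_(2 N)] it is the finite triple
    product. *)
Definition finite_theta (N : nat) (a : C) : C :=
  Sum (fun n => weight (Z.of_nat N) n * (thc p n * Cpowz a n)).

Lemma weight_0 n : n <> 0%Z -> weight 0 n = 0.
Proof.
  intros Hn. unfold weight, ipoch.
  destruct (Z.ltb_spec (0 - n) 0); [ring|]. destruct (Z.ltb_spec (0 + n) 0); [ring | lia].
Qed.

Lemma weight_0_0 : weight 0 0 = 1.
Proof. unfold weight, ipoch, pochn. simpl. field. Qed.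

Lemma finite_theta_0 a : finite_theta 0 a = 1.
Proof.
  unfold finite_theta. rewrite (Sum_single _ 0%Z).
  - simpl Z.of_nat. rewrite weight_0_0, thc_0, Cpowz_0. ring.
  - intros n Hn. simpl Z.of_nat. rewrite weight_0 by exact Hn. ring.
Qed.

Lemma finite_theta_S N (a : C) : a <> 0 ->
  (1 - p ^ (2 * N + 1)) * (1 - p ^ (2 * N + 2)) * finite_theta (S N) a
  = (1 - p ^ N * a) * (1 - p ^ N * (p / a)) * finite_theta N a.
Proof.
  intros Ha. unfold finite_theta. set (Z' := Z.of_nat N).
  assert (s0 := summable_weight Z' a Ha).
  assert (s3 := summable_weight (Z.of_nat (S N)) a Ha).
  assert (i1 : forall i j : Z, (i - 1 = j - 1)%Z -> i = j) by (intros; lia).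
  assert (i2 : forall i j : Z, (i + 1 = j + 1)%Z -> i = j) by (intros; lia).
  assert (i3 : forall i : Z, (i - 1 + 1 = i)%Z) by (intros; lia).
  assert (i4 : forall i : Z, (i + 1 - 1 = i)%Z) by (intros; lia).
  assert (s1 : summable (fun n => weight Z' (n - 1) * (thc p (n - 1) * Cpowz a (n - 1)))).
  { apply (summable_inj (fun n => (n - 1)%Z) _ i1 s0). }
  assert (s2 : summable (fun n => weight Z' (n + 1) * (thc p (n + 1) * Cpowz a (n + 1)))).
  { apply (summable_inj (fun n => (n + 1)%Z) _ i2 s0). }
  assert (e1 := Sum_reindex (fun n => (n - 1)%Z) (fun n => (n + 1)%Z) _ i3 i4 s0).
  assert (e2 := Sum_reindex (fun n => (n + 1)%Z) (fun n => (n - 1)%Z) _ i4 i3 s0).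
  cbv beta in e1, e2.
  set (X := Sum (fun n => weight Z' n * _)) in *.
  set (X1 := Sum (fun n => weight Z' (n - 1) * _)) in e1.
  set (X2 := Sum (fun n => weight Z' (n + 1) * _)) in e2.
  replace ((1 - p ^ N * a) * (1 - p ^ N * (p / a)) * X) with
    ((1 + p ^ N * p ^ N * p) * X + (- (p ^ N * a) * X1 + - (p ^ N * p / a) * X2))
    by (rewrite e1, e2; field; exact Ha).
  unfold X, X1, X2.
  rewrite <- !Sum_scal by assumption.
  rewrite <- !Sum_plus; try (repeat apply summable_plus); try apply summable_scal; try assumption.
  apply Sum_ext. intros n.
  replace (Z.of_nat (S N)) with (Z' + 1)%Z by (unfold Z'; lia).
  rewrite weight_left, weight_right, (weight_down Z' n).
  assert (eP : Cpowz p Z' = p ^ N) by apply Cpowz_of_nat.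
  rewrite !(Cpowz_add p Z' 1), Cpowz_1, eP by exact Hp0.
  rewrite (thc_succ p Hp0 n), (Cpowz_succ a n Ha).
  assert (f1 := thc_succ p Hp0 (n - 1)). assert (f2 := Cpowz_succ a (n - 1) Ha).
  assert (f3 := Cpowz_succ p (n - 1) Hp0).
  replace (n - 1 + 1)%Z with n in f1, f2, f3 by ring. rewrite f1, f2, f3.
  assert (n1 := Cpowz_neq_0 p (n - 1) Hp0).
  replace (2 * N + 2)%nat with (N + N + 2)%nat by lia.
  replace (2 * N + 1)%nat with (N + N + 1)%nat by lia.
  rewrite !Cpow_add_r. simpl. field. auto.
Qed.

Lemma finite_theta_prod N (a : C) : a <> 0 ->
  pochn p p (2 * N) * finite_theta N a = pochn a p N * pochn (p / a) p N.
Proof.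
  intros Ha. induction N as [|N IH].
  - rewrite finite_theta_0. unfold pochn. simpl. ring.
  - replace (2 * S N)%nat with (S (S (2 * N))) by lia.
    change (pochn p p (S (S (2 * N)))) with
      (pochn p p (2 * N) * (1 - p ^ (2 * N) * p) * (1 - p ^ S (2 * N) * p)).
    change (pochn a p (S N)) with (pochn a p N * (1 - p ^ N * a)).
    change (pochn (p / a) p (S N)) with (pochn (p / a) p N * (1 - p ^ N * (p / a))).
    replace (pochn p p (2 * N) * (1 - p ^ (2 * N) * p) * (1 - p ^ S (2 * N) * p) * finite_theta (S N) a)
      with (pochn p p (2 * N) * ((1 - p ^ (2 * N + 1)) * (1 - p ^ (2 * N + 2)) * finite_theta (S N) a)).
    + rewrite finite_theta_S by exact Ha.
      replace (pochn a p N * (1 - p ^ N * a) * (pochn (p / a) p N * (1 - p ^ N * (p / a)))) with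
        ((1 - p ^ N * a) * (1 - p ^ N * (p / a)) * (pochn a p N * pochn (p / a) p N)) by ring.
      rewrite <- IH. ring.
    + rewrite !Cpow_add_r. simpl. ring.
Qed.

Lemma ipoch_lim n :
  clim eventually (fun N : nat => ipoch p (Z.of_nat N + n)) (/ qpoch p p).
Proof.
  intros eps He.
  destruct (clim_inv eventually (pochn p p) (qpoch p p) (qpoch_self_neq_0 p Hp) (pochn_lim p p Hp) eps He)
    as [N0 HN0].
  exists (N0 + Z.to_nat (Z.abs n))%nat. intros N hN. unfold ipoch.
  destruct (Z.ltb_spec (Z.of_nat N + n) 0); [lia|]. apply HN0. lia.
Qed.

Lemma weight_lim n :
  clim eventually (fun N : nat => weight (Z.of_nat N) n) (/ (qpoch p p * qpoch p p)).
Proof.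
  assert (hJ := qpoch_self_neq_0 p Hp).
  replace (/ (qpoch p p * qpoch p p)) with (/ qpoch p p * / qpoch p p) by (field; auto).
  apply clim_mult; [apply eventually_filter | |].
  - apply clim_ext with (fun N : nat => ipoch p (Z.of_nat N + - n)); [apply eventually_filter | |].
    + intros N. cbv beta. apply (f_equal (ipoch p)). lia.
    + apply ipoch_lim.
  - apply clim_ext with (fun N : nat => ipoch p (Z.of_nat N + n)); [apply eventually_filter | |].
    + intros N. cbv beta. apply (f_equal (ipoch p)). lia.
    + apply ipoch_lim.
Qed.

Lemma Sum_weight_lim (a : Z -> C) : summable a ->
  clim eventually (fun N : nat => Sum (fun n => weight (Z.of_nat N) n * a n))
    (/ (qpoch p p * qpoch p p) * Sum a).
Proof.
  intros Ha. destruct weight_bound as [M HM].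
  rewrite <- Sum_scal by exact Ha.
  refine (proj2 (Sum_dominated eventually (fun (N : nat) n => weight (Z.of_nat N) n * a n) _
    (fun n => (M * Cmod (a n))%R) _ _ _)).
  - apply rsummable_scal; [|exact Ha].
    eapply Rle_trans; [apply Cmod_ge_0 | apply (HM 0%Z 0%Z)].
  - apply filter_forall. intros N n. rewrite Cmod_mult.
    apply Rmult_le_compat_r; [apply Cmod_ge_0 | apply HM].
  - intros n. apply clim_mult; [apply eventually_filter | apply weight_lim | apply clim_const, eventually_filter].
Qed.

(** Jacobi's triple product. *)
Lemma triple_product (a : C) : a <> 0 ->
  Sum (fun n => thc p n * Cpowz a n) = qpoch p p * thp p a.
Proof.
  intros Ha. assert (hJ := qpoch_self_neq_0 p Hp).
  assert (h : qpoch p p * (/ (qpoch p p * qpoch p p) * Sum (fun n => thc p n * Cpowz a n)) = thp p a).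
  { apply (clim_seq_unique (fun N => pochn p p (2 * N) * finite_theta N a)).
    - apply clim_mult; [apply eventually_filter | apply (clim_double (pochn p p)), pochn_lim, Hp |].
      apply Sum_weight_lim, summable_thc; assumption.
    - apply clim_ext with (fun N => pochn a p N * pochn (p / a) p N); [apply eventually_filter | |].
      + intros N. symmetry. now apply finite_theta_prod.
      + apply clim_mult; [apply eventually_filter | |]; apply pochn_lim, Hp. }
  rewrite <- h. field. exact hJ.
Qed.

(** The partial fraction series of [qpoch p p ^ 2 / thp p a]. *)
Definition pfrac (a : C) : C := Sum (fun n => thc p n * Cpowz p n / (1 - a * Cpowz p n)).

(** The same truncation of [pfrac], equal to [1 / ((a; p)_(N + 1) (p / a; p)_N)]. *)
Definition finite_pfrac (N : nat) (a : C) : C :=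
  Sum (fun n => weight (Z.of_nat N) n * (thc p n * Cpowz p n / (1 - a * Cpowz p n))).

Lemma summable_thc_div (a b : C) : a <> 0 -> b <> 0 -> nopole p a ->
  summable (fun n => thc p n * Cpowz b n / (1 - a * Cpowz p n)).
Proof.
  intros Ha Hb H. destruct (pole_inv_bounded p a Hp Ha H) as [M HM].
  apply summable_ext with (fun n => / (1 - a * Cpowz p n) * (thc p n * Cpowz b n)).
  - intros n. unfold Cdiv. ring.
  - apply summable_bounded_mult with M; [exact HM | now apply summable_thc].
Qed.

(** The polynomials [finite_theta (S N)] vanish at [1] and at [p]; this is what makes the
    finite partial fractions multiplicative in [N]. *)
Lemma finite_theta_root N : finite_theta (S N) 1 = 0 /\ finite_theta (S N) p = 0.
Proof.
  assert (h : forall N, pochn 1 p (S N) = 0).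
  { intros M. rewrite pochn_S_l. ring. }
  assert (n1 := pochn_self_neq_0 (2 * S N)).
  split.
  - assert (e := finite_theta_prod (S N) 1 C1_nz). rewrite h in e.
    replace (finite_theta (S N) 1) with (/ pochn p p (2 * S N) * (pochn p p (2 * S N) * finite_theta (S N) 1))
      by (field; exact n1). rewrite e. ring.
  - assert (e := finite_theta_prod (S N) p Hp0).
    replace (p / p) with (RtoC 1) in e by (field; exact Hp0). rewrite h in e.
    replace (finite_theta (S N) p) with (/ pochn p p (2 * S N) * (pochn p p (2 * S N) * finite_theta (S N) p))
      by (field; exact n1). rewrite e. ring.
Qed.

Lemma finite_pfrac_S N (a : C) : a <> 0 -> nopole p a ->
  (1 - p ^ S N * a) * (1 - p ^ N * (p / a)) * finite_pfrac (S N) a = finite_pfrac N a.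
Proof.
  intros Ha H. destruct (finite_theta_root N) as [r1 r2]. unfold finite_theta in r1, r2.
  unfold finite_pfrac. destruct weight_bound as [M HM].
  assert (s1 : summable (fun n => weight (Z.of_nat (S N)) n * (thc p n * Cpowz p n / (1 - a * Cpowz p n)))).
  { apply summable_bounded_mult with M; [apply HM | now apply summable_thc_div]. }
  assert (s2 := summable_weight (Z.of_nat (S N)) 1 C1_nz).
  assert (s3 := summable_weight (Z.of_nat (S N)) p Hp0).
  replace ((1 - p ^ S N * a) * (1 - p ^ N * (p / a)) *
     Sum (fun n => weight (Z.of_nat (S N)) n * (thc p n * Cpowz p n / (1 - a * Cpowz p n)))) with
   ((1 - p ^ S N * a) * (1 - p ^ N * (p / a)) *
     Sum (fun n => weight (Z.of_nat (S N)) n * (thc p n * Cpowz p n / (1 - a * Cpowz p n)))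
    + (- p ^ S N * Sum (fun n => weight (Z.of_nat (S N)) n * (thc p n * Cpowz 1 n))
       + p ^ S N / a * Sum (fun n => weight (Z.of_nat (S N)) n * (thc p n * Cpowz p n))))
    by (rewrite r1, r2; ring).
  rewrite <- !Sum_scal by assumption.
  rewrite <- !Sum_plus; try (repeat apply summable_plus); try apply summable_scal; try assumption.
  apply Sum_ext. intros n.
  replace (Z.of_nat (S N)) with (Z.of_nat N + 1)%Z by lia.
  rewrite (weight_down (Z.of_nat N) n), Cpowz_1_l, (Cpowz_add p (Z.of_nat N) 1), Cpowz_1, Cpowz_of_nat by exact Hp0.
  rewrite Cpow_S.
  assert (n1 := Cpowz_neq_0 p n Hp0). field. repeat split; auto.
Qed.

Lemma finite_pfrac_prod N (a : C) : a <> 0 -> nopole p a ->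
  pochn a p (S N) * pochn (p / a) p N * finite_pfrac N a = 1.
Proof.
  intros Ha H. induction N as [|N IH].
  - unfold finite_pfrac. rewrite (Sum_single _ 0%Z).
    + simpl Z.of_nat. rewrite weight_0_0, thc_0, Cpowz_0. unfold pochn. simpl.
      assert (h := nopole_ne_1 p a H). field. exact h.
    + intros n Hn. simpl Z.of_nat. rewrite weight_0 by exact Hn. ring.
  - rewrite <- IH, <- (finite_pfrac_S N a Ha H).
    change (pochn a p (S (S N))) with (pochn a p (S N) * (1 - p ^ S N * a)).
    change (pochn (p / a) p (S N)) with (pochn (p / a) p N * (1 - p ^ N * (p / a))). ring.
Qed.

Lemma thp_pfrac (a : C) : a <> 0 -> nopole p a -> thp p a * pfrac a = qpoch p p * qpoch p p.
Proof.
  intros Ha H. assert (hJ := qpoch_self_neq_0 p Hp).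
  assert (h : thp p a * (/ (qpoch p p * qpoch p p) * pfrac a) = 1).
  { apply (clim_seq_unique (fun N => pochn a p (S N) * pochn (p / a) p N * finite_pfrac N a)).
    - apply clim_mult; [apply eventually_filter | |].
      + apply clim_mult; [apply eventually_filter | apply clim_S|]; apply pochn_lim, Hp.
      + apply Sum_weight_lim, summable_thc_div; assumption.
    - apply clim_ext with (fun _ => 1); [apply eventually_filter | | apply clim_const, eventually_filter].
      intros N. symmetry. now apply finite_pfrac_prod. }
  replace (thp p a * pfrac a) with
    (thp p a * (/ (qpoch p p * qpoch p p) * pfrac a) * (qpoch p p * qpoch p p)) by (field; exact hJ).
  rewrite h. ring.
Qed.

Lemma thp_neq_0 (a : C) : a <> 0 -> nopole p a -> thp p a <> 0.
Proof.
  intros Ha H h. assert (e := thp_pfrac a Ha H). rewrite h in e.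
  assert (hJ := qpoch_self_neq_0 p Hp). apply (Cmult_neq_0 _ _ hJ hJ). rewrite <- e. ring.
Qed.

Lemma pfrac_eq (a : C) : a <> 0 -> nopole p a -> pfrac a = qpoch p p * qpoch p p / thp p a.
Proof.
  intros Ha H. rewrite <- (thp_pfrac a Ha H). field. now apply thp_neq_0.
Qed.

End Finite.

(** * Appell-Lerch sums and Kronecker's series *)

(** The theta series. *)
Definition theta (p a : C) : C := Sum (fun n => thc p n * Cpowz a n).

(** The unnormalised Appell-Lerch sum. *)
Definition appell (p a w : C) : C := Sum (fun n => thc p n * Cpowz a n / (1 - w * Cpowz p n)).

(** Kronecker's series [sum_n b^n / (1 - a p^n)]. *)
Definition kron (p b a : C) : C := Sum (fun n => Cpowz b n / (1 - a * Cpowz p n)).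

(** Constants factor out as soon as the scaled family is summable. *)
Lemma Sum_scal_weak {I : Type} (c : C) (a : I -> C) :
  summable (fun i => c * a i) -> Sum (fun i => c * a i) = c * Sum a.
Proof.
  intros H. destruct (excluded_middle_informative (c = 0)) as [->|hc].
  - rewrite Cmult_0_l. apply Sum_eq. intros eps He. exists nil. split; [constructor|].
    intros F _ _ _. rewrite Csum_list_scal.
    replace (0 * Csum_list a F - 0) with (RtoC 0) by ring. now rewrite Cmod_0.
  - apply Sum_scal. apply summable_ext with (fun i => / c * (c * a i)).
    + intros i. field. exact hc.
    + now apply summable_scal.
Qed.

Lemma Sum_shift (a : Z -> C) k : summable a -> Sum (fun n => a (n + k)%Z) = Sum a.
Proof.
  apply (Sum_reindex (fun n => (n + k)%Z) (fun n => (n - k)%Z)); intros; lia.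
Qed.

Lemma Sum_opp (a : Z -> C) : summable a -> Sum (fun n => a (- n)%Z) = Sum a.
Proof. apply (Sum_reindex (fun n => (- n)%Z) (fun n => (- n)%Z)); intros; lia. Qed.

Lemma Zadd_inj k (i j : Z) : (i + k = j + k)%Z -> i = j.
Proof. lia. Qed.

Section Appell.
Variable p : C.
Hypothesis Hp : (0 < Cmod p < 1)%R.

Let Hp0 : p <> 0.
Proof. apply Cmod_gt_0. lra. Qed.

Let J := qpoch p p.

Let HJ : J <> 0.
Proof. now apply qpoch_self_neq_0. Qed.

Lemma theta_eq (a : C) : a <> 0 -> theta p a = J * thp p a.
Proof. now apply triple_product. Qed.

Lemma appell_shift_a (a w : C) : a <> 0 -> w <> 0 -> nopole p w ->
  appell p (p * a) w = (appell p a w - theta p a) / w.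
Proof.
  intros Ha Hw H.
  assert (s1 := summable_thc p a Hp Ha).
  assert (s2 := summable_thc_div p Hp w a Hw Ha H).
  unfold appell, theta.
  replace ((Sum (fun n => thc p n * Cpowz a n / (1 - w * Cpowz p n)) - Sum (fun n => thc p n * Cpowz a n)) / w)
    with (/ w * Sum (fun n => thc p n * Cpowz a n / (1 - w * Cpowz p n))
          + (- / w) * Sum (fun n => thc p n * Cpowz a n)) by (field; exact Hw).
  rewrite <- !Sum_scal by assumption.
  rewrite <- Sum_plus by (apply summable_scal; assumption).
  apply Sum_ext. intros n. rewrite Cpowz_mult_l by assumption. assert (h := H n).
  field. auto.
Qed.

Lemma appell_flip (a w : C) : a <> 0 -> w <> 0 -> nopole p w ->
  appell p a w + appell p (p / a) (/ w) = theta p a.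
Proof.
  intros Ha Hw H.
  assert (Hw' := nopole_inv p w Hp0 Hw H).
  assert (s2 := summable_thc_div p Hp w a Hw Ha H).
  assert (s3 := summable_thc_div p Hp (/ w) (p / a) (Cinv_neq_0 w Hw) (Cdiv_neq_0 p a Hp0 Ha) Hw').
  unfold appell, theta. rewrite <- (Sum_opp _ s3), <- Sum_plus.
  - apply Sum_ext. intros n.
    rewrite thc_opp, Cpowz_div, !Cpowz_opp by assumption.
    assert (h := H n). assert (h' := Hw' (- n)%Z). rewrite Cpowz_opp in h' by exact Hp0.
    assert (n1 := Cpowz_neq_0 p n Hp0). assert (n2 := Cpowz_neq_0 a n Ha).
    field. repeat split; auto.
    intros h2. apply h. replace (1 - w * Cpowz p n) with (- (w * Cpowz p n - 1)) by ring. rewrite h2. ring.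
  - exact s2.
  - apply (summable_inj (fun n => (- n)%Z) _ Z.opp_inj s3).
Qed.

Lemma theta_Cpowz j : theta p (Cpowz p j) = 0.
Proof.
  rewrite theta_eq by (now apply Cpowz_neq_0).
  replace (Cpowz p j) with (Cpowz p j * 1) by ring.
  rewrite thp_Cpowz, thp_1 by (exact Hp || apply C1_nz). unfold Cdiv. ring.
Qed.

(** Since the theta series vanishes at powers of [p], the powers [w^k pfrac p w] have partial fraction
    series without polynomial part. *)
Lemma appell_Cpowz j (w : C) : w <> 0 -> nopole p w ->
  appell p (Cpowz p j) w = Cpowz w (1 - j) * pfrac p w.
Proof.
  intros Hw H.
  assert (step : forall j, appell p (Cpowz p (j + 1)) w = appell p (Cpowz p j) w / w).
  { intros i. rewrite Cpowz_succ, appell_shift_a, theta_Cpowz by (auto using Cpowz_neq_0).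
    unfold Cdiv. ring. }
  assert (h : forall i, appell p (Cpowz p (1 + i)) w = Cpowz w (- i) * pfrac p w).
  { apply (Z.peano_ind (fun i => appell p (Cpowz p (1 + i)) w = Cpowz w (- i) * pfrac p w)).
    - change (1 + 0)%Z with 1%Z. rewrite Cpowz_1. simpl Z.opp. rewrite Cpowz_0.
      unfold appell, pfrac. ring.
    - intros i IH. unfold Z.succ. rewrite Z.add_assoc, step, IH.
      rewrite !Cpowz_opp, Cpowz_succ by exact Hw. field. split; [apply Cpowz_neq_0|]; exact Hw.
    - intros i IH. unfold Z.pred. assert (e := step (1 + (i + -1))%Z).
      replace (1 + (i + -1) + 1)%Z with (1 + i)%Z in e by ring. rewrite IH in e.
      assert (e2 := Cpowz_succ w (i + -1) Hw). replace (i + -1 + 1)%Z with i in e2 by ring.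
      rewrite !Cpowz_opp in * by exact Hw. rewrite e2 in e.
      set (X := appell p (Cpowz p (1 + (i + -1))) w) in *. replace X with (X / w * w) by (field; exact Hw).
      rewrite <- e. field. split; [apply Cpowz_neq_0|]; exact Hw. }
  specialize (h (j - 1)%Z). replace (1 + (j - 1))%Z with j in h by ring. rewrite h.
  f_equal. f_equal. ring.
Qed.

Lemma appell_1 (w : C) : w <> 0 -> nopole p w -> appell p 1 w = w * pfrac p w.
Proof.
  intros Hw H. assert (e := appell_Cpowz 0 w Hw H). rewrite Cpowz_0 in e. rewrite e.
  simpl Z.sub. now rewrite Cpowz_1.
Qed.

Lemma summable_kron (a b : C) : (Cmod p < Cmod b < 1)%R -> a <> 0 -> nopole p a ->
  summable (fun n => Cpowz b n / (1 - a * Cpowz p n)).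
Proof.
  intros Hb Ha H. assert (Hb0 : b <> 0) by (apply Cmod_gt_0; lra).
  destruct (pole_inv_bound p a Hp Ha H) as [M [HM HM2]].
  eapply summable_le; [|apply (rsummable_scal M); [lra | apply (rsummable_geom_damped (Cmod p) (Cmod b) Hp Hb)]].
  intros n. unfold Cdiv. rewrite Cmod_mult, Cmod_Cpowz by exact Hb0.
  assert (hb : (0 < powerRZ (Cmod b) n)%R) by (apply powerRZ_lt; lra).
  specialize (HM2 n). unfold Rdiv in *.
  apply Rle_trans with (powerRZ (Cmod b) n * (M * / (1 + powerRZ (Cmod p) n)))%R.
  - apply Rmult_le_compat_l; lra.
  - right. ring.
Qed.

Lemma kron_shift (a b : C) k : (Cmod p < Cmod b < 1)%R -> a <> 0 -> nopole p a ->
  kron p b (a * Cpowz p k) = kron p b a / Cpowz b k.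
Proof.
  intros Hb Ha H. assert (Hb0 : b <> 0) by (apply Cmod_gt_0; lra).
  assert (s := summable_kron a b Hb Ha H).
  unfold kron. rewrite <- (Sum_shift _ k s).
  replace (Sum (fun n => Cpowz b (n + k) / (1 - a * Cpowz p (n + k))) / Cpowz b k)
    with (/ Cpowz b k * Sum (fun n => Cpowz b (n + k) / (1 - a * Cpowz p (n + k))))
    by (unfold Cdiv; ring).
  rewrite <- Sum_scal.
  - apply Sum_ext. intros n. rewrite !Cpowz_add by assumption.
    assert (h := H (n + k)%Z). rewrite Cpowz_add in h by assumption.
    replace (1 - a * Cpowz p k * Cpowz p n) with (1 - a * (Cpowz p n * Cpowz p k)) by ring.
    field. split; [exact h | now apply Cpowz_neq_0].
  - apply (summable_inj (fun n => (n + k)%Z) _ (Zadd_inj k) s).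
Qed.

(** Expand [theta p (a b)] and use that [a^l * pfrac p a] is again a partial fraction series; after the
    substitution [l = n + j] the double series is a product. *)
Lemma theta_pfrac_kron (a b : C) : (Cmod p < Cmod b < 1)%R -> a <> 0 -> nopole p a ->
  theta p (a * b) * pfrac p a = theta p b * kron p b a.
Proof.
  intros Hb Ha H. assert (Hb0 : b <> 0) by (apply Cmod_gt_0; lra).
  set (F := fun x : Z * Z => let (n, l) := x in
    thc p l * Cpowz b l * (thc p n * Cpowz (Cpowz p (1 - l)) n / (1 - a * Cpowz p n))).
  set (G := fun x : Z * Z => (Cpowz b (fst x) / (1 - a * Cpowz p (fst x)))
                             * (thc p (snd x) * Cpowz b (snd x))).
  assert (HG : summable G).
  { apply (summable_prod (fun n => Cpowz b n / (1 - a * Cpowz p n)) (fun n => thc p n * Cpowz b n)).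
    - now apply summable_kron.
    - now apply summable_thc. }
  assert (HFG : forall n l, F (n, l) = G (n, (l + - n)%Z)).
  { intros n l. unfold F, G. simpl fst. simpl snd.
    assert (e : thc p l = thc p (l + - n) * thc p n * Cpowz p (l * n) / Cpowz p (n * n)).
    { replace l with ((l + - n) + n)%Z at 1 by ring. rewrite thc_add by exact Hp0.
      rewrite Z.mul_add_distr_r, Z.mul_opp_l, Cpowz_add, Cpowz_opp by exact Hp0.
      field. now apply Cpowz_neq_0. }
    rewrite e. rewrite <- Cpowz_mul by exact Hp0.
    rewrite Z.mul_sub_distr_r, Z.mul_1_l, Cpowz_sub by exact Hp0.
    rewrite (Cpowz_add b), (Cpowz_opp b) by exact Hb0.
    assert (e2 := thc_sq p Hp0 n).
    replace (thc p (l + - n) * thc p n * Cpowz p (l * n) / Cpowz p (n * n) * Cpowz b l *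
      (thc p n * (Cpowz p n / Cpowz p (l * n)) / (1 - a * Cpowz p n))) with
      (thc p (l + - n) * (thc p n * thc p n) * Cpowz p (l * n) / Cpowz p (n * n) * Cpowz b l *
      ((Cpowz p n / Cpowz p (l * n)) / (1 - a * Cpowz p n))).
    - rewrite e2. field. repeat split; auto using Cpowz_neq_0.
    - field. repeat split; auto using Cpowz_neq_0. }
  assert (HF : summable F).
  { apply summable_ext with (fun x => G (fst x, (snd x + - fst x)%Z)).
    - intros [n l]. now rewrite HFG.
    - apply (summable_inj (fun x : Z * Z => (fst x, (snd x + - fst x)%Z))); [|exact HG].
      intros [n l] [n' l']. simpl. intros E. injection E as -> E. f_equal. lia. }
  destruct (Sum_fubini F HF) as [_ e1]. destruct (Sum_fubini_swap F HF) as [_ e2].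
  transitivity (Sum F).
  - rewrite <- e2. unfold theta. rewrite Cmult_comm, <- Sum_scal.
    + apply Sum_ext. intros l. unfold F.
      rewrite Sum_scal by (apply summable_thc_div; auto using Cpowz_neq_0).
      change (Sum (fun n => thc p n * Cpowz (Cpowz p (1 - l)) n / (1 - a * Cpowz p n)))
        with (appell p (Cpowz p (1 - l)) a).
      rewrite appell_Cpowz, Cpowz_mult_l by assumption.
      replace (1 - (1 - l))%Z with l by ring. ring.
    + apply summable_thc; auto using Cmult_neq_0.
  - rewrite <- e1. unfold kron. rewrite <- Sum_scal by (now apply summable_kron).
    apply Sum_ext. intros n.
    rewrite (Sum_ext _ (fun l => G (n, (l + - n)%Z))) by (intros; apply HFG).
    rewrite (Sum_shift (fun l => G (n, l)) (- n)) by (apply summable_row, HG).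
    unfold G. simpl fst. simpl snd.
    rewrite Sum_scal by (now apply summable_thc). unfold theta. ring.
Qed.

(** Kronecker's formula. *)
Lemma kron_eq (a b : C) : (Cmod p < Cmod b < 1)%R -> a <> 0 -> nopole p a ->
  kron p b a = J * J * thp p (a * b) / (thp p a * thp p b).
Proof.
  intros Hb Ha H. assert (Hb0 : b <> 0) by (apply Cmod_gt_0; lra).
  assert (Hb1 := nopole_annulus p b Hp Hb).
  assert (n1 := thp_neq_0 p Hp a Ha H). assert (n2 := thp_neq_0 p Hp b Hb0 Hb1).
  assert (e := theta_pfrac_kron a b Hb Ha H).
  rewrite !theta_eq in e by (auto using Cmult_neq_0). rewrite (pfrac_eq p Hp a Ha H) in e. fold J in e.
  replace (kron p b a) with (J * thp p b * kron p b a / (J * thp p b)) by (field; auto).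
  rewrite <- e. field. auto.
Qed.

(** The symmetry of the Appell-Lerch sum, obtained by expanding [a^k / thp p a] in partial
    fractions.  The factor [p^n] gained from [1 / (1 - a p^n) = 1 + a p^n / (1 - a p^n)] makes the
    double series converge absolutely. *)
Lemma appell_sym (a w : C) : a <> 0 -> w <> 0 -> nopole p a -> nopole p w ->
  appell p a w / thp p a = J + w / thp p w * appell p (p * w) a.
Proof.
  intros Ha Hw HA HW.
  set (F := fun x : Z * Z => let (k, n) := x in
    thc p k / (1 - w * Cpowz p k) * a * (thc p n * Cpowz (Cpowz p (2 - k)) n / (1 - a * Cpowz p n))).
  set (G := fun x : Z * Z => let (j, n) := x in
    a * Cpowz p n / (1 - a * Cpowz p n) * (thc p j * Cpowz 1 j / (1 - w * Cpowz p n * Cpowz p j))).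
  assert (HG : summable G).
  { destruct (pole_inv_bound p a Hp Ha HA) as [M [HM HM2]].
    destruct (pole_inv_bound p w Hp Hw HW) as [M' [HM' HM2']].
    set (v := fun j : Z => (Cmod (thc p j * Cpowz 1 j) + Cmod (thc p j * Cpowz (/ p) j))%R).
    set (u := fun n : Z => (powerRZ (Cmod p) n / ((1 + powerRZ (Cmod p) n) * (1 + powerRZ (Cmod p) n)))%R).
    assert (Hv : rsummable v).
    { apply rsummable_plus; apply summable_thc; auto using C1_nz, Cinv_neq_0. }
    assert (Hv0 : forall j, (0 <= v j)%R).
    { intros j. unfold v. assert (h1 := Cmod_ge_0 (thc p j * Cpowz 1 j)).
      assert (h2 := Cmod_ge_0 (thc p j * Cpowz (/ p) j)). lra. }
    assert (Hu0 : forall n, (0 <= u n)%R).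
    { intros n. unfold u. assert (0 < powerRZ (Cmod p) n)%R by (apply powerRZ_lt; lra).
      apply Rlt_le, Rdiv_lt_0_compat; nra. }
    eapply summable_le; [|apply (rsummable_scal (Cmod a * M * M'));
      [|apply (rsummable_prod v u Hv0 Hu0 Hv (rsummable_bump (Cmod p) Hp))]].
    2: { apply Rmult_le_pos; [apply Rmult_le_pos; [apply Cmod_ge_0|]|]; lra. }
    intros [j n]. simpl fst. simpl snd. unfold G, u, v. rewrite Cpowz_1_l, Cpowz_inv, !Cmult_1_r by exact Hp0.
    unfold Cdiv. rewrite !Cmod_mult. rewrite (Cmod_inv (Cpowz p j)) by (now apply Cpowz_neq_0).
    rewrite !Cmod_Cpowz by exact Hp0.
    replace (w * Cpowz p n * Cpowz p j) with (w * Cpowz p (n + j)) by (rewrite Cpowz_add by exact Hp0; ring).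
    specialize (HM2 n). specialize (HM2' (n + j)%Z). rewrite powerRZ_add in HM2' by lra.
    set (P := powerRZ (Cmod p) n) in *. set (R' := powerRZ (Cmod p) j) in *.
    assert (hP : (0 < P)%R) by (apply powerRZ_lt; lra). assert (hR : (0 < R')%R) by (apply powerRZ_lt; lra).
    set (x1 := Cmod (/ (1 - a * Cpowz p n))) in *. set (x2 := Cmod (/ (1 - w * Cpowz p (n + j)))) in *.
    assert (hx1 : (0 <= x1)%R) by apply Cmod_ge_0. assert (hx2 : (0 <= x2)%R) by apply Cmod_ge_0.
    assert (ht := Cmod_ge_0 (thc p j)). assert (ha := Cmod_ge_0 a).
    set (t := Cmod (thc p j)) in *.
    assert (h1 : (x2 <= M' * (1 + / R') / (1 + P))%R).
    { eapply Rle_trans; [exact HM2'|]. unfold Rdiv. rewrite !Rmult_assoc. apply Rmult_le_compat_l; [lra|].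
      apply Rmult_le_reg_r with ((1 + P * R') * (1 + P))%R; [nra|].
      replace (/ (1 + P * R') * ((1 + P * R') * (1 + P)))%R with (1 + P)%R by (field; nra).
      replace ((1 + / R') * / (1 + P) * ((1 + P * R') * (1 + P)))%R with (1 + P + P * R' + / R')%R
        by (field; lra).
      assert (0 < / R')%R by (apply Rinv_0_lt_compat; lra). nra. }
    assert (h2 : (x1 * x2 <= (M / (1 + P)) * (M' * (1 + / R') / (1 + P)))%R)
      by (apply Rmult_le_compat; lra).
    apply Rle_trans with (Cmod a * P * t * ((M / (1 + P)) * (M' * (1 + / R') / (1 + P))))%R.
    - replace (Cmod a * P * x1 * (t * x2))%R with (Cmod a * P * t * (x1 * x2))%R by ring.
      apply Rmult_le_compat_l; [|exact h2]. repeat apply Rmult_le_pos; lra.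
    - right. field. lra. }
  assert (HFG : forall k n, F (k, n) = G ((k + - n)%Z, n)).
  { intros k n. unfold F, G.
    assert (e : thc p k = thc p (k + - n) * thc p n * Cpowz p (k * n) / Cpowz p (n * n)).
    { replace k with ((k + - n) + n)%Z at 1 by ring. rewrite thc_add by exact Hp0.
      rewrite Z.mul_add_distr_r, Z.mul_opp_l, Cpowz_add, Cpowz_opp by exact Hp0.
      field. now apply Cpowz_neq_0. }
    assert (ek : Cpowz p n * Cpowz p (k + - n) = Cpowz p k)
      by (rewrite <- Cpowz_add by exact Hp0; f_equal; ring).
    rewrite e, Cpowz_1_l, <- Cpowz_mul by exact Hp0.
    replace ((2 - k) * n)%Z with (n + n - k * n)%Z by ring.
    rewrite Cpowz_sub, (Cpowz_add p n n) by exact Hp0.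
    replace (1 - w * Cpowz p n * Cpowz p (k + - n)) with (1 - w * Cpowz p k) by (rewrite <- ek; ring).
    assert (e2 := thc_sq p Hp0 n). assert (hA := HA n). assert (hW := HW k).
    transitivity (thc p (k + - n) * (thc p n * thc p n) * Cpowz p (k * n) / Cpowz p (n * n)
      / (1 - w * Cpowz p k) * a * ((Cpowz p n * Cpowz p n / Cpowz p (k * n)) / (1 - a * Cpowz p n))).
    - field. repeat split; auto using Cpowz_neq_0.
    - rewrite e2. field. repeat split; auto using Cpowz_neq_0. }
  assert (HF : summable F).
  { apply summable_ext with (fun x => G ((fst x + - snd x)%Z, snd x)).
    - intros [k n]. now rewrite HFG.
    - apply (summable_inj (fun x : Z * Z => ((fst x + - snd x)%Z, snd x))); [|exact HG].
      intros [n l] [n' l']. simpl. intros E. injection E as E ->. f_equal. lia. }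
  destruct (Sum_fubini F HF) as [_ e1]. destruct (Sum_fubini_swap F HF) as [_ e2].
  assert (n1 := thp_neq_0 p Hp a Ha HA). assert (n2 := thp_neq_0 p Hp w Hw HW).
  assert (Hpw : p * w <> 0) by auto using Cmult_neq_0.
  assert (L : appell p a w * pfrac p a = Sum F).
  { rewrite <- e1. unfold appell. rewrite Cmult_comm, <- Sum_scal by (now apply summable_thc_div).
    apply Sum_ext. intros k. unfold F.
    rewrite Sum_scal by (apply summable_thc_div; auto using Cpowz_neq_0).
    change (Sum (fun n => thc p n * Cpowz (Cpowz p (2 - k)) n / (1 - a * Cpowz p n)))
      with (appell p (Cpowz p (2 - k)) a).
    rewrite appell_Cpowz by assumption.
    replace (1 - (2 - k))%Z with (k - 1)%Z by ring. rewrite Cpowz_sub, Cpowz_1 by exact Ha.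
    assert (hW := HW k). field. auto. }
  assert (R : Sum F = J * J * w / thp p w * (appell p (p * w) a - theta p (p * w))).
  { rewrite <- e2. unfold appell, theta.
    replace (Sum (fun n => thc p n * Cpowz (p * w) n / (1 - a * Cpowz p n)) - Sum (fun n => thc p n * Cpowz (p * w) n))
      with (Sum (fun n => thc p n * Cpowz (p * w) n / (1 - a * Cpowz p n)) + (- (1)) * Sum (fun n => thc p n * Cpowz (p * w) n))
      by ring.
    assert (s1 := summable_thc p (p * w) Hp Hpw).
    assert (s2 := summable_thc_div p Hp a (p * w) Ha Hpw HA).
    rewrite <- (Sum_scal (- (1))) by exact s1.
    rewrite <- Sum_plus by (exact s2 || apply summable_scal, s1).
    rewrite <- Sum_scal by (apply summable_plus; [exact s2 | apply summable_scal, s1]).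
    apply Sum_ext. intros n.
    rewrite (Sum_ext _ (fun k => G ((k + - n)%Z, n))) by (intros; apply HFG).
    assert (sG : summable (fun j => G (j, n))).
    { apply (summable_inj (fun j => (j, n))); [congruence | exact HG]. }
    rewrite (Sum_shift (fun j => G (j, n)) (- n)) by exact sG.
    unfold G. assert (HWn := nopole_shift p w n Hp0 HW).
    assert (Hwn : w * Cpowz p n <> 0) by auto using Cmult_neq_0, Cpowz_neq_0.
    rewrite Sum_scal by (apply summable_thc_div; auto using C1_nz).
    change (Sum (fun i => thc p i * Cpowz 1 i / (1 - w * Cpowz p n * Cpowz p i)))
      with (appell p 1 (w * Cpowz p n)).
    rewrite appell_1, pfrac_eq by assumption. fold J.
    replace (thp p (w * Cpowz p n)) with (thp p (Cpowz p n * w)) by (f_equal; ring).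
    rewrite thp_Cpowz, Cpowz_mult_l by assumption.
    assert (hA := HA n). field. repeat split; auto using Cpowz_neq_0, thc_neq_0. }
  rewrite (pfrac_eq p Hp a Ha HA) in L. fold J in L.
  rewrite theta_eq, thp_shift in R by assumption.
  replace (appell p a w / thp p a) with (appell p a w * (J * J / thp p a) / (J * J)) by (field; auto).
  rewrite L, R. field. auto.
Qed.

(** Partial fractions of the product of Kronecker's series with a series
    [sum_n a_n / (1 - u p^(e n) x)]. *)
Lemma kron_mult_pfrac (b u x : C) (e : Z) (a : Z -> C) :
  (0 < e)%Z -> (Cmod p < Cmod b < 1)%R -> u <> 0 -> x <> 0 ->
  nopole p u -> nopole p x -> nopole (Cpowz p e) (x * u) -> summable a ->
  let G := fun t => Sum (fun n => a n / (1 - t * u * Cpowz (Cpowz p e) n)) in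
  summable (fun m => Cpowz b m * G (Cpowz p (- m)) / (1 - x * Cpowz p m)) /\
  kron p b x * G x
  = Sum (fun m => Cpowz b m * G (Cpowz p (- m)) / (1 - x * Cpowz p m))
    + kron p b (/ u) * Sum (fun n => a n * Cpowz (Cpowz b e) n / (1 - x * u * Cpowz (Cpowz p e) n)).
Proof.
  intros He Hb Hu Hx HU HX HXU Ha G.
  assert (Hb0 : b <> 0) by (apply Cmod_gt_0; lra).
  set (r := Cpowz p e) in *. assert (Hr0 : r <> 0) by (now apply Cpowz_neq_0).
  assert (Hr : (0 < Cmod r < 1)%R).
  { split; [now apply Cmod_gt_0|]. unfold r. rewrite Cmod_Cpowz by exact Hp0.
    assert (h := powerRZ_antitone (Cmod p) 1 e Hp ltac:(lia)). rewrite powerRZ_1 in h. lra. }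
  destruct (pole_inv_bounded p u Hp Hu HU) as [M HM].
  destruct (pole_inv_bounded r (x * u) Hr (Cmult_neq_0 _ _ Hx Hu) HXU) as [M' HM'].
  assert (sk := summable_kron x b Hb Hx HX).
  assert (sa : summable (fun n => a n / (1 - x * u * Cpowz r n))).
  { apply summable_ext with (fun n => / (1 - x * u * Cpowz r n) * a n); [intros; unfold Cdiv; ring|].
    apply summable_bounded_mult with M'; assumption. }
  set (F := fun y : Z * Z => (Cpowz b (fst y) / (1 - x * Cpowz p (fst y)))
     * (a (snd y) / (1 - x * u * Cpowz r (snd y)))).
  (* [F = F1 + F2] is the term by term splitting into simple fractions; [F2] is summable because [F]
     and [F1] are. *)
  set (F1 := fun y : Z * Z => let (m, n) := y in
     / (1 - u * Cpowz p (e * n - m)) * ((Cpowz b m / (1 - x * Cpowz p m)) * a n)).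
  set (F2 := fun y : Z * Z => F y + (- (1)) * F1 y).
  assert (sF : summable F) by (apply (summable_prod _ _ sk sa)).
  assert (sF1 : summable F1).
  { apply summable_ext with (fun y : Z * Z => / (1 - u * Cpowz p (e * snd y - fst y)) *
      ((Cpowz b (fst y) / (1 - x * Cpowz p (fst y))) * a (snd y))); [now intros [m n]|].
    apply summable_bounded_mult with M; [intros; apply HM | apply (summable_prod _ _ sk Ha)]. }
  assert (sF2 : summable F2) by (apply summable_plus; [exact sF | apply summable_scal, sF1]).
  assert (eF : Sum F = kron p b x * G x).
  { rewrite <- (proj2 (Sum_fubini F sF)). unfold F. simpl fst. simpl snd.
    rewrite (Sum_ext _ (fun m => G x * (Cpowz b m / (1 - x * Cpowz p m)))).
    - rewrite Sum_scal by exact sk. unfold kron. ring.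
    - intros m. rewrite Sum_scal by exact sa. unfold G. ring. }
  assert (eF12 : Sum F = Sum F1 + Sum F2).
  { rewrite <- Sum_plus by assumption. apply Sum_ext. intros y. unfold F2. ring. }
  assert (Epow : forall n m, Cpowz p (e * n - m) = Cpowz r n / Cpowz p m).
  { intros n m. unfold r. now rewrite Cpowz_sub, Cpowz_mul. }
  destruct (Sum_fubini F1 sF1) as [sF1' eF1]. destruct (Sum_fubini_swap F2 sF2) as [sF2' eF2].
  assert (g1 : forall m, Sum (fun n => F1 (m, n)) = Cpowz b m * G (Cpowz p (- m)) / (1 - x * Cpowz p m)).
  { intros m. unfold F1.
    rewrite (Sum_ext _ (fun n => Cpowz b m / (1 - x * Cpowz p m) * (a n / (1 - Cpowz p (- m) * u * Cpowz r n)))).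
    - rewrite Sum_scal.
      + unfold G. unfold Cdiv. ring.
      + apply summable_ext with (fun n => / (1 - u * Cpowz p (e * n - m)) * a n).
        * intros n. rewrite Epow, Cpowz_opp by exact Hp0. unfold Cdiv. rewrite Cmult_comm.
          f_equal. f_equal. ring.
        * apply summable_bounded_mult with M; [intros; apply HM | exact Ha].
    - intros n. rewrite Epow, Cpowz_opp by exact Hp0. unfold Cdiv.
      replace (u * (Cpowz r n * / Cpowz p m)) with (/ Cpowz p m * u * Cpowz r n) by ring. ring. }
  assert (g2 : forall n, Sum (fun m => F2 (m, n))
    = kron p b (/ u) * (a n * Cpowz (Cpowz b e) n / (1 - x * u * Cpowz r n))).
  { intros n.
    assert (HU' : nopole p (/ u)) by (now apply nopole_inv).
    assert (HUn : nopole p (/ u * Cpowz p (- (e * n)))) by (now apply nopole_shift).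
    assert (hUn : / u * Cpowz p (- (e * n)) <> 0) by auto using Cmult_neq_0, Cinv_neq_0, Cpowz_neq_0.
    rewrite (Sum_ext _ (fun m => a n / (1 - x * u * Cpowz r n) *
      (Cpowz b m / (1 - / u * Cpowz p (- (e * n)) * Cpowz p m)))).
    - rewrite Sum_scal by (now apply summable_kron).
      change (Sum (fun m => Cpowz b m / (1 - / u * Cpowz p (- (e * n)) * Cpowz p m)))
        with (kron p b (/ u * Cpowz p (- (e * n)))).
      rewrite kron_shift by (auto using Cinv_neq_0).
      rewrite Cpowz_opp, Cpowz_mul by exact Hb0.
      assert (h := HXU n). field. split; [exact h | now apply Cpowz_neq_0, Cpowz_neq_0].
    - intros m. unfold F2, F, F1. simpl fst. simpl snd.
      assert (h1 := HXU n). assert (h2 := HX m). assert (h3 := HU (e * n - m)%Z).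
      assert (h4 := HUn m). rewrite Epow in h3 |- *. rewrite Cpowz_opp, Cpowz_mul in h4 |- * by exact Hp0. fold r in h4 |- *.
      assert (n1 := Cpowz_neq_0 p m Hp0). assert (n2 := Cpowz_neq_0 r n Hr0).
      assert (h5 : Cpowz p m - u * Cpowz r n <> 0).
      { intros h. apply h3. replace (1 - u * (Cpowz r n / Cpowz p m)) with
          ((Cpowz p m - u * Cpowz r n) / Cpowz p m) by (field; exact n1). rewrite h. unfold Cdiv. ring. }
      field. repeat split; auto.
      intros h. apply h5. replace (Cpowz p m - u * Cpowz r n) with (- (u * Cpowz r n - Cpowz p m)) by ring.
      rewrite h. ring. }
  split.
  - eapply summable_ext; [exact g1 | exact sF1'].
  - rewrite <- eF, eF12, <- eF1, <- eF2. f_equal.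
    + apply Sum_ext, g1.
    + rewrite (Sum_ext _ _ g2). apply Sum_scal_weak.
      eapply summable_ext; [exact g2 | exact sF2'].
Qed.

(** The theta quotient with two families of simple poles as a combination of Appell-Lerch sums. *)
Lemma thp_quotient_appell (al la w : C) :
  (Cmod p < Cmod al < 1)%R -> la <> 0 -> w <> 0 ->
  nopole p la -> nopole p w -> nopole p (w * la) ->
  J * J * thp p (al * w) / (thp p w * thp p (w * la))
  = thp p al / thp p la * appell p (al * p / la) w
    + thp p (al / la) / thp p (/ la) * appell p (al * p) (w * la).
Proof.
  intros Hal Hla Hw HL HW HWL.
  assert (Hal0 : al <> 0) by (apply Cmod_gt_0; lra).
  assert (HA := nopole_annulus p al Hp Hal). assert (HL' := nopole_inv p la Hp0 Hla HL).
  assert (Hla' := Cinv_neq_0 la Hla). assert (Hwl := Cmult_neq_0 _ _ Hw Hla).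
  assert (n1 := thp_neq_0 p Hp la Hla HL). assert (n2 := thp_neq_0 p Hp w Hw HW).
  assert (n3 := thp_neq_0 p Hp (w * la) Hwl HWL). assert (n4 := thp_neq_0 p Hp (/ la) Hla' HL').
  assert (n5 := thp_neq_0 p Hp al Hal0 HA).
  destruct (kron_mult_pfrac al la w 1 (fun n => thc p n * Cpowz p n) eq_refl Hal Hla Hw HL HW)
    as [_ e].
  { now rewrite Cpowz_1. }
  { now apply summable_thc. }
  cbv beta zeta in e. rewrite !Cpowz_1 in e.
  change (Sum (fun n => thc p n * Cpowz p n / (1 - w * la * Cpowz p n))) with (pfrac p (w * la)) in e.
  rewrite (Sum_ext (fun m => Cpowz al m * _ / _)
    (fun m => J * J / thp p la * (thc p m * Cpowz (al * p / la) m / (1 - w * Cpowz p m)))) in e.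
  2: { intros m.
    change (Sum (fun n => thc p n * Cpowz p n / (1 - Cpowz p (- m) * la * Cpowz p n)))
      with (pfrac p (Cpowz p (- m) * la)).
    rewrite pfrac_eq.
    - fold J. rewrite thp_Cpowz, thc_opp, Cpowz_opp by assumption.
      rewrite Cpowz_div, Cpowz_mult_l by (auto using Cmult_neq_0).
      assert (h := HW m). field. repeat split; auto using Cpowz_neq_0, thc_neq_0.
    - exact Hp.
    - auto using Cmult_neq_0, Cpowz_neq_0.
    - rewrite Cmult_comm. now apply nopole_shift. }
  rewrite Sum_scal in e by (apply summable_thc_div; auto using Cdiv_neq_0, Cmult_neq_0).
  change (Sum (fun n => thc p n * Cpowz (al * p / la) n / (1 - w * Cpowz p n)))
    with (appell p (al * p / la) w) in e.
  rewrite (Sum_ext (fun n => thc p n * Cpowz p n * Cpowz al n / (1 - w * la * Cpowz p n))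
    (fun n => thc p n * Cpowz (al * p) n / (1 - w * la * Cpowz p n))) in e.
  2: { intros n. rewrite Cpowz_mult_l by assumption. unfold Cdiv. ring. }
  change (Sum (fun n => thc p n * Cpowz (al * p) n / (1 - w * la * Cpowz p n)))
    with (appell p (al * p) (w * la)) in e.
  rewrite pfrac_eq in e by assumption.
  rewrite !kron_eq in e by assumption. fold J in e.
  replace (/ la * al) with (al / la) in e by (unfold Cdiv; ring).
  replace (al * w) with (w * al) by ring.
  transitivity (thp p al / (J * J) * (J * J * thp p (w * al) / (thp p w * thp p al) * (J * J / thp p (w * la)))).
  - field. repeat split; auto.
  - rewrite e. field. repeat split; auto.
Qed.

End Appell.

(** * The double sum as a partial fraction series *)

(** The sign with which the index [(s, t)] enters the double sum. *)
Definition quadrant_sign (s t : Z) : C :=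
  if Z.leb 0 s then (if Z.leb 0 t then 1 else 0) else (if Z.leb 0 t then 0 else - (1)).

(** The double sum as one family over all pairs of integers. *)
Definition signed_term (q x y z : C) (i : Z * Z) : C :=
  quadrant_sign (fst i) (snd i) * double_term q x y z i.

(** The term of index [(s, n - s)] of the double sum, without its denominator. *)
Definition diag_term (q y z : C) (n s : Z) : C :=
  quadrant_sign s (n - s) * (Cpowz q (s * (n - s)) * Cpowz y s * Cpowz z (n - s)).

(** The coefficient of [1 / (1 - x q^n)] in the double sum. *)
Definition diag_sum (q y z : C) (n : Z) : C := Sum (diag_term q y z n).

Lemma summable_single {I : Type} (a : I -> C) i0 : (forall i, i <> i0 -> a i = 0) -> summable a.
Proof.
  intros H. exists (Cmod (a i0)). intros F HF.
  assert (h0 : forall G, ~ In i0 G -> Rsum_list (fun i => Cmod (a i)) G = 0%R).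
  { induction G as [|i G IH]; simpl; intros h; [easy|].
    rewrite IH, H, Cmod_0 by intuition congruence. ring. }
  induction HF as [|i F hi HF IH]; simpl; [apply Cmod_ge_0|].
  destruct (eq_dec_cl i i0) as [->|hne].
  - rewrite h0 by exact hi. lra.
  - rewrite H, Cmod_0 by exact hne. lra.
Qed.

Section DoubleSum.
Variables q y z : C.
Hypothesis Hq : (0 < Cmod q < 1)%R.
Hypothesis Hy : (Cmod q < Cmod y < 1)%R.
Hypothesis Hz : (Cmod q < Cmod z < 1)%R.

Let Hq0 : q <> 0.
Proof. apply Cmod_gt_0. lra. Qed.
Let Hy0 : y <> 0.
Proof. apply Cmod_gt_0. lra. Qed.
Let Hz0 : z <> 0.
Proof. apply Cmod_gt_0. lra. Qed.

(** The factor of the dominating product family that depends on one index only. *)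
Definition damped (b : C) (n : Z) : R := (powerRZ (Cmod b) n / (1 + powerRZ (Cmod q) n))%R.

Lemma signed_term_bound x M : (0 <= M)%R ->
  (forall n, (Cmod (/ (1 - x * Cpowz q n)) <= M / (1 + powerRZ (Cmod q) n))%R) ->
  forall i, (Cmod (signed_term q x y z i) <= 4 * M * (damped y (fst i) * damped z (snd i)))%R.
Proof.
  intros HM H [s t]. unfold signed_term, double_term, damped. simpl fst. simpl snd.
  specialize (H (s + t)%Z).
  set (r := Cmod q) in *.
  assert (hs : (0 < powerRZ r s)%R) by (apply powerRZ_lt; lra).
  assert (ht : (0 < powerRZ r t)%R) by (apply powerRZ_lt; lra).
  assert (hys : (0 < powerRZ (Cmod y) s)%R) by (apply powerRZ_lt; lra).
  assert (hzt : (0 < powerRZ (Cmod z) t)%R) by (apply powerRZ_lt; lra).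
  rewrite powerRZ_add in H by lra.
  assert (Hm : (Cmod (Cpowz q (s * t) * Cpowz y s * Cpowz z t / (1 - x * Cpowz q (s + t)))
    <= powerRZ r (s * t) * powerRZ (Cmod y) s * powerRZ (Cmod z) t
       * (M / (1 + powerRZ r s * powerRZ r t)))%R).
  { unfold Cdiv. rewrite !Cmod_mult, !Cmod_Cpowz by assumption. fold r.
    assert (h : (0 < powerRZ r (s * t))%R) by (apply powerRZ_lt; lra).
    apply Rmult_le_compat_l; [|exact H]. repeat apply Rmult_le_pos; lra. }
  set (T := Cmod (_ / _)) in Hm.
  set (P := powerRZ r s) in *. set (R' := powerRZ r t) in *.
  set (Y := powerRZ (Cmod y) s) in *. set (W := powerRZ (Cmod z) t) in *.
  assert (Hcase : (powerRZ r (s * t) / (1 + P * R') <= 4 / ((1 + P) * (1 + R')))%R ->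
     (T <= 4 * M * (Y / (1 + P) * (W / (1 + R'))))%R).
  { intros hc. eapply Rle_trans; [exact Hm|].
    replace (powerRZ r (s * t) * Y * W * (M / (1 + P * R')))%R with
      (Y * W * M * (powerRZ r (s * t) / (1 + P * R')))%R by (unfold Rdiv; ring).
    replace (4 * M * (Y / (1 + P) * (W / (1 + R'))))%R with (Y * W * M * (4 / ((1 + P) * (1 + R'))))%R
      by (field; lra).
    apply Rmult_le_compat_l; [|exact hc]. repeat apply Rmult_le_pos; lra. }
  assert (Hpos : (0 <= 4 * M * (Y / (1 + P) * (W / (1 + R'))))%R).
  { repeat apply Rmult_le_pos; try lra; left; apply Rinv_0_lt_compat; lra. }
  assert (hprod : (0 < P * R')%R) by now apply Rmult_lt_0_compat.
  assert (h4 : (0 < (1 + P) * (1 + R'))%R) by (apply Rmult_lt_0_compat; lra).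
  unfold quadrant_sign. destruct (Z.leb_spec 0 s) as [h1|h1]; destruct (Z.leb_spec 0 t) as [h2|h2];
    rewrite Cmod_mult.
  - rewrite Cmod_1, Rmult_1_l. apply Hcase.
    assert (e1 := powerRZ_antitone r 0 (s * t) Hq ltac:(nia)). rewrite powerRZ_O in e1.
    assert (e2 := powerRZ_antitone r 0 s Hq h1). rewrite powerRZ_O in e2. fold P in e2.
    assert (e3 := powerRZ_antitone r 0 t Hq h2). rewrite powerRZ_O in e3. fold R' in e3.
    apply Rmult_le_reg_r with ((1 + P * R') * ((1 + P) * (1 + R')))%R; [nra|].
    replace (powerRZ r (s * t) / (1 + P * R') * ((1 + P * R') * ((1 + P) * (1 + R'))))%R
      with (powerRZ r (s * t) * ((1 + P) * (1 + R')))%R by (field; nra).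
    replace (4 / ((1 + P) * (1 + R')) * ((1 + P * R') * ((1 + P) * (1 + R'))))%R
      with (4 * (1 + P * R'))%R by (field; nra).
    nra.
  - rewrite Cmod_0, Rmult_0_l. exact Hpos.
  - rewrite Cmod_0, Rmult_0_l. exact Hpos.
  - rewrite Cmod_opp, Cmod_1, Rmult_1_l. apply Hcase.
    assert (e1 := powerRZ_antitone r 0 (s * t) Hq ltac:(nia)). rewrite powerRZ_O in e1.
    assert (e2 := powerRZ_antitone r s 0 Hq ltac:(lia)). rewrite powerRZ_O in e2. fold P in e2.
    assert (e3 := powerRZ_antitone r t 0 Hq ltac:(lia)). rewrite powerRZ_O in e3. fold R' in e3.
    apply Rmult_le_reg_r with ((1 + P * R') * ((1 + P) * (1 + R')))%R; [nra|].
    replace (powerRZ r (s * t) / (1 + P * R') * ((1 + P * R') * ((1 + P) * (1 + R'))))%R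
      with (powerRZ r (s * t) * ((1 + P) * (1 + R')))%R by (field; nra).
    replace (4 / ((1 + P) * (1 + R')) * ((1 + P * R') * ((1 + P) * (1 + R'))))%R
      with (4 * (1 + P * R'))%R by (field; nra).
    nra.
Qed.

Lemma rsummable_damped2 M : (0 <= M)%R ->
  rsummable (fun i : Z * Z => (4 * M * (damped y (fst i) * damped z (snd i)))%R).
Proof.
  intros HM. assert (h : forall b, (Cmod q < Cmod b < 1)%R -> forall n, (0 <= damped b n)%R).
  { intros b Hb n. unfold damped. assert (0 < powerRZ (Cmod b) n)%R by (apply powerRZ_lt; lra).
    assert (0 < powerRZ (Cmod q) n)%R by (apply powerRZ_lt; lra).
    apply Rlt_le, Rdiv_lt_0_compat; lra. }
  apply rsummable_scal; [lra|].
  apply (rsummable_prod (damped y) (damped z)); try (apply h; assumption);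
    apply rsummable_geom_damped; assumption.
Qed.

Lemma summable_signed_term (x : C) : x <> 0 -> nopole q x -> summable (signed_term q x y z).
Proof.
  intros Hx H. destruct (pole_inv_bound q x Hq Hx H) as [M [HM HM2]].
  eapply summable_le; [apply (signed_term_bound x M); [lra | exact HM2] | apply rsummable_damped2; lra].
Qed.

(** Both quadrant sums converge, and their difference is the signed sum over all indices. *)
Lemma lhs_signed (x : C) : x <> 0 -> nopole q x ->
  ex_sum_over nonneg2 (double_term q x y z) /\ ex_sum_over neg2 (double_term q x y z) /\
  lhs q x y z = Sum (signed_term q x y z).
Proof.
  intros Hx H. assert (s := summable_signed_term x Hx H).
  set (e1 := fun i : Z * Z => if Z.leb 0 (fst i) then
    (if Z.leb 0 (snd i) then double_term q x y z i else RtoC 0) else RtoC 0).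
  set (e2 := fun i : Z * Z => if Z.leb 0 (fst i) then RtoC 0 else
    (if Z.leb 0 (snd i) then RtoC 0 else double_term q x y z i)).
  assert (s1 : summable e1).
  { eapply summable_le; [|exact s]. intros [a b]. unfold e1, signed_term, quadrant_sign. simpl fst. simpl snd.
    destruct (Z.leb 0 a), (Z.leb 0 b); rewrite ?Cmult_1_l, ?Cmod_0; try apply Cmod_ge_0. lra. }
  assert (s2 : summable e2).
  { eapply summable_le; [|exact s]. intros [a b]. unfold e2, signed_term, quadrant_sign. simpl fst. simpl snd.
    destruct (Z.leb 0 a), (Z.leb 0 b); rewrite ?Cmod_0; try apply Cmod_ge_0.
    rewrite Cmod_mult, Cmod_opp, Cmod_1. lra. }
  assert (h1 : is_sum_over nonneg2 (double_term q x y z) (Sum e1)).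
  { apply is_sum_over_extend; [| |exact s1]; intros [a b]; unfold nonneg2, e1; simpl fst; simpl snd; intros h;
      destruct (Z.leb_spec 0 a), (Z.leb_spec 0 b); try easy; lia. }
  assert (h2 : is_sum_over neg2 (double_term q x y z) (Sum e2)).
  { apply is_sum_over_extend; [| |exact s2]; intros [a b]; unfold neg2, e2; simpl fst; simpl snd; intros h;
      destruct (Z.leb_spec 0 a), (Z.leb_spec 0 b); try easy; lia. }
  split; [now exists (Sum e1)|]. split; [now exists (Sum e2)|].
  unfold lhs. rewrite (sum_over_eq _ _ _ h1), (sum_over_eq _ _ _ h2).
  replace (Sum e1 - Sum e2) with (Sum e1 + (- (1)) * Sum e2) by ring.
  rewrite <- Sum_scal by exact s2. rewrite <- Sum_plus by (exact s1 || apply summable_scal, s2).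
  apply Sum_ext. intros [a b]. unfold e1, e2, signed_term, quadrant_sign. simpl fst. simpl snd.
  destruct (Z.leb 0 a), (Z.leb 0 b); ring.
Qed.

Lemma signed_term_diag (x : C) n s : nopole q x ->
  signed_term q x y z (s, (n - s)%Z) = / (1 - x * Cpowz q n) * diag_term q y z n s.
Proof.
  intros H. unfold signed_term, double_term, diag_term. simpl fst. simpl snd.
  replace (s + (n - s))%Z with n by ring. unfold Cdiv. ring.
Qed.

Lemma lhs_diag (x : C) : x <> 0 -> nopole q x ->
  (forall n, summable (diag_term q y z n)) /\
  lhs q x y z = Sum (fun n => diag_sum q y z n / (1 - x * Cpowz q n)).
Proof.
  intros Hx H. assert (s := summable_signed_term x Hx H).
  set (D := fun i : Z * Z => signed_term q x y z (snd i, (fst i - snd i)%Z)).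
  assert (sD : summable D).
  { apply (summable_inj (fun i : Z * Z => (snd i, (fst i - snd i)%Z))); [|exact s].
    intros [a b] [a' b']. simpl. intros E. injection E as -> E. f_equal. lia. }
  assert (sn : forall n, summable (diag_term q y z n)).
  { intros n. apply summable_ext with (fun s => (1 - x * Cpowz q n) * D (n, s)).
    - intros k. unfold D. simpl fst. simpl snd. rewrite signed_term_diag by exact H.
      assert (h := H n). field. exact h.
    - apply summable_scal, summable_row, sD. }
  split; [exact sn|].
  rewrite (proj2 (proj2 (lhs_signed x Hx H))).
  rewrite <- (Sum_reindex (fun i : Z * Z => (snd i, (fst i - snd i)%Z)) (fun i => ((fst i + snd i)%Z, fst i))
    _ ltac:(intros [? ?]; simpl; f_equal; lia) ltac:(intros [? ?]; simpl; f_equal; lia) s).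
  change (Sum (fun i : Z * Z => signed_term q x y z (snd i, (fst i - snd i)%Z))) with (Sum D).
  rewrite <- (proj2 (Sum_fubini D sD)). apply Sum_ext. intros n.
  unfold D. simpl fst. simpl snd.
  rewrite (Sum_ext _ (fun k => / (1 - x * Cpowz q n) * diag_term q y z n k)).
  - rewrite Sum_scal by apply sn. unfold diag_sum, Cdiv. ring.
  - intros k. now apply signed_term_diag.
Qed.

Lemma summable_diag n : summable (diag_term q y z n).
Proof. apply (lhs_diag y Hy0). now apply nopole_annulus. Qed.

Lemma diag_sum_0 : diag_sum q y z 0 = 1.
Proof.
  unfold diag_sum. rewrite (Sum_single _ 0%Z).
  - unfold diag_term, quadrant_sign. simpl. ring.
  - intros s hs. unfold diag_term, quadrant_sign.
    destruct (Z.leb_spec 0 s), (Z.leb_spec 0 (0 - s)); try lia; ring.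
Qed.

Lemma diag_sum_m1 : diag_sum q y z (-1) = 0.
Proof.
  assert (h : forall s, diag_term q y z (-1) s = 0).
  { intros s. unfold diag_term, quadrant_sign.
    destruct (Z.leb_spec 0 s), (Z.leb_spec 0 (-1 - s)); try lia; ring. }
  unfold diag_sum. rewrite (Sum_single _ 0%Z); auto.
Qed.

Lemma diag_sum_rec n :
  diag_sum q y z (n + 2) = Cpowz q (n + 1) * y * z * diag_sum q y z n + Cpowz y (n + 2) + Cpowz z (n + 2).
Proof.
  set (d1 := fun s : Z => if Z.eq_dec s (n + 1) then Cpowz y (n + 2) else RtoC 0).
  set (d2 := fun s : Z => if Z.eq_dec s (-1) then Cpowz z (n + 2) else RtoC 0).
  assert (z1 : forall s, s <> (n + 1)%Z -> d1 s = 0).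
  { intros s hs. unfold d1. destruct (Z.eq_dec s (n + 1)); easy. }
  assert (z2 : forall s, s <> (-1)%Z -> d2 s = 0).
  { intros s hs. unfold d2. destruct (Z.eq_dec s (-1)); easy. }
  assert (s1 := summable_single d1 _ z1). assert (s2 := summable_single d2 _ z2).
  assert (e1 : Sum d1 = Cpowz y (n + 2)).
  { rewrite (Sum_single d1 _ z1). unfold d1. destruct (Z.eq_dec (n + 1) (n + 1)); easy. }
  assert (e2 : Sum d2 = Cpowz z (n + 2)).
  { rewrite (Sum_single d2 _ z2). unfold d2. destruct (Z.eq_dec (-1) (-1)); easy. }
  rewrite <- e1, <- e2. unfold diag_sum.
  rewrite <- (Sum_shift (diag_term q y z (n + 2)) 1) by apply summable_diag.
  rewrite <- Sum_scal by apply summable_diag.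
  assert (s3 := summable_scal (Cpowz q (n + 1) * y * z) _ (summable_diag n)).
  rewrite <- Sum_plus by assumption. rewrite <- Sum_plus by (try apply summable_plus; assumption).
  apply Sum_ext. intros s. unfold diag_term.
  replace (n + 2 - (s + 1))%Z with (n - s + 1)%Z by ring.
  replace ((s + 1) * (n - s + 1))%Z with (s * (n - s) + (n + 1))%Z by ring.
  rewrite (Cpowz_add q), (Cpowz_succ y s), (Cpowz_succ z (n - s)) by assumption.
  set (X := Cpowz q (s * (n - s)) * Cpowz y s * Cpowz z (n - s)).
  replace (Cpowz q (s * (n - s)) * Cpowz q (n + 1) * (y * Cpowz y s) * (z * Cpowz z (n - s)))
    with (Cpowz q (n + 1) * y * z * X) by (unfold X; ring).
  (* Shifting both indices by one changes the sign only on the two lines [s = -1] and [t = -1]. *)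
  assert (Hs : quadrant_sign (s + 1) (n - s + 1) = quadrant_sign s (n - s)
     + (if Z.eq_dec s (n + 1) then RtoC 1 else RtoC 0) + (if Z.eq_dec s (-1) then RtoC 1 else RtoC 0)).
  { unfold quadrant_sign.
    destruct (Z.leb_spec 0 (s + 1)), (Z.leb_spec 0 (n - s + 1)), (Z.leb_spec 0 s), (Z.leb_spec 0 (n - s)),
      (Z.eq_dec s (n + 1)), (Z.eq_dec s (-1)); try lia; ring. }
  rewrite Hs.
  assert (E1 : (if Z.eq_dec s (n + 1) then RtoC 1 else RtoC 0) * (Cpowz q (n + 1) * y * z * X) = d1 s).
  { unfold d1, X. destruct (Z.eq_dec s (n + 1)) as [->|]; [|ring].
    replace ((n + 1) * (n - (n + 1)))%Z with (- (n + 1))%Z by ring.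
    replace (n - (n + 1))%Z with (- (1))%Z by ring. rewrite !Cpowz_opp, Cpowz_1 by assumption.
    replace (n + 2)%Z with (n + 1 + 1)%Z by ring. rewrite (Cpowz_succ y (n + 1)) by assumption.
    field. split; [exact Hz0 | now apply Cpowz_neq_0]. }
  assert (E2 : (if Z.eq_dec s (-1) then RtoC 1 else RtoC 0) * (Cpowz q (n + 1) * y * z * X) = d2 s).
  { unfold d2, X. destruct (Z.eq_dec s (-1)) as [->|]; [|ring].
    replace (-1 * (n - -1))%Z with (- (n + 1))%Z by ring.
    replace (n - -1)%Z with (n + 1)%Z by ring. change (-1)%Z with (- (1))%Z.
    rewrite !Cpowz_opp, Cpowz_1 by assumption.
    replace (n + 2)%Z with (n + 1 + 1)%Z by ring. rewrite (Cpowz_succ z (n + 1)) by assumption.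
    field. split; [exact Hy0 | now apply Cpowz_neq_0]. }
  rewrite <- E1, <- E2. ring.
Qed.

(** Two solutions of the recurrence that agree at [0] and at [-1] are equal. *)
Lemma diag_sum_unique (B : Z -> C) : B 0%Z = 1 -> B (-1)%Z = 0 ->
  (forall n, B (n + 2)%Z = Cpowz q (n + 1) * y * z * B n + Cpowz y (n + 2) + Cpowz z (n + 2)) ->
  forall n, diag_sum q y z n = B n.
Proof.
  intros B0 B1 HB.
  assert (h : forall n, diag_sum q y z n = B n /\ diag_sum q y z (n - 1) = B (n - 1)%Z).
  { apply (Z.peano_ind (fun n => diag_sum q y z n = B n /\ diag_sum q y z (n - 1) = B (n - 1)%Z)).
    - simpl Z.sub. rewrite diag_sum_0, diag_sum_m1. auto.
    - intros n [IH1 IH2]. unfold Z.succ. replace (n + 1 - 1)%Z with n by ring. split; [|exact IH1].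
      replace (n + 1)%Z with (n - 1 + 2)%Z by ring. rewrite diag_sum_rec, HB, IH2. easy.
    - intros n [IH1 IH2]. unfold Z.pred. split; [exact IH2|].
      assert (a1 := diag_sum_rec (n + -1 - 1)). assert (a2 := HB (n + -1 - 1)%Z).
      replace (n + -1 - 1 + 2)%Z with n in a1, a2 by ring.
      assert (nq := Cpowz_neq_0 q (n + -1 - 1 + 1) Hq0). set (c := Cpowz q (n + -1 - 1 + 1)) in *.
      set (D := diag_sum q y z (n + -1 - 1)) in *. set (E := B (n + -1 - 1)%Z) in *.
      replace D with ((c * y * z * D + Cpowz y n + Cpowz z n - Cpowz y n - Cpowz z n) / (c * y * z))
        by (field; auto).
      rewrite <- a1, IH1, a2. field. auto. }
  intros n. apply h.
Qed.

End DoubleSum.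

(** * The right-hand side in terms of theta products *)

Lemma thp_split (q a : C) : (0 < Cmod q < 1)%R -> a <> 0 ->
  thp q a = thp (q ^ 2) a * thp (q ^ 2) (q * a).
Proof.
  intros Hq Ha. assert (Hq0 : q <> 0) by (apply Cmod_gt_0; lra). unfold thp.
  rewrite (qpoch_split a q Hq), (qpoch_split (q / a) q Hq).
  replace (q * (q / a)) with (q ^ 2 / a) by (unfold Cdiv; ring).
  replace (q ^ 2 / (q * a)) with (q / a) by (field; auto). ring.
Qed.

(** The normalisation that makes the residues of the product term and of the first single sum agree;
    it amounts to [(-q; q)_oo (q; q)_oo = (q^2; q^2)_oo]. *)
Lemma thp_m1 (q : C) : (0 < Cmod q < 1)%R ->
  thp q (- (1)) * (qpoch q q * qpoch q q) = 2 * (qpoch (q ^ 2) (q ^ 2) * qpoch (q ^ 2) (q ^ 2)).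
Proof.
  intros Hq. unfold thp. rewrite (qpoch_rec (- (1)) q Hq), <- (qpoch_neg q Hq).
  replace (q / - (1)) with (- q) by (field; apply Copp_neq_0, C1_nz).
  replace (q * - (1)) with (- q) by ring. ring.
Qed.

Lemma Cmod_sq_range (q : C) : (0 < Cmod q < 1)%R -> (0 < Cmod (q ^ 2) < 1)%R.
Proof. intros Hq. rewrite Cmod_pow. simpl. nra. Qed.

Lemma Cpowz_sq (q : C) n : q <> 0 -> Cpowz (q ^ 2) n = Cpowz q (2 * n).
Proof. intros Hq. now rewrite Cpowz_mul. Qed.

Lemma nopole_sq (q x : C) : q <> 0 -> nopole q x -> nopole (q ^ 2) x.
Proof. intros Hq H n. rewrite Cpowz_sq by exact Hq. apply H. Qed.

Lemma nopole_sq_q (q x : C) : q <> 0 -> nopole q x -> nopole (q ^ 2) (q * x).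
Proof.
  intros Hq H. apply nopole_sq; [exact Hq|].
  replace (q * x) with (x * Cpowz q 1) by (rewrite Cpowz_1; ring). now apply nopole_shift.
Qed.

Lemma single_term_eq (q w c : C) k : q <> 0 -> w <> 0 ->
  single_term q w c k = thc (q ^ 2) k * Cpowz (q * w) k / (1 - - c * Cpowz (q ^ 2) k).
Proof.
  intros Hq Hw. unfold single_term, thc.
  rewrite !Cpowz_sq, tri_double, Cpowz_mult_l by assumption.
  replace (k * (k - 1))%Z with (k * k - k)%Z by ring. rewrite Cpowz_sub by exact Hq.
  replace (1 - - c * Cpowz q (2 * k)) with (1 + Cpowz q (2 * k) * c) by ring.
  unfold Cdiv. set (D := / (1 + _)). assert (n0 := Cpowz_neq_0 q k Hq). field. exact n0.
Qed.

Lemma single_term_sum (q w c : C) : (0 < Cmod q < 1)%R -> w <> 0 -> c <> 0 ->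
  nopole (q ^ 2) (- c) ->
  ex_sum_over all_Z (single_term q w c).
Proof.
  intros Hq Hw Hc H. assert (Hq0 : q <> 0) by (apply Cmod_gt_0; lra).
  assert (s := summable_ext _ (single_term q w c) (fun k => eq_sym (single_term_eq q w c k Hq0 Hw))
    (summable_thc_div (q ^ 2) (Cmod_sq_range q Hq) (- c) (q * w) (Copp_neq_0 c Hc) (Cmult_neq_0 _ _ Hq0 Hw) H)).
  exists (Sum (single_term q w c)). apply has_sum_is_sum_over, has_sum_Sum, s.
Qed.

Lemma single_part_eq (q a b c : C) : q <> 0 -> a <> 0 -> b <> 0 ->
  single_part q a b c
  = thp (q ^ 2) (a * b) / (thp q a * thp q b) * (qpoch q q ^ 2 / qpoch (q ^ 2) (q ^ 2))
    * appell (q ^ 2) (q * (a * b)) (- c).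
Proof.
  intros Hq Ha Hb. unfold single_part.
  replace (sum_over all_Z (single_term q (a * b) c)) with (appell (q ^ 2) (q * (a * b)) (- c)).
  - unfold qpochs, thp. cbn [fold_right]. f_equal. f_equal. unfold Cdiv. f_equal.
    + ring.
    + f_equal. ring.
  - symmetry. change (sum_over all_Z (single_term q (a * b) c)) with (Sum (single_term q (a * b) c)).
    apply Sum_ext. intros k. apply single_term_eq; auto using Cmult_neq_0.
Qed.

Lemma product_part_eq (q x y z : C) : x <> 0 -> y <> 0 -> z <> 0 ->
  product_part q x y z
  = 2 * (qpoch (q ^ 2) (q ^ 2) ^ 3 / (thp q x * thp q y * thp q z))
    * (thp (q ^ 2) (x * y) * thp (q ^ 2) (x * z) * thp (q ^ 2) (y * z)
       / (thp (q ^ 2) (- x) * thp (q ^ 2) (- y) * thp (q ^ 2) (- z))).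
Proof.
  intros Hx Hy Hz. unfold product_part.
  assert (h : forall a : C, a <> 0 -> - (q ^ 2 / a) = q ^ 2 / - a).
  { intros a Ha. assert (h0 := Copp_neq_0 a Ha). field. auto. }
  rewrite !h by assumption. unfold qpochs, thp. cbn [fold_right].
  f_equal; [f_equal|]; unfold Cdiv; f_equal; try (f_equal; ring). ring.
Qed.

Section Main.
Variables q : C.
Hypothesis Hq : (0 < Cmod q < 1)%R.

Let Hq0 : q <> 0.
Proof. apply Cmod_gt_0. lra. Qed.

Let Q := q ^ 2.
Let HQ : (0 < Cmod Q < 1)%R.
Proof. now apply Cmod_sq_range. Qed.
Let HQ0 : Q <> 0.
Proof. apply Cmod_gt_0. lra. Qed.
Let J := qpoch Q Q.
Let Jq := qpoch q q.
Let HJ : J <> 0.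
Proof. now apply qpoch_self_neq_0. Qed.
Let HJq : Jq <> 0.
Proof. now apply qpoch_self_neq_0. Qed.

Let HQr (b : C) : (Cmod q < Cmod b < 1)%R -> (Cmod Q < Cmod b < 1)%R.
Proof. intros Hb. unfold Q. rewrite Cmod_pow. simpl. nra. Qed.

Let HQr2 (b : C) : (Cmod q < Cmod b < 1)%R -> (Cmod Q < Cmod (q * b) < 1)%R.
Proof. intros Hb. unfold Q. rewrite Cmod_pow, Cmod_mult. simpl. nra. Qed.

Lemma nopole_opp_annulus (b : C) : (Cmod q < Cmod b < 1)%R -> nopole Q (- b).
Proof. intros Hb. apply nopole_annulus; [exact HQ|]. rewrite Cmod_opp. now apply HQr. Qed.

Lemma nopole_m1 : nopole q (- (1)).
Proof.
  apply nopole_iff; [exact Hq0|]. intros n h.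
  assert (e : Cmod (- (1)) = powerRZ (Cmod q) n) by (rewrite h; now apply Cmod_Cpowz).
  rewrite Cmod_opp, Cmod_1 in e.
  destruct (Z_lt_le_dec n 0) as [hn|hn].
  - assert (a := powerRZ_antitone (Cmod q) n (-1) Hq ltac:(lia)).
    change (-1)%Z with (- (1))%Z in a. rewrite powerRZ_neg', powerRZ_1 in a.
    assert (1 < / Cmod q)%R by (rewrite <- Rinv_1; apply Rinv_lt_contravar; lra). lra.
  - destruct (Z.eq_dec n 0) as [->|hn'].
    + rewrite Cpowz_0 in h. apply (f_equal fst) in h. simpl in h. lra.
    + assert (a := powerRZ_antitone (Cmod q) 1 n Hq ltac:(lia)). rewrite powerRZ_1 in a. lra.
Qed.

(** The normalised Appell-Lerch sum by which Kronecker's series [kron q y t] is multiplied in the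
    single sum with prefactor in [t] and [y] and denominators [1 + q^(2 k) z]. *)
Definition lerch (y z t : C) : C := appell Q (t * (q * y)) (- z) / (J * thp Q (t * (q * y))).

(** The quotient of the product term by Kronecker's series in [x]. *)
(** The factor of [theta_quot] that does not depend on its last argument. *)
Definition quot_const (y z : C) : C :=
  2 * (J / (Jq * Jq)) * (thp Q (y * z) / (thp q z * thp Q (- y) * thp Q (- z))).

Definition theta_quot (y z t : C) : C :=
  quot_const y z * (J * J * thp Q (t * z) / (thp Q (- t) * thp Q (t * (q * y)))).

(** The contribution of the poles of [kron q y x] to the partial fractions of [kron q y x * f x]. *)
Definition residue_series (y : C) (f : C -> C) (x : C) : C :=
  Sum (fun m => Cpowz y m * f (Cpowz q (- m)) / (1 - x * Cpowz q m)).

Definition residue_summable (y : C) (f : C -> C) (x : C) : Prop :=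
  summable (fun m => Cpowz y m * f (Cpowz q (- m)) / (1 - x * Cpowz q m)).

Section Fixed.
Variables y z : C.
Hypothesis Hy : (Cmod q < Cmod y < 1)%R.
Hypothesis Hz : (Cmod q < Cmod z < 1)%R.

Let Hy0 : y <> 0.
Proof. apply Cmod_gt_0. lra. Qed.
Let Hz0 : z <> 0.
Proof. apply Cmod_gt_0. lra. Qed.
Let Hqy0 : q * y <> 0.
Proof. now apply Cmult_neq_0. Qed.
Let Hqy : nopole q (q * y).
Proof.
  replace (q * y) with (y * Cpowz q 1) by (rewrite Cpowz_1; ring).
  apply nopole_shift; [exact Hq0|]. now apply nopole_annulus.
Qed.
Let Hoz0 : - z <> 0.
Proof. now apply Copp_neq_0. Qed.
Let Hoy0 : - y <> 0.
Proof. now apply Copp_neq_0. Qed.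
Let tz := thp_neq_0 q Hq z Hz0 (nopole_annulus q z Hq Hz).
Let ty := thp_neq_0 q Hq y Hy0 (nopole_annulus q y Hq Hy).
Let toz := thp_neq_0 Q HQ (- z) Hoz0 (nopole_opp_annulus z Hz).
Let toy := thp_neq_0 Q HQ (- y) Hoy0 (nopole_opp_annulus y Hy).

Let sub_Q : Cpowz q 2 = Q.
Proof. easy. Qed.

(** Kronecker's series vanishes at [1 / (q y)], so that the product with an Appell-Lerch sum having
    its poles there keeps only the poles of the former. *)
Lemma kron_appell_y (a x : C) : a <> 0 -> x <> 0 -> nopole q x -> nopole Q (x * (q * y)) ->
  residue_summable y (fun t => appell Q a (t * (q * y))) x /\
  kron q y x * appell Q a (x * (q * y)) = residue_series y (fun t => appell Q a (t * (q * y))) x.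
Proof.
  intros Ha Hx HX HXY.
  destruct (kron_mult_pfrac q Hq y (q * y) x 2 (fun n => thc Q n * Cpowz a n)
    eq_refl Hy Hqy0 Hx Hqy HX) as [s e].
  - rewrite sub_Q. exact HXY.
  - now apply summable_thc.
  - cbv beta zeta in s, e. rewrite sub_Q in s, e. split; [exact s|].
    etransitivity; [exact e|].
    rewrite (kron_eq q Hq (/ (q * y)) y Hy) by (auto using Cinv_neq_0, nopole_inv).
    replace (/ (q * y) * y) with (/ q) by (field; auto).
    rewrite thp_inv by assumption.
    replace (thp q q) with (thp q (q * 1)) by (f_equal; ring).
    rewrite thp_shift, thp_1 by (exact Hq || apply C1_nz).
    unfold residue_series, appell. unfold Cdiv. ring.
Qed.

(** The analogous product with an Appell-Lerch sum having its poles at the points [- Q^n], which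
    survive. *)
Lemma kron_appell_m1 (a x : C) : a <> 0 -> x <> 0 -> nopole q x -> nopole Q (- x) ->
  residue_summable y (fun t => appell Q a (- t)) x /\
  kron q y x * appell Q a (- x) = residue_series y (fun t => appell Q a (- t)) x
    + kron q y (- (1)) * appell Q (a * (y * y)) (- x).
Proof.
  intros Ha Hx HX HXm.
  assert (hm : - (1) <> 0) by (apply Copp_neq_0, C1_nz).
  destruct (kron_mult_pfrac q Hq y (- (1)) x 2 (fun n => thc Q n * Cpowz a n)
    eq_refl Hy hm Hx nopole_m1 HX) as [s e].
  - rewrite sub_Q. replace (x * - (1)) with (- x) by ring. exact HXm.
  - now apply summable_thc.
  - cbv beta zeta in s, e. rewrite sub_Q in s, e.
    assert (eG : forall t, Sum (fun n => thc Q n * Cpowz a n / (1 - t * - (1) * Cpowz Q n)) = appell Q a (- t)).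
    { intros t. unfold appell. apply Sum_ext. intros n. now replace (t * - (1)) with (- t) by ring. }
    assert (e0 : forall m, Cpowz y m * Sum (fun n => thc Q n * Cpowz a n / (1 - Cpowz q (- m) * - (1) * Cpowz Q n))
        / (1 - x * Cpowz q m) = Cpowz y m * appell Q a (- Cpowz q (- m)) / (1 - x * Cpowz q m)).
    { intros m. now rewrite eG. }
    split.
    + eapply summable_ext; [exact e0 | exact s].
    + rewrite <- (eG x). etransitivity; [exact e|]. f_equal.
      * apply Sum_ext, e0.
      * f_equal; [f_equal; field; exact C1_nz|].
        unfold appell. apply Sum_ext. intros n. replace (x * - (1)) with (- x) by ring.
        rewrite (Cpowz_mult_l a) by auto using Cmult_neq_0.
        replace (Cpowz y 2) with (y * y) by (simpl; ring). unfold Cdiv. ring.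
Qed.

Let hpow (m : Z) : Cpowz q m <> 0.
Proof. now apply Cpowz_neq_0. Qed.

Let HqyQ (m : Z) : nopole Q (Cpowz q m * (q * y)).
Proof.
  apply nopole_sq; [exact Hq0|]. rewrite Cmult_comm. now apply nopole_shift.
Qed.

Let HmQ (m : Z) : nopole Q (- Cpowz q m).
Proof.
  apply nopole_sq; [exact Hq0|]. replace (- Cpowz q m) with (- (1) * Cpowz q m) by ring.
  apply nopole_shift; [exact Hq0 | apply nopole_m1].
Qed.

(** The coefficient of the partial fraction series of [lerch]. *)
Definition lerch_coef : C := - z / (J * thp Q (- z)).

Lemma lerch_pfrac (t : C) : t <> 0 -> nopole Q (t * (q * y)) ->
  lerch y z t = 1 + lerch_coef * appell Q (Q * - z) (t * (q * y)).
Proof.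
  intros Ht H. unfold lerch, lerch_coef.
  assert (h := appell_sym Q HQ (t * (q * y)) (- z) (Cmult_neq_0 _ _ Ht Hqy0) Hoz0 H (nopole_opp_annulus z Hz)).
  assert (n1 := thp_neq_0 Q HQ _ (Cmult_neq_0 _ _ Ht Hqy0) H). fold J in h.
  replace (appell Q (t * (q * y)) (- z) / (J * thp Q (t * (q * y)))) with
    (/ J * (appell Q (t * (q * y)) (- z) / thp Q (t * (q * y)))) by (field; auto).
  rewrite h. field. auto.
Qed.

Lemma residue_series_ext f g x : (forall m, f (Cpowz q m) = g (Cpowz q m)) ->
  residue_series y f x = residue_series y g x.
Proof. intros H. apply Sum_ext. intros m. now rewrite H. Qed.

Lemma residue_summable_ext f g x : (forall m, f (Cpowz q m) = g (Cpowz q m)) ->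
  residue_summable y f x -> residue_summable y g x.
Proof. intros H. apply summable_ext. intros m. now rewrite H. Qed.

Lemma residue_plus f g x : residue_summable y f x -> residue_summable y g x ->
  residue_summable y (fun t => f t + g t) x /\
  residue_series y (fun t => f t + g t) x = residue_series y f x + residue_series y g x.
Proof.
  intros sf sg.
  assert (e : forall m, Cpowz y m * f (Cpowz q (- m)) / (1 - x * Cpowz q m)
     + Cpowz y m * g (Cpowz q (- m)) / (1 - x * Cpowz q m)
     = Cpowz y m * (f (Cpowz q (- m)) + g (Cpowz q (- m))) / (1 - x * Cpowz q m)).
  { intros m. unfold Cdiv. ring. }
  split.
  - eapply summable_ext; [exact e | now apply summable_plus].
  - unfold residue_series. rewrite <- Sum_plus by assumption. apply Sum_ext. intros m. now rewrite e.
Qed.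

Lemma residue_scal c f x : residue_summable y f x ->
  residue_summable y (fun t => c * f t) x /\
  residue_series y (fun t => c * f t) x = c * residue_series y f x.
Proof.
  intros sf.
  assert (e : forall m, c * (Cpowz y m * f (Cpowz q (- m)) / (1 - x * Cpowz q m))
     = Cpowz y m * (c * f (Cpowz q (- m))) / (1 - x * Cpowz q m)).
  { intros m. unfold Cdiv. ring. }
  split.
  - eapply summable_ext; [exact e | now apply summable_scal].
  - unfold residue_series. rewrite <- Sum_scal by assumption. apply Sum_ext. intros m. now rewrite e.
Qed.

Lemma residue_one (x : C) : x <> 0 -> nopole q x ->
  residue_summable y (fun _ => 1) x /\ residue_series y (fun _ => 1) x = kron q y x.
Proof.
  intros Hx HX.
  assert (e : forall m, Cpowz y m / (1 - x * Cpowz q m) = Cpowz y m * 1 / (1 - x * Cpowz q m)).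
  { intros m. now rewrite Cmult_1_r. }
  split.
  - eapply summable_ext; [exact e | now apply summable_kron].
  - unfold residue_series, kron. apply Sum_ext. intros m. now rewrite e.
Qed.

Lemma kron_lerch (x : C) : x <> 0 -> nopole q x -> nopole Q (x * (q * y)) ->
  residue_summable y (lerch y z) x /\ kron q y x * lerch y z x = residue_series y (lerch y z) x.
Proof.
  intros Hx HX HXY.
  assert (Ha : Q * - z <> 0) by auto using Cmult_neq_0.
  destruct (kron_appell_y (Q * - z) x Ha Hx HX HXY) as [s1 e1].
  destruct (residue_scal lerch_coef _ x s1) as [s2 e2].
  destruct (residue_one x Hx HX) as [s3 e3].
  destruct (residue_plus _ _ x s3 s2) as [s4 e4].
  assert (hE : forall m, 1 + lerch_coef * appell Q (Q * - z) (Cpowz q m * (q * y)) = lerch y z (Cpowz q m)).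
  { intros m. symmetry. apply lerch_pfrac; [apply hpow | apply HqyQ]. }
  split.
  - exact (residue_summable_ext (fun t => 1 + lerch_coef * appell Q (Q * - z) (t * (q * y))) (lerch y z) x hE s4).
  - rewrite lerch_pfrac by assumption.
    rewrite <- (residue_series_ext (fun t => 1 + lerch_coef * appell Q (Q * - z) (t * (q * y))) (lerch y z) x hE), e4, e3, e2, <- e1. ring.
Qed.

Lemma theta_quot_pfrac (t : C) : t <> 0 -> nopole Q (t * (q * y)) -> nopole Q (- t) ->
  theta_quot y z t
  = quot_const y z * (thp Q (- z) / thp Q (- (q * y))) * appell Q (q * z / y) (- t)
    + quot_const y z * (thp Q (z / (q * y)) / thp Q (- / (q * y))) * appell Q (Q * - z) (t * (q * y)).
Proof.
  intros Ht H1 H2. unfold theta_quot.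
  assert (Hal : (Cmod Q < Cmod (- z) < 1)%R) by (rewrite Cmod_opp; now apply HQr).
  assert (hla : - (q * y) <> 0) by now apply Copp_neq_0.
  assert (HL : nopole Q (- (q * y))).
  { apply nopole_annulus; [exact HQ|]. rewrite Cmod_opp. now apply HQr2. }
  assert (ew : - t * - (q * y) = t * (q * y)) by ring.
  assert (e := thp_quotient_appell Q HQ (- z) (- (q * y)) (- t) Hal hla (Copp_neq_0 t Ht) HL H2).
  rewrite ew in e. specialize (e H1). fold J in e.
  replace (- z * - t) with (t * z) in e by ring. rewrite e.
  replace (- z * Q / - (q * y)) with (q * z / y) by (unfold Q; field; repeat split; auto).
  replace (- z / - (q * y)) with (z / (q * y)) by (field; auto).
  replace (/ - (q * y)) with (- / (q * y)) by (field; auto).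
  replace (- z * Q) with (Q * - z) by ring. ring.
Qed.

(** Partial fractions of the product term: besides the poles at powers of [q], it has the poles of
    the first single sum, and there the residues agree. *)
Lemma kron_theta_quot (x : C) : x <> 0 -> nopole q x -> nopole Q (x * (q * y)) -> nopole Q (- x) ->
  residue_summable y (theta_quot y z) x /\
  kron q y x * theta_quot y z x = residue_series y (theta_quot y z) x
    + thp Q (y * z) / (thp q y * thp q z) * (Jq ^ 2 / J) * appell Q (q * (y * z)) (- x).
Proof.
  intros Hx HX HXY HXm.
  assert (Ha : Q * - z <> 0) by auto using Cmult_neq_0.
  assert (Hb : q * z / y <> 0) by auto using Cmult_neq_0, Cdiv_neq_0.
  destruct (kron_appell_y (Q * - z) x Ha Hx HX HXY) as [s1 e1].
  destruct (kron_appell_m1 (q * z / y) x Hb Hx HX HXm) as [s2 e2].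
  set (c1 := quot_const y z * (thp Q (- z) / thp Q (- (q * y)))).
  set (c2 := quot_const y z * (thp Q (z / (q * y)) / thp Q (- / (q * y)))).
  destruct (residue_scal c1 _ x s2) as [s3 e3].
  destruct (residue_scal c2 _ x s1) as [s4 e4].
  destruct (residue_plus _ _ x s3 s4) as [s5 e5].
  assert (hE : forall m, c1 * appell Q (q * z / y) (- Cpowz q m)
    + c2 * appell Q (Q * - z) (Cpowz q m * (q * y)) = theta_quot y z (Cpowz q m)).
  { intros m. symmetry. apply theta_quot_pfrac; [apply hpow | apply HqyQ | apply HmQ]. }
  split.
  - exact (residue_summable_ext
      (fun t => c1 * appell Q (q * z / y) (- t) + c2 * appell Q (Q * - z) (t * (q * y)))
      (theta_quot y z) x hE s5).
  - rewrite theta_quot_pfrac by assumption. fold c1 c2.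
    rewrite <- (residue_series_ext
      (fun t => c1 * appell Q (q * z / y) (- t) + c2 * appell Q (Q * - z) (t * (q * y)))
      (theta_quot y z) x hE), e5, e3, e4, <- e1.
    replace (kron q y x * (c1 * appell Q (q * z / y) (- x) + c2 * appell Q (Q * - z) (x * (q * y)))) with
      (c1 * (kron q y x * appell Q (q * z / y) (- x)) + c2 * (kron q y x * appell Q (Q * - z) (x * (q * y)))) by ring.
    rewrite e2.
    replace (q * z / y * (y * y)) with (q * (y * z)) by (field; exact Hy0).
    assert (hc : c1 * kron q y (- (1)) = thp Q (y * z) / (thp q y * thp q z) * (Jq ^ 2 / J)).
    { assert (hm : - (1) <> 0) by (apply Copp_neq_0, C1_nz).
      rewrite (kron_eq q Hq (- (1)) y Hy hm nopole_m1). fold Jq.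
      replace (- (1) * y) with (- y) by ring. rewrite (thp_split q (- y) Hq Hoy0). fold Q.
      replace (q * - y) with (- (q * y)) by ring.
      assert (hm1 := thp_m1 q Hq). fold Q Jq J in hm1.
      assert (hn := thp_neq_0 q Hq (- (1)) hm nopole_m1).
      assert (HL : nopole Q (- (q * y))).
      { apply nopole_annulus; [exact HQ|]. rewrite Cmod_opp. now apply HQr2. }
      assert (hl := thp_neq_0 Q HQ (- (q * y)) (Copp_neq_0 _ Hqy0) HL).
      unfold c1, quot_const.
      transitivity (thp Q (y * z) / (thp q y * thp q z) * (2 * (J * J)) / (thp q (- (1)) * J)).
      - field. repeat split; auto.
      - rewrite <- hm1. field. repeat split; auto. }
    rewrite <- hc. ring.
Qed.

(** ** The residues satisfy the recurrence of the double sum *)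

Lemma thp_Q_down (a : C) : a <> 0 -> thp Q (a / Q) = - (a / Q * thp Q a).
Proof.
  intros Ha. assert (h := thp_shift Q (a / Q) HQ (Cdiv_neq_0 _ _ Ha HQ0)).
  replace (Q * (a / Q)) with a in h by (field; exact HQ0). rewrite h. field. auto.
Qed.

Lemma lerch_down (t : C) : t <> 0 -> nopole Q (t * (q * y)) ->
  lerch y z (t / Q) = 1 + q * z / (t * y) * lerch y z t.
Proof.
  intros Ht H. unfold lerch.
  set (a := t * (q * y)) in *. assert (Ha : a <> 0) by (unfold a; auto using Cmult_neq_0).
  replace (t / Q * (q * y)) with (a / Q) by (unfold a, Cdiv; ring).
  assert (Ha' : a / Q <> 0) by auto using Cdiv_neq_0.
  assert (e := appell_shift_a Q HQ (a / Q) (- z) Ha' Hoz0 (nopole_opp_annulus z Hz)).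
  replace (Q * (a / Q)) with a in e by (field; exact HQ0).
  rewrite theta_eq in e by assumption. fold J in e.
  assert (e2 : appell Q (a / Q) (- z) = - z * appell Q a (- z) + J * thp Q (a / Q)).
  { rewrite e. field. exact Hz0. }
  assert (n1 := thp_neq_0 Q HQ a Ha H).
  rewrite e2, thp_Q_down by exact Ha.
  set (T := thp Q a) in *. set (A := appell Q a (- z)). unfold a, Q. field.
  repeat split; auto.
Qed.

Lemma theta_quot_down (t : C) : t <> 0 -> nopole Q (t * (q * y)) -> nopole Q (- t) ->
  theta_quot y z (t / Q) = q * z / (t * y) * theta_quot y z t.
Proof.
  intros Ht H1 H2. unfold theta_quot.
  replace (t / Q * (q * y)) with (t * (q * y) / Q) by (unfold Cdiv; ring).
  replace (t / Q * z) with (t * z / Q) by (unfold Cdiv; ring).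
  replace (- (t / Q)) with (- t / Q) by (unfold Cdiv; ring).
  assert (Ht' := Copp_neq_0 t Ht).
  assert (h1 : t * (q * y) <> 0) by auto using Cmult_neq_0.
  rewrite !thp_Q_down by auto using Cmult_neq_0.
  assert (n1 := thp_neq_0 Q HQ _ h1 H1). assert (n2 := thp_neq_0 Q HQ _ Ht' H2).
  set (A := thp Q (t * (q * y))) in *. set (B := thp Q (- t)) in *.
  unfold Q. field. repeat split; auto.
Qed.

End Fixed.
End Main.

(** * Residues of the right-hand side *)

Lemma appell_flip_shift (p a w : C) : (0 < Cmod p < 1)%R -> a <> 0 -> w <> 0 -> nopole p w ->
  appell p (p / a) (/ w) = - (w * appell p (p * a) w).
Proof.
  intros Hp Ha Hw H. rewrite appell_shift_a by assumption.
  assert (e := appell_flip p Hp a w Ha Hw H). rewrite <- e. field. exact Hw.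
Qed.

Section Identity.
Variables q y z : C.
Hypothesis Hq : (0 < Cmod q < 1)%R.
Hypothesis Hy : (Cmod q < Cmod y < 1)%R.
Hypothesis Hz : (Cmod q < Cmod z < 1)%R.

Let Hq0 : q <> 0.
Proof. apply Cmod_gt_0. lra. Qed.
Let Hy0 : y <> 0.
Proof. apply Cmod_gt_0. lra. Qed.
Let Hz0 : z <> 0.
Proof. apply Cmod_gt_0. lra. Qed.
Let Q := q ^ 2.
Let HQ : (0 < Cmod Q < 1)%R.
Proof. now apply Cmod_sq_range. Qed.
Let HQ0 : Q <> 0.
Proof. apply Cmod_gt_0. lra. Qed.
Let J := qpoch Q Q.
Let Jq := qpoch q q.
Let HJ : J <> 0.
Proof. now apply qpoch_self_neq_0. Qed.
Let HJq : Jq <> 0.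
Proof. now apply qpoch_self_neq_0. Qed.

Let range_self (b : C) : (Cmod q < Cmod b < 1)%R -> (Cmod Q < Cmod b < 1)%R.
Proof. intros Hb. unfold Q. rewrite Cmod_pow. simpl. nra. Qed.
Let range_q (b : C) : (Cmod q < Cmod b < 1)%R -> (Cmod Q < Cmod (q * b) < 1)%R.
Proof. intros Hb. unfold Q. rewrite Cmod_pow, Cmod_mult. simpl. nra. Qed.
Let range_yz : (Cmod Q < Cmod (y * z) < 1)%R.
Proof. unfold Q. rewrite Cmod_pow, Cmod_mult. simpl. nra. Qed.

Let Nyz := nopole_annulus Q (y * z) HQ range_yz.
Let Noy := nopole_opp_annulus q Hq y Hy.
Let Noz := nopole_opp_annulus q Hq z Hz.
Let Hoy0 := Copp_neq_0 y Hy0.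
Let Hoz0 := Copp_neq_0 z Hz0.
Let Hyz0 := Cmult_neq_0 y z Hy0 Hz0.
Let Hqy0 := Cmult_neq_0 q y Hq0 Hy0.
Let Hqz0 := Cmult_neq_0 q z Hq0 Hz0.
Let t_yz := thp_neq_0 Q HQ (y * z) Hyz0 Nyz.
Let t_oy := thp_neq_0 Q HQ (- y) Hoy0 Noy.
Let t_oz := thp_neq_0 Q HQ (- z) Hoz0 Noz.
Let t_qy := thp_neq_0 Q HQ (q * y) Hqy0 (nopole_annulus Q (q * y) HQ (range_q y Hy)).
Let t_qz := thp_neq_0 Q HQ (q * z) Hqz0 (nopole_annulus Q (q * z) HQ (range_q z Hz)).
Let t_y := thp_neq_0 Q HQ y Hy0 (nopole_annulus Q y HQ (range_self y Hy)).
Let t_z := thp_neq_0 Q HQ z Hz0 (nopole_annulus Q z HQ (range_self z Hz)).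

Let m1_neq_0 : - (1) <> 0.
Proof. apply Copp_neq_0, C1_nz. Qed.

Let theta_m1 : thp Q (- (1)) * thp Q (- q) * (Jq * Jq) = 2 * (J * J).
Proof.
  assert (h := thp_m1 q Hq). rewrite thp_split in h by assumption.
  replace (q * - (1)) with (- q) in h by ring. exact h.
Qed.

Let t_m1 : thp Q (- (1)) <> 0.
Proof. apply thp_neq_0; [exact HQ | exact m1_neq_0 |]. now apply nopole_sq, nopole_m1. Qed.

Let t_mq : thp Q (- q) <> 0.
Proof.
  apply thp_neq_0; [exact HQ | now apply Copp_neq_0 |].
  replace (- q) with (q * - (1)) by ring. now apply nopole_sq_q, nopole_m1.
Qed.

(** The coefficient of [1 / (1 - x q^m)] in the right-hand side. *)
Definition rhs_residue (m : Z) : C :=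
  Cpowz y m * lerch q y z (Cpowz q (- m)) + Cpowz z m * lerch q z y (Cpowz q (- m))
  - Cpowz y m * theta_quot q y z (Cpowz q (- m)).

(** The cases [0] and [-1] are the expansion of a theta quotient with [la = y z] and [w = - 1 / y], for
    [al = q y] and [al = y]. *)
Lemma rhs_residue_0 : rhs_residue 0 = 1.
Proof.
  unfold rhs_residue. simpl Z.opp. rewrite !Cpowz_0.
  unfold lerch, theta_quot, quot_const. fold Q J Jq.
  replace (1 * (q * y)) with (q * y) by ring. replace (1 * (q * z)) with (q * z) by ring.
  replace (1 * z) with z by ring. rewrite (thp_split q z Hq Hz0). fold Q.
  assert (hw : - / y <> 0) by (apply Copp_neq_0, Cinv_neq_0, Hy0).
  assert (ew : - / y = / - y) by (field; auto).
  assert (Hw : nopole Q (- / y)) by (rewrite ew; now apply nopole_inv).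
  assert (ez : - / y * (y * z) = - z) by (field; auto).
  assert (e := thp_quotient_appell Q HQ (q * y) (y * z) (- / y) (range_q y Hy) Hyz0 hw Nyz Hw).
  rewrite ez in e. specialize (e Noz). fold J in e.
  replace (q * y * - / y) with (- q) in e by (field; exact Hy0).
  replace (q * y * Q / (y * z)) with (Q / (z / q)) in e by (field; auto).
  replace (q * y / (y * z)) with (q / z) in e by (field; auto).
  rewrite ew, appell_flip_shift in e by auto using Cdiv_neq_0.
  replace (Q * (z / q)) with (q * z) in e by (unfold Q; field; exact Hq0).
  replace (q * y * Q) with (Q * (q * y)) in e by ring.
  rewrite (appell_shift_a Q HQ (q * y) (- z)) in e by assumption.
  rewrite (theta_eq Q HQ (q * y) Hqy0) in e. fold J in e.
  rewrite !thp_inv in e by assumption.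
  replace (thp Q (q / z)) with (thp Q (q * z)) in e.
  2: { rewrite <- (thp_refl Q (q / z)) by auto using Cdiv_neq_0. f_equal. unfold Q. field. auto. }
  set (A := thp Q (q * y)) in *. set (B := thp Q (q * z)) in *.
  set (S1 := appell Q (q * y) (- z)) in *. set (S2 := appell Q (q * z) (- y)) in *.
  assert (h : B * S1 + A * S2 = J * A * B + thp Q (y * z) * J * J * thp Q (- q) / (thp Q (- y) * thp Q (- z))).
  { transitivity (J * A * B + thp Q (y * z) / y *
      (thp Q (q * y) / thp Q (y * z) * - (- y * S2) + B / - (thp Q (y * z) / (y * z)) * ((S1 - J * A) / - z))).
    - fold A. field. repeat split; auto.
    - fold A. rewrite <- e. field. repeat split; auto. }
  transitivity ((B * S1 + A * S2) / (J * A * B)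
    - 2 * (J * J) * J * thp Q (y * z) / (Jq * Jq * B * thp Q (- y) * thp Q (- z) * thp Q (- (1)) * A)).
  - field. repeat split; auto.
  - rewrite h, <- theta_m1. field. repeat split; auto.
Qed.

Lemma rhs_residue_m1 : rhs_residue (-1) = 0.
Proof.
  unfold rhs_residue. change (- (-1))%Z with 1%Z. change (-1)%Z with (- (1))%Z.
  rewrite !Cpowz_opp, !Cpowz_1 by assumption.
  unfold lerch, theta_quot, quot_const. fold Q J Jq.
  replace (q * (q * y)) with (Q * y) by (unfold Q; ring).
  replace (q * (q * z)) with (Q * z) by (unfold Q; ring).
  rewrite (thp_split q z Hq Hz0). fold Q.
  rewrite !(thp_shift Q) by assumption.
  assert (hw : - / y <> 0) by (apply Copp_neq_0, Cinv_neq_0, Hy0).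
  assert (ew : - / y = / - y) by (field; auto).
  assert (Hw : nopole Q (- / y)) by (rewrite ew; now apply nopole_inv).
  assert (ez : - / y * (y * z) = - z) by (field; auto).
  assert (e := thp_quotient_appell Q HQ y (y * z) (- / y) (range_self y Hy) Hyz0 hw Nyz Hw).
  rewrite ez in e. specialize (e Noz). fold J in e.
  replace (y * - / y) with (- (1)) in e by (field; exact Hy0).
  replace (y * Q / (y * z)) with (Q / z) in e by (field; auto).
  replace (y / (y * z)) with (/ z) in e by (field; auto).
  rewrite ew, appell_flip_shift in e by assumption.
  replace (y * Q) with (Q * y) in e by ring.
  rewrite !thp_inv in e by assumption.
  set (S1 := appell Q (Q * y) (- z)) in *. set (S2 := appell Q (Q * z) (- y)) in *.
  assert (h : thp Q z * S1 + thp Q y * S2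
    = thp Q (y * z) * J * J * thp Q (- (1)) / (thp Q (- y) * thp Q (- z))).
  { transitivity (thp Q (y * z) / y *
      (thp Q y / thp Q (y * z) * - (- y * S2) + - (thp Q z / z) / - (thp Q (y * z) / (y * z)) * S1)).
    - field. repeat split; auto.
    - rewrite <- e. field. repeat split; auto. }
  transitivity (- (thp Q z * S1 + thp Q y * S2) / (J * thp Q y * thp Q z)
    + 2 * (J * J) * J * thp Q (y * z) / (Jq * Jq * thp Q z * thp Q (- y) * thp Q (- z) * thp Q (- q) * thp Q y)).
  - field. repeat split; auto.
  - rewrite h, <- theta_m1. field. repeat split; auto.
Qed.

Lemma rhs_residue_rec m :
  rhs_residue (m + 2) = Cpowz q (m + 1) * y * z * rhs_residue m + Cpowz y (m + 2) + Cpowz z (m + 2).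
Proof.
  unfold rhs_residue. set (t := Cpowz q (- m)).
  assert (ht : t <> 0) by (now apply Cpowz_neq_0).
  assert (N : forall b, (Cmod q < Cmod b < 1)%R -> nopole (q ^ 2) (t * (q * b))).
  { intros b Hb. apply nopole_sq; [exact Hq0|].
    replace (t * (q * b)) with (b * Cpowz q (- m + 1)) by (unfold t; rewrite Cpowz_succ by exact Hq0; ring).
    apply nopole_shift; [exact Hq0 | now apply nopole_annulus]. }
  assert (N1 : nopole (q ^ 2) (- t)).
  { apply nopole_sq; [exact Hq0|]. replace (- t) with (- (1) * Cpowz q (- m)) by (unfold t; ring).
    apply nopole_shift; [exact Hq0 | now apply nopole_m1]. }
  replace (Cpowz q (- (m + 2))) with (t / q ^ 2).
  2: { unfold t. replace (- (m + 2))%Z with (- m - 2)%Z by ring. now rewrite Cpowz_sub. }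
  rewrite (lerch_down q Hq y z Hy Hz t ht (N y Hy)), (lerch_down q Hq z y Hz Hy t ht (N z Hz)),
    (theta_quot_down q Hq y z Hy Hz t ht (N y Hy) N1).
  rewrite (Cpowz_succ q) by exact Hq0.
  replace (Cpowz q m) with (/ t).
  2: { unfold t. rewrite Cpowz_opp by exact Hq0. field. now apply Cpowz_neq_0. }
  rewrite !(Cpowz_add _ m 2) by assumption. rewrite !Cpowz_2. field. auto.
Qed.

(** The identity away from the poles and from the points where [x y] or [x z] is an odd power of [q]. *)
Lemma lhs_eq_rhs_generic (x : C) : x <> 0 -> nopole q x -> nopole Q (- x) ->
  nopole Q (x * (q * y)) -> nopole Q (x * (q * z)) -> lhs q x y z = rhs q x y z.
Proof.
  intros Hx HX HXm HXY HXZ.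
  assert (tx := thp_neq_0 q Hq x Hx HX).
  assert (ty := thp_neq_0 q Hq y Hy0 (nopole_annulus q y Hq Hy)).
  assert (tz := thp_neq_0 q Hq z Hz0 (nopole_annulus q z Hq Hz)).
  assert (txm := thp_neq_0 Q HQ (- x) (Copp_neq_0 x Hx) HXm).
  assert (P : forall b c : C, (Cmod q < Cmod b < 1)%R -> c <> 0 -> nopole Q (x * (q * b)) ->
     single_part q x b c = kron q b x * lerch q b c x).
  { intros b c Hb Hc Nb. assert (Hb0 : b <> 0) by (apply Cmod_gt_0; lra).
    assert (tb := thp_neq_0 q Hq b Hb0 (nopole_annulus q b Hq Hb)).
    rewrite single_part_eq, kron_eq by assumption. unfold lerch. fold Q J Jq.
    rewrite (thp_split q (x * b)) by auto using Cmult_neq_0. fold Q.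
    replace (q * (x * b)) with (x * (q * b)) by ring.
    assert (h := thp_neq_0 Q HQ (x * (q * b)) ltac:(auto using Cmult_neq_0) Nb).
    field. repeat split; auto. }
  assert (PP : product_part q x y z = kron q y x * theta_quot q y z x).
  { rewrite product_part_eq, kron_eq by assumption. unfold theta_quot, quot_const. fold Q J Jq.
    rewrite (thp_split q (x * y)) by auto using Cmult_neq_0. fold Q.
    replace (q * (x * y)) with (x * (q * y)) by ring.
    assert (h := thp_neq_0 Q HQ (x * (q * y)) ltac:(auto using Cmult_neq_0) HXY).
    field. repeat split; auto. }
  unfold rhs. rewrite (P y z Hy Hz0 HXY), (P z y Hz Hy0 HXZ), PP, single_part_eq by assumption.
  fold Q J Jq.
  destruct (kron_lerch q Hq y z Hy Hz x Hx HX HXY) as [s1 e1].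
  destruct (kron_lerch q Hq z y Hz Hy x Hx HX HXZ) as [s2 e2].
  destruct (kron_theta_quot q Hq y z Hy Hz x Hx HX HXY HXm) as [s3 e3].
  rewrite e1, e2, e3. fold Q J Jq.
  rewrite (proj2 (lhs_diag q y z Hq Hy Hz x Hx HX)).
  rewrite (Sum_ext _ (fun m => Cpowz y m * lerch q y z (Cpowz q (- m)) / (1 - x * Cpowz q m)
    + (Cpowz z m * lerch q z y (Cpowz q (- m)) / (1 - x * Cpowz q m)
    + - (1) * (Cpowz y m * theta_quot q y z (Cpowz q (- m)) / (1 - x * Cpowz q m))))).
  - assert (s4 := summable_scal (- (1)) _ s3).
    rewrite Sum_plus, Sum_plus, Sum_scal by (try apply summable_plus; assumption).
    unfold residue_series. ring.
  - intros m. rewrite (diag_sum_unique q y z Hq Hy Hz rhs_residue rhs_residue_0 rhs_residue_m1 rhs_residue_rec).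
    unfold rhs_residue. assert (h := HX m). field. exact h.
Qed.

End Identity.

(** * Continuity in [x] *)

(** The punctured neighbourhoods of [x]. *)
Definition punctured (x : C) (P : C -> Prop) : Prop :=
  exists d : R, (0 < d)%R /\ forall u, (0 < Cmod (u - x) < d)%R -> P u.

#[global] Instance punctured_filter (x : C) : ProperFilter (punctured x).
Proof.
  constructor.
  - intros P [d [Hd H]]. exists (x + RtoC (d / 2)). apply H.
    replace (x + RtoC (d / 2) - x) with (RtoC (d / 2)) by ring.
    rewrite Cmod_R, Rabs_pos_eq; lra.
  - constructor.
    + exists 1%R. split; [lra | easy].
    + intros P P' [d [Hd H]] [d' [Hd' H']]. exists (Rmin d d'). split; [now apply Rmin_pos|].
      assert (h1 := Rmin_l d d'). assert (h2 := Rmin_r d d').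
      intros u Hu. split; [apply H | apply H']; lra.
    + intros P P' Himp [d [Hd H]]. exists d. split; auto.
Qed.

Lemma Cminus_eq_0 (a b : C) : a - b = 0 -> a = b.
Proof. intros h. replace a with (a - b + b) by ring. rewrite h. ring. Qed.

Lemma punctured_locally' (x : C) (P : C -> Prop) : punctured x P -> locally' x P.
Proof.
  intros [d [Hd H]].
  assert (h : clim (locally x) (fun u => u) x).
  { apply clim_filterlim; [typeclasses eauto | apply filterlim_id]. }
  unfold locally', within. generalize (h d Hd). apply filter_imp. intros u Hu Hne. apply H.
  split; [|exact Hu]. apply Cmod_gt_0. intros h0. apply Hne, (Cminus_eq_0 u x), h0.
Qed.

Lemma clim_punctured_id (x : C) : clim (punctured x) (fun u => u) x.
Proof. intros eps He. exists eps. split; [exact He|]. intros u Hu. lra. Qed.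

(** A geometric progression avoids some punctured neighbourhood of every nonzero point. *)
Lemma nopole_punctured (p c x : C) : (0 < Cmod p < 1)%R -> c <> 0 -> x <> 0 ->
  punctured x (fun u => nopole p (u * c)).
Proof.
  intros Hp Hc Hx. assert (Hp0 : p <> 0) by (apply Cmod_gt_0; lra).
  assert (hc : (0 < Cmod c)%R) by (now apply Cmod_gt_0).
  assert (hx : (0 < Cmod x)%R) by (now apply Cmod_gt_0).
  assert (Hxc := Cmult_neq_0 x c Hx Hc).
  destruct (classic (nopole p (x * c))) as [H|H].
  - destruct (pole_bound_near p (x * c) Hp Hxc H) as [k [Hk Hb]].
    exists (k / Cmod c)%R. split; [now apply Rdiv_lt_0_compat|]. intros u [_ Hu] n.
    apply Cmod_gt_0. eapply Rlt_le_trans; [|apply Hb].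
    + assert (0 < powerRZ (Cmod p) n)%R by (apply powerRZ_lt; lra). nra.
    + replace (u * c - x * c) with ((u - x) * c) by ring. rewrite Cmod_mult.
      apply Rmult_lt_reg_r with (/ Cmod c)%R; [now apply Rinv_0_lt_compat|].
      rewrite Rmult_assoc, Rinv_r by lra. lra.
  - assert (H' : exists m, x * c = Cpowz p m).
    { apply NNPP. intros h. apply H, nopole_iff; [exact Hp0|]. intros m e. apply h. now exists m. }
    destruct H' as [m Hm].
    exists (Cmod x * (1 - Cmod p))%R. split; [apply Rmult_lt_0_compat; lra|].
    intros u [Hu1 Hu2]. apply nopole_iff; [exact Hp0|]. intros n Hn.
    assert (e : u = x * Cpowz p (n - m)).
    { rewrite Cpowz_sub, <- Hn, <- Hm by exact Hp0. field. auto. }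
    set (k := (n - m)%Z) in *.
    assert (hk : k <> 0%Z).
    { intros hk. rewrite hk, Cpowz_0, Cmult_1_r in e. subst u.
      replace (x - x) with (RtoC 0) in Hu1 by ring. rewrite Cmod_0 in Hu1. lra. }
    assert (h : (1 - Cmod p <= Cmod (Cpowz p k - 1))%R).
    { destruct (Z_lt_le_dec k 0) as [h|h].
      - assert (h1 := Cmod_triangle_inv (Cpowz p k) 1). rewrite Cmod_1, Cmod_Cpowz in h1 by exact Hp0.
        assert (h2 := powerRZ_antitone (Cmod p) k (-1) Hp ltac:(lia)).
        change (-1)%Z with (- (1))%Z in h2. rewrite powerRZ_neg', powerRZ_1 in h2.
        assert (h3 : (2 - Cmod p <= / Cmod p)%R).
        { apply Rmult_le_reg_r with (Cmod p); [lra|]. rewrite Rinv_l by lra. nra. }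
        lra.
      - assert (h1 := Cmod_triangle_inv 1 (Cpowz p k)). rewrite Cmod_1, Cmod_Cpowz in h1 by exact Hp0.
        assert (h2 := powerRZ_antitone (Cmod p) 1 k Hp ltac:(lia)). rewrite powerRZ_1 in h2.
        rewrite Cmod_minus_sym. lra. }
    rewrite e in Hu2. replace (x * Cpowz p k - x) with (x * (Cpowz p k - 1)) in Hu2 by ring.
    rewrite Cmod_mult in Hu2. nra.
Qed.

Lemma punctured_neq_0 (x : C) : x <> 0 -> punctured x (fun u => u <> 0).
Proof.
  intros Hx. exists (Cmod x). split; [now apply Cmod_gt_0|]. intros u [_ Hu] ->.
  replace (0 - x) with (- x) in Hu by ring. rewrite Cmod_opp in Hu. lra.
Qed.

Lemma powerRZ_between r s R' n : (0 < r <= s)%R -> (s <= R')%R ->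
  (powerRZ s n <= powerRZ r n + powerRZ R' n)%R.
Proof.
  intros Hr Hs. assert (h1 : (0 < powerRZ r n)%R) by (apply powerRZ_lt; lra).
  assert (h2 : (0 < powerRZ R' n)%R) by (apply powerRZ_lt; lra).
  destruct n as [|n|n]; simpl in *.
  - lra.
  - assert (h := pow_incr s R' (Pos.to_nat n) ltac:(lra)). lra.
  - assert (h := pow_incr r s (Pos.to_nat n) ltac:(lra)).
    assert (h3 : (0 < r ^ Pos.to_nat n)%R) by (apply pow_lt; lra).
    assert (h4 := Rinv_le_contravar _ _ h3 h). lra.
Qed.

Section Continuity.
Context {T : Type} (G : (T -> Prop) -> Prop) {FG : ProperFilter G}.

(** An upper bound, uniform in [t], for the terms of a theta series with varying argument. *)
Definition theta_bound (p a : C) (n : Z) : R :=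
  (Cmod (thc p n * Cpowz (a / 2) n) + Cmod (thc p n * Cpowz (2 * a) n))%R.

Lemma C2_neq_0 : (2 : C) <> 0.
Proof. intros h. apply (f_equal fst) in h. simpl in h. lra. Qed.

Lemma rsummable_theta_bound (p a : C) : (0 < Cmod p < 1)%R -> a <> 0 -> rsummable (theta_bound p a).
Proof.
  intros Hp Ha. assert (h2 := C2_neq_0).
  apply rsummable_plus; apply summable_thc; auto using Cmult_neq_0, Cdiv_neq_0.
Qed.

Lemma theta_bound_near (p : C) (f : T -> C) (a : C) : a <> 0 -> clim G f a ->
  G (fun t => forall n, (Cmod (thc p n * Cpowz (f t) n) <= theta_bound p a n)%R).
Proof.
  intros Ha Hf. assert (h2 := C2_neq_0). assert (ha : (0 < Cmod a)%R) by (now apply Cmod_gt_0).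
  generalize (Hf (Cmod a / 2)%R ltac:(lra)). apply filter_imp. intros t Ht n.
  assert (k1 := Cmod_triangle_inv a (f t)). rewrite Cmod_minus_sym in k1.
  assert (k2 := Cmod_triangle_inv (f t) a).
  assert (hf : f t <> 0) by (apply Cmod_gt_0; lra).
  unfold theta_bound. rewrite !Cmod_mult, !Cmod_Cpowz by auto using Cmult_neq_0, Cdiv_neq_0.
  rewrite <- Rmult_plus_distr_l. apply Rmult_le_compat_l; [apply Cmod_ge_0|].
  rewrite Cmod_div, Cmod_mult by exact h2.
  replace (Cmod 2) with 2%R by (rewrite Cmod_R, Rabs_pos_eq; lra).
  apply powerRZ_between; lra.
Qed.

Lemma clim_theta (p : C) (f : T -> C) (a : C) : (0 < Cmod p < 1)%R -> a <> 0 -> clim G f a ->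
  clim G (fun t => theta p (f t)) (theta p a).
Proof.
  intros Hp Ha Hf.
  refine (proj2 (Sum_dominated G (fun t n => thc p n * Cpowz (f t) n) _ (theta_bound p a) _ _ _)).
  - now apply rsummable_theta_bound.
  - now apply theta_bound_near.
  - intros n. apply clim_mult; [apply FG | apply clim_const, FG | apply clim_Cpowz; [apply FG | |]; assumption].
Qed.

Lemma clim_thp (p : C) (f : T -> C) (a : C) : (0 < Cmod p < 1)%R -> a <> 0 -> clim G f a ->
  clim G (fun t => thp p (f t)) (thp p a).
Proof.
  intros Hp Ha Hf. assert (hJ := qpoch_self_neq_0 p Hp).
  replace (thp p a) with (/ qpoch p p * theta p a) by (rewrite theta_eq by assumption; field; exact hJ).
  apply clim_ext_loc with (fun t => / qpoch p p * theta p (f t)); [apply FG | |].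
  - generalize (Hf (Cmod a) (proj1 (Cmod_gt_0 a) Ha)). apply filter_imp. intros t Ht.
    assert (hf : f t <> 0).
    { intros h. rewrite h in Ht. replace (0 - a) with (- a) in Ht by ring. rewrite Cmod_opp in Ht. lra. }
    rewrite theta_eq by assumption. field. exact hJ.
  - apply clim_mult; [apply FG | apply clim_const, FG | now apply clim_theta].
Qed.

Lemma clim_appell (p : C) (f g : T -> C) (a w : C) : (0 < Cmod p < 1)%R ->
  a <> 0 -> w <> 0 -> nopole p w -> clim G f a -> clim G g w ->
  clim G (fun t => appell p (f t) (g t)) (appell p a w).
Proof.
  intros Hp Ha Hw HW Hf Hg.
  destruct (pole_bound_near p w Hp Hw HW) as [c [Hc Hb]].
  refine (proj2 (Sum_dominated G (fun t n => thc p n * Cpowz (f t) n / (1 - g t * Cpowz p n)) _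
    (fun n => (/ c * theta_bound p a n)%R) _ _ _)).
  - apply rsummable_scal; [left; now apply Rinv_0_lt_compat | now apply rsummable_theta_bound].
  - generalize (filter_and _ _ (theta_bound_near p f a Ha Hf) (Hg c Hc)). apply filter_imp.
    intros t [h1 h2] n. specialize (h1 n). specialize (Hb (g t) h2 n).
    assert (hP : (0 < powerRZ (Cmod p) n)%R) by (apply powerRZ_lt; lra).
    assert (h3 : (c <= Cmod (1 - g t * Cpowz p n))%R) by nra.
    assert (h4 : 1 - g t * Cpowz p n <> 0) by (apply Cmod_gt_0; lra).
    unfold Cdiv. rewrite (Cmod_mult (thc p n * Cpowz (f t) n)), Cmod_inv, Rmult_comm by exact h4.
    apply Rmult_le_compat; [left; apply Rinv_0_lt_compat; lra | apply Cmod_ge_0 | | exact h1].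
    now apply Rinv_le_contravar.
  - intros n. apply clim_div; [apply FG | apply HW | |].
    + apply clim_mult; [apply FG | apply clim_const, FG | apply clim_Cpowz; [apply FG | |]; assumption].
    + apply clim_minus; [apply FG | apply clim_const, FG |].
      apply clim_mult; [apply FG | exact Hg | apply clim_const, FG].
Qed.

Lemma clim_lhs (q y z : C) (f : T -> C) (x : C) : (0 < Cmod q < 1)%R ->
  (Cmod q < Cmod y < 1)%R -> (Cmod q < Cmod z < 1)%R -> x <> 0 -> nopole q x ->
  clim G f x -> clim G (fun t => Sum (signed_term q (f t) y z)) (Sum (signed_term q x y z)).
Proof.
  intros Hq Hy Hz Hx HX Hf.
  destruct (pole_bound_near q x Hq Hx HX) as [c [Hc Hb]].
  assert (hc : (0 < / c)%R) by now apply Rinv_0_lt_compat.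
  refine (proj2 (Sum_dominated G (fun t => signed_term q (f t) y z) _
    (fun i => (4 * / c * (damped q y (fst i) * damped q z (snd i)))%R) _ _ _)).
  - apply rsummable_damped2; try assumption. lra.
  - generalize (Hf c Hc). apply filter_imp. intros t Ht.
    apply signed_term_bound; try assumption; [lra|]. intros n. specialize (Hb (f t) Ht n).
    assert (hP : (0 < powerRZ (Cmod q) n)%R) by (apply powerRZ_lt; lra).
    assert (hcP : (0 < c * (1 + powerRZ (Cmod q) n))%R) by (apply Rmult_lt_0_compat; lra).
    assert (h4 : 1 - f t * Cpowz q n <> 0) by (apply Cmod_gt_0; lra).
    rewrite Cmod_inv by exact h4. unfold Rdiv. rewrite <- Rinv_mult. now apply Rinv_le_contravar.
  - intros [s t]. unfold signed_term, double_term. cbn [fst snd].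
    apply clim_mult; [apply FG | apply clim_const, FG |].
    apply clim_div; [apply FG | apply HX | apply clim_const, FG |].
    apply clim_minus; [apply FG | apply clim_const, FG |].
    apply clim_mult; [apply FG | exact Hf | apply clim_const, FG].
Qed.

Lemma clim_rhs (q y z : C) (f : T -> C) (x : C) : (0 < Cmod q < 1)%R ->
  (Cmod q < Cmod y < 1)%R -> (Cmod q < Cmod z < 1)%R -> x <> 0 -> nopole q x -> nopole (q ^ 2) (- x) ->
  G (fun t => f t <> 0) -> clim G f x -> clim G (fun t => rhs q (f t) y z) (rhs q x y z).
Proof.
  intros Hq Hy Hz Hx HX HXm Hf0 Hf.
  assert (Hq0 : q <> 0) by (apply Cmod_gt_0; lra).
  assert (Hy0 : y <> 0) by (apply Cmod_gt_0; lra).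
  assert (Hz0 : z <> 0) by (apply Cmod_gt_0; lra).
  assert (HQ := Cmod_sq_range q Hq).
  assert (hJ := qpoch_self_neq_0 (q ^ 2) HQ).
  assert (tx := thp_neq_0 q Hq x Hx HX).
  assert (ty := thp_neq_0 q Hq y Hy0 (nopole_annulus q y Hq Hy)).
  assert (tz := thp_neq_0 q Hq z Hz0 (nopole_annulus q z Hq Hz)).
  assert (Noy := nopole_opp_annulus q Hq y Hy). assert (Noz := nopole_opp_annulus q Hq z Hz).
  assert (txm := thp_neq_0 (q ^ 2) HQ (- x) (Copp_neq_0 x Hx) HXm).
  assert (tym := thp_neq_0 (q ^ 2) HQ (- y) (Copp_neq_0 y Hy0) Noy).
  assert (tzm := thp_neq_0 (q ^ 2) HQ (- z) (Copp_neq_0 z Hz0) Noz).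
  assert (Hfm : clim G (fun t => - f t) (- x)) by (apply clim_opp; [apply FG | exact Hf]).
  assert (Hfb : forall b : C, clim G (fun t => f t * b) (x * b)).
  { intros b. apply clim_mult; [apply FG | exact Hf | apply clim_const, FG]. }
  assert (K : forall c : C, clim G (fun _ => c) c) by (intros; apply clim_const, FG).
  assert (P : forall b c : C, b <> 0 -> thp q b <> 0 -> c <> 0 -> nopole (q ^ 2) (- c) ->
    clim G (fun t => single_part q (f t) b c) (single_part q x b c)).
  { intros b c Hb Tb Hc Nc. rewrite single_part_eq by assumption.
    eapply clim_ext_loc; [apply FG | |].
    - eapply filter_imp; [|exact Hf0]. intros t Ht. symmetry. apply single_part_eq; assumption.
    - cbv beta. apply clim_mult; [apply FG | apply clim_mult; [apply FG | | apply K] |].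
      + apply clim_div; [apply FG | auto using Cmult_neq_0 | |].
        * apply clim_thp; auto using Cmult_neq_0.
        * apply clim_mult; [apply FG | now apply clim_thp | apply K].
      + apply clim_appell; auto using Cmult_neq_0, Copp_neq_0.
        apply clim_mult; [apply FG | apply K | apply Hfb]. }
  unfold rhs. repeat (apply clim_minus || apply clim_plus); try apply FG.
  - rewrite single_part_eq by assumption.
    apply clim_ext with (fun t => thp (q ^ 2) (y * z) / (thp q y * thp q z) *
      (qpoch q q ^ 2 / qpoch (q ^ 2) (q ^ 2)) * appell (q ^ 2) (q * (y * z)) (- f t)); [apply FG | |].
    + intros t. symmetry. now apply single_part_eq.
    + apply clim_mult; [apply FG | apply K |]. apply clim_appell; auto using Cmult_neq_0, Copp_neq_0.
  - now apply P.
  - now apply P.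
  - rewrite product_part_eq by assumption.
    eapply clim_ext_loc; [apply FG | |].
    + eapply filter_imp; [|exact Hf0]. intros t Ht. symmetry. apply product_part_eq; assumption.
    + cbv beta. apply clim_mult; [apply FG | |].
      * apply clim_mult; [apply FG | apply K |].
        apply clim_div; [apply FG | auto using Cmult_neq_0 | apply K |].
        apply clim_mult; [apply FG | apply clim_mult; [apply FG | | apply K] | apply K]. now apply clim_thp.
      * apply clim_div; [apply FG | auto using Cmult_neq_0 | |].
        -- apply clim_mult; [apply FG | apply clim_mult; [apply FG | |] | apply K];
             apply clim_thp; auto using Cmult_neq_0.
        -- apply clim_mult; [apply FG | apply clim_mult; [apply FG | | apply K] | apply K].
           apply clim_thp; auto using Copp_neq_0.
Qed.

End Continuity.

Theorem theorem1p1 (q x y z : C)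
  (hq : (0 < Cmod q < 1)%R)
  (hx : x <> 0) (hy : y <> 0) (hz : z <> 0)
  (hyq : (Cmod q < Cmod y < 1)%R)
  (hzq : (Cmod q < Cmod z < 1)%R)
  (hxq : forall n : Z, x <> Cpowz q n) :
  ex_sum_over nonneg2 (double_term q x y z) /\
  ex_sum_over neg2 (double_term q x y z) /\
  ((forall n : Z, x <> - Cpowz q (2 * n)) ->
     ex_sum_over all_Z (single_term q (y * z) x) /\
     ex_sum_over all_Z (single_term q (x * y) z) /\
     ex_sum_over all_Z (single_term q (x * z) y) /\
     lhs q x y z = rhs q x y z) /\
  ((exists n : Z, x = - Cpowz q (2 * n)) ->
     filterlim (fun u : C => rhs q u y z) (locally' x)
               (locally (lhs q x y z))).
Proof.
  assert (q0 : q <> 0) by (apply Cmod_gt_0; lra).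
  assert (HQ := Cmod_sq_range q hq).
  assert (HX : nopole q x) by (now apply nopole_iff).
  destruct (lhs_signed q y z hq hyq hzq x hx HX) as [ex1 [ex2 el]].
  (* The identity holds at all nearby points, where no exceptional configuration occurs. *)
  assert (Hnear : punctured x (fun u => Sum (signed_term q u y z) = rhs q u y z)).
  { generalize (filter_and _ _ (punctured_neq_0 x hx)
      (filter_and _ _ (nopole_punctured q 1 x hq C1_nz hx)
      (filter_and _ _ (nopole_punctured (q ^ 2) (- (1)) x HQ (Copp_neq_0 _ C1_nz) hx)
      (filter_and _ _ (nopole_punctured (q ^ 2) (q * y) x HQ (Cmult_neq_0 _ _ q0 hy) hx)
        (nopole_punctured (q ^ 2) (q * z) x HQ (Cmult_neq_0 _ _ q0 hz) hx))))).
    apply filter_imp. intros u [h1 [h2 [h3 [h4 h5]]]].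
    rewrite Cmult_1_r in h2. replace (u * - (1)) with (- u) in h3 by ring.
    rewrite <- (proj2 (proj2 (lhs_signed q y z hq hyq hzq u h1 h2))).
    now apply lhs_eq_rhs_generic. }
  assert (Hlim : clim (punctured x) (fun u => rhs q u y z) (lhs q x y z)).
  { rewrite el. apply clim_ext_loc with (fun u => Sum (signed_term q u y z)); [apply punctured_filter | exact Hnear |].
    apply clim_lhs; try assumption; [apply punctured_filter | apply clim_punctured_id]. }
  split; [exact ex1|]. split; [exact ex2|]. split.
  - intros Hxm.
    assert (HXm : nopole (q ^ 2) (- x)).
    { apply nopole_iff; [apply Cmod_gt_0; lra|]. intros n h. apply (Hxm n).
      rewrite <- Cpowz_sq, <- h by exact q0. ring. }
    split; [|split; [|split]].
    + apply single_term_sum; auto using Cmult_neq_0.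
    + apply single_term_sum; auto using Cmult_neq_0. now apply nopole_opp_annulus.
    + apply single_term_sum; auto using Cmult_neq_0. now apply nopole_opp_annulus.
    + apply (clim_unique (punctured x) (fun u => rhs q u y z)); [exact Hlim|].
      apply clim_rhs; try assumption; [apply punctured_filter | now apply punctured_neq_0 | apply clim_punctured_id].
  - intros _. apply clim_filterlim in Hlim; [|apply punctured_filter].
    intros P HP. apply punctured_locally', Hlim, HP.
Qed.
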